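(* Assume that the Lévy process $\{z_t,t\in[0,T]\}$ is square integrable, and that for each $t$, $\tilde\sigma(t,\cdot,\cdot)$ is Lipschitz continuous when $\mathbb R\times\mathcal P_2(\mathbb R)$ is endowed with the product of the canonical metric on $\mathbb R$ and the Vaserstein metric $d$ on $\mathcal P_2(\mathbb R)$. In addition, assume that for fixed $x\in\mathbb R$ and $\nu\in\mathcal P_2(\mathbb R)$, $\tilde\sigma(\cdot,x,\nu)$ is left continuous with right limits, and that $\int_0^T|\tilde\sigma(s,0,\delta_0)|^2ds<\infty$, where $\delta_0$ is the Dirac measure at $0$. Then the equation $$d\tilde x_t=\tilde\sigma(t,\tilde x_{t-},\mathbb P_{t-})\,r(\tilde\alpha_{t-})\,dz_t,\quad t\in[0,T],\qquad \tilde x_0=\tilde x(0),$$ where $\mathbb P_t$ denotes the probability distribution of $\tilde x_t$, admits a unique strong solution such that $\mathbb E\left(\sup_{t\le T}|\tilde x_t|^2\right)<\infty$.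
   Context: $T>0$ and $(\Omega,\mathcal F,\mathbb P)$ is a complete probability space. $\{z_t\}$ is a Lévy process with values in $\mathbb R$; $\{\tilde\alpha_t,t\in[0,T]\}$ is a (càdlàg) Markov chain on the finite state space $\mathbb S=\{1,\dots,d\}$; $\tilde x(0)$ is a real random variable with $\mathbb E|\tilde x(0)|^2<\infty$; $\tilde x(0)$, $z$ and $\tilde\alpha$ are mutually independent. $\tilde\sigma:[0,T]\times\mathbb R\times\mathcal P(\mathbb R)\to\mathbb R$, where $\mathcal P(\mathbb R)$ is the space of probability measures on $\mathbb R$, and $r:\mathbb R\to\mathbb R$ is a positive continuous function. $\mathbb P_{s-}=\mathbb P\circ\tilde x_{s-}^{-1}$ is the weak limit of $\mathbb P_t$ as $t\to s$ increasingly. $\mathcal P_2(\mathbb R)$ is the space of probability measures on $\mathbb R$ with finite second moment, with the Vaserstein metric $$d(\mu,\nu)=\inf\left\{\left(\int_{\mathbb R\times\mathbb R}|x-y|^2Q(dx,dy)\right)^{1/2}:Q\in\mathcal P(\mathbb R\times\mathbb R)\text{ with marginals }\mu\text{ and }\nu\right\}.$$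
   Formalization: The Lipschitz constant of σ̃(t,·,·) is taken to be the same for all t in [0,T]; with a constant depending on t uniqueness fails, e.g. σ̃ = min(2x⁺/t, t/2) (0 at t = 0), z_t = t, r = 1, x̃(0) = 0 has solutions 0 and t²/4. *)

(* Defs.v *)
From HB Require Import structures.
From mathcomp Require Import all_boot all_order all_algebra.
From mathcomp Require Import all_classical all_reals all_analysis.

Set Implicit Arguments.
Unset Strict Implicit.
Unset Printing Implicit Defensive.

Import Order.TTheory GRing.Theory Num.Theory.
Import numFieldNormedType.Exports.

Local Open Scope classical_set_scope.
Local Open Scope ring_scope.

Section paths.
Context {R : realType}.

Definition left_lim (V : ptopologicalType) (f : R -> V) (t : R) : V :=
  lim (f @ t^'-).

Definition cadlag_on (V : ptopologicalType) (T : R) (f : R -> V) : Prop :=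
  (forall t, 0 <= t < T -> f @ t^'+ --> f t) /\
  (forall t, 0 < t <= T -> cvg (f @ t^'-)).

Definition caglad_on (V : ptopologicalType) (T : R) (f : R -> V) : Prop :=
  (forall t, 0 < t <= T -> f @ t^'- --> f t) /\
  (forall t, 0 <= t < T -> cvg (f @ t^'+)).

End paths.

Section wasserstein.
Context {R : realType}.
Implicit Types mu nu : probability R R.

Definition in_P2 mu : Prop := (\int[mu]_x ((x ^+ 2)%:E) < +oo)%E.

Definition coupling mu nu (Q : probability (R * R)%type R) : Prop :=
  forall A : set R, measurable A ->
    Q (A `*` [set: R]) = mu A /\ Q ([set: R] `*` A) = nu A.

Definition W2 mu nu : \bar R :=
  ereal_inf [set ((\int[Q]_p (((p.1 - p.2) ^+ 2)%:E)) `^ 2^-1)%E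
            | Q in coupling mu nu].

(* The product metric on R x P_2(R) is the sum of the two metrics.  The
   Lipschitz constant K does not depend on the time t in [0, T]: otherwise
   sigma t x mu := min (2 x^+ / t) (t / 2), extended by 0 at t = 0, with
   z_t = t and r = 1, has the two solutions 0 and t^2 / 4 started at 0. *)
Definition lipschitz_on_P2 (T : R) (sigma : R -> R -> probability R R -> R) :=
  exists K : R, forall t, 0 <= t <= T ->
    forall x y mu nu, in_P2 mu -> in_P2 nu ->
    (`|sigma t x mu - sigma t y nu|%:E <= K%:E * (`|x - y|%:E + W2 mu nu))%E.

End wasserstein.

Section processes.
Context {R : realType} {d : measure_display} {Omega : measurableType d}.
Variable P : probability Omega R.

Definition sq_integrable (X : Omega -> R) : Prop :=
  (\int[P]_w ((X w ^+ 2)%:E) < +oo)%E.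

(* mutual independence of X 0, ..., X n.-1 *)
Definition independent_RVs (n : nat) (X : nat -> Omega -> R) : Prop :=
  forall A : nat -> set R, (forall i, measurable (A i)) ->
    P (\bigcap_(i < n) (X i @^-1` A i)) =
    (\prod_(i < n) fine (P (X i @^-1` A i)))%:E.

Record levy_process (T : R) (z : R -> {RV P >-> R}) : Prop := {
  levy_start : \forall w \ae P, z 0 w = 0;
  levy_independent_increments : forall (n : nat) (tt : nat -> R),
    0 <= tt 0%N -> (forall i, (i < n)%N -> tt i <= tt i.+1) -> tt n <= T ->
    independent_RVs n (fun i w => z (tt i.+1) w - z (tt i) w);
  levy_stationary_increments : forall s h, 0 <= s -> 0 <= h -> s + h <= T ->
    forall A : set R, measurable A ->
    P ((fun w => z (s + h) w - z s w) @^-1` A) = P (z h @^-1` A);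
  levy_stochastically_continuous : forall t, 0 <= t <= T ->
    forall e, 0 < e ->
    P [set w | e <= `|z s w - z t w|] @[s --> within `[0, T] (nbhs t)]
      --> (0 : \bar R);
  levy_cadlag : \forall w \ae P, cadlag_on T (fun t => z t w)
}.

Definition cond_prob (A B : set Omega) : R :=
  fine (P (A `&` B)) / fine (P B).

(* a (possibly time-inhomogeneous) Markov chain with state space {1, ..., m} *)
Record markov_chain (T : R) (m : nat) (a : R -> {RV P >-> nat}) : Prop := {
  chain_state : forall t w, 0 <= t <= T -> (1 <= a t w <= m)%N;
  chain_markov : forall (n : nat) (tt : nat -> R) (i : nat -> nat),
    0 <= tt 0%N -> (forall k, (k <= n)%N -> tt k < tt k.+1) ->
    tt n.+1 <= T ->
    let past := \bigcap_(k < n.+1) (a (tt k) @^-1` [set i k]) in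
    (0 < P past)%E ->
    cond_prob (a (tt n.+1) @^-1` [set i n.+1]) past =
    cond_prob (a (tt n.+1) @^-1` [set i n.+1]) (a (tt n) @^-1` [set i n]);
  chain_cadlag : \forall w \ae P, cadlag_on T (fun t => a t w)
}.

(* events observable from a process X up to time t *)
Definition events_upto d' (V : measurableType d') (X : R -> Omega -> V)
    (t : R) : set_system Omega :=
  [set B | exists s A, [/\ 0 <= s <= t, measurable A & B = X s @^-1` A]].

Definition independent3 (G1 G2 G3 : set_system Omega) : Prop :=
  forall A B C, G1 A -> G2 B -> G3 C ->
    P (A `&` B `&` C) = (P A * P B * P C)%E.

Definition independent_data (T : R) (x0 : {RV P >-> R})
    (z : R -> {RV P >-> R}) (a : R -> {RV P >-> nat}) : Prop :=
  independent3 (preimage_set_system setT x0 measurable)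
    <<s events_upto z T >> <<s events_upto a T >>.

(* the P-completed filtration generated by the data of the equation *)
Definition data_filtration (x0 : {RV P >-> R}) (z : R -> {RV P >-> R})
    (a : R -> {RV P >-> nat}) (t : R) : set_system Omega :=
  <<s preimage_set_system setT x0 measurable `|` events_upto z t
      `|` events_upto a t `|` [set N | P.-negligible N] >>.

Section stochastic_integral.
Variables (T : R) (F : R -> set_system Omega).

Definition F_measurable (t : R) (X : Omega -> R) : Prop :=
  forall A : set R, measurable A -> F t (X @^-1` A).

Definition adapted (X : R -> Omega -> R) : Prop :=
  forall t, 0 <= t <= T -> F_measurable t (X t).

Record simple_process := SimpleProcess {
  sp_size : nat;
  sp_time : nat -> R;
  sp_coef : nat -> Omega -> R;
  sp_time0 : 0 <= sp_time 0%N;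
  sp_timeS : forall i, (i < sp_size)%N -> sp_time i <= sp_time i.+1;
  sp_timeT : sp_time sp_size <= T;
  sp_adapted : forall i, (i < sp_size)%N ->
    F_measurable (sp_time i) (sp_coef i);
  sp_sq_integrable : forall i, (i < sp_size)%N -> sq_integrable (sp_coef i)
}.

Definition sp_val (phi : simple_process) (s : R) (w : Omega) : R :=
  \sum_(i < sp_size phi)
    sp_coef phi i w * ((sp_time phi i < s <= sp_time phi i.+1)%R)%:R.

Definition sp_integral (phi : simple_process) (z : R -> Omega -> R) (t : R)
    (w : Omega) : R :=
  \sum_(i < sp_size phi) sp_coef phi i w *
    (z (Num.min t (sp_time phi i.+1)) w - z (Num.min t (sp_time phi i)) w).

(* Y t = \int_0^t H s dz s for t in [0, T], in the Ito sense: L^2 limit of the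
   integrals of simple processes converging to H in L^2(dt * P).  For a square
   integrable Levy process z this determines each Y t almost surely. *)
Definition stochastic_integral (H z Y : R -> Omega -> R) : Prop :=
  exists phi : nat -> simple_process,
    (\int[P]_w \int[lebesgue_measure]_(s in `[0%R, T])
       (((sp_val (phi n) s w - H s w) ^+ 2)%:E) @[n --> \oo] --> 0)%E /\
    forall t, 0 <= t <= T ->
      (\int[P]_w (((sp_integral (phi n) z t w - Y t w) ^+ 2)%:E)
         @[n --> \oo] --> 0)%E.

End stochastic_integral.

Definition has_law (X : Omega -> R) (mu : probability R R) : Prop :=
  forall A : set R, measurable A -> mu A = P (X @^-1` A).

(* d x_t = sigma (t, x_{t-}, P_{t-}) r (a_{t-}) d z_t, x_0 = x0, where
   P_{t-} = nu t is the law of x_{t-}; the value at t = 0 of the integrand is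
   irrelevant. *)
Record strong_solution (T : R) (sigma : R -> R -> probability R R -> R)
    (r : R -> R) (x0 : {RV P >-> R}) (z : R -> {RV P >-> R})
    (a : R -> {RV P >-> nat}) (x : R -> Omega -> R) : Prop := {
  sol_adapted : adapted T (data_filtration x0 z a) x;
  sol_cadlag : \forall w \ae P, cadlag_on T (fun t => x t w);
  sol_start : \forall w \ae P, x 0 w = x0 w;
  sol_equation : exists nu : R -> probability R R,
    (forall t, 0 < t <= T -> has_law (fun w => left_lim (x^~ w) t) (nu t)) /\
    stochastic_integral T (data_filtration x0 z a)
      (fun t w => sigma t (left_lim (x^~ w) t) (nu t) *
                  r (left_lim (fun s => a s w) t)%:R)
      z
      (fun t w => x t w - x0 w)
}.

Definition sup_sq_integrable (T : R) (x : R -> Omega -> R) : Prop :=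
  (\int[P]_w ereal_sup [set ((x t w ^+ 2)%:E) | t in `[0%R, T]] < +oo)%E.

End processes.

(* Main.v *)
Require Import Defs.
From HB Require Import structures.
From mathcomp Require Import all_boot all_order all_algebra.
From mathcomp Require Import all_classical all_reals all_analysis.
From mathcomp Require Import measurable_realfun ring lra.
Set Implicit Arguments.
Unset Strict Implicit.
Unset Printing Implicit Defensive.
Import Order.TTheory GRing.Theory Num.Theory.
Import numFieldNormedType.Exports.
Local Open Scope classical_set_scope.
Local Open Scope ring_scope.

(* Write z_t = b t + M_t.  Stationarity and independence of the increments make the mean
   and the variance of z_t additive in t, hence linear, so M is a square integrable
   martingale with E (M_t - M_s)^2 = c (t - s).  For step processes the Ito isometry for M,
   Doob's inequality and Cauchy-Schwarz for the drift give
     E sup_{t <= T} (I(phi)_t - I(psi)_t)^2 <= C |phi - psi|^2  in L^2(dt * P).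
   The integrand H_x = sigma (t, x_{t-}, law of x_{t-}) r (a_{t-}) is the limit of its
   values at dyadic times, so it is approximable by step processes, and
     E (H_x - H_y)^2 (t) <= L E (x_{t-} - y_{t-})^2,
   because r is bounded on the finite state space and the joint law of (x_{t-}, y_{t-}) is a
   coupling of the two laws.  A bound E (x_u - y_u)^2 <= A e^(b u) is therefore improved to
   (A / 2) e^(b t) by the equation as soon as b is large: this gives uniqueness, and makes
   the Picard iterates x0 + I(phi_k), with phi_k a step process within 8^-k of the
   integrand of the previous iterate, converge uniformly on [0, T] almost surely. *)

(** * Square integrable random variables *)

(** Additivity alone does not give linearity. The variance is nonnegative and additive, hence
    monotone and bounded; the mean is bounded near 0 by stochastic continuity and a Chebyshev
    argument, then on [0, T] by additivity. Suprema over all times need not be measurable, and left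
    limits exist only almost surely and after time 0. So suprema are replaced by integrable
    majorants, obtained at dyadic times and extended by right continuity, and the integral
    inequalities are stated for functions that may fail to be measurable. The Ito integral is given
    only through some approximating sequence. Comparing two integrals means comparing step processes
    on unrelated grids, so the isometry is proved for intervals that may overlap. For existence no
    integral is constructed beforehand: the step processes of the iteration are the approximating
    sequence of the limit. The rate 8^-k leaves room for a weight: the squared uniform increments
    have mean of order 8^-k, remain summable after multiplication by 4^k, and the square root of a
    majorant of this sum, times 2^-k, bounds the k-th increment at all times. *)

Section integral_toolkit.
Context d (T : measurableType d) (R : realType).
Variable mu : {measure set T -> \bar R}.
Local Open Scope ereal_scope.

(* The integral of a nonnegative function is a supremum over simple functions, hence
   monotone even on functions that are not measurable. *)
Lemma ge0_mono_integral (D : set T) (f g : T -> \bar R) :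
  (forall x, D x -> 0 <= f x) -> (forall x, D x -> f x <= g x) ->
  \int[mu]_(x in D) f x <= \int[mu]_(x in D) g x.
Proof.
move=> f0 fg; have g0 x : D x -> 0 <= g x.
  by move=> Dx; exact: le_trans (f0 _ Dx) (fg _ Dx).
rewrite !ge0_integralE//.
apply: le_ereal_sup => _ /= [h hf <-]; exists h => // x.
apply: le_trans (hf x) _; rewrite /patch; case: ifPn => // /set_mem Dx.
exact: fg.
Qed.

Lemma ae_ge0_mono_integral (f g : T -> \bar R) :
  (forall x, 0 <= f x) -> (forall x, 0 <= g x) -> measurable_fun setT g ->
  {ae mu, forall x, f x <= g x} -> \int[mu]_x f x <= \int[mu]_x g x.
Proof.
move=> f0 g0 mg [N [mN N0 fgN]].
(* Raising [g] to +oo on the null set gives a measurable function with the same integral that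
   dominates [f] everywhere, although [f] need not be measurable. *)
pose g' x := maxe (g x) (if x \in N then +oo else 0).
have mg' : measurable_fun setT g'.
  apply: measurable_maxe => //; apply: measurable_fun_if => //.
  by apply: (measurable_fun_bool true); rewrite setTI preimage_mem_true.
have -> : \int[mu]_x g x = \int[mu]_x g' x.
  apply: ge0_ae_eq_integral => //.
  - by move=> x _; rewrite /g' le_max g0.
  - exists N; split => // x /= /not_implyP[_]; apply: contra_notP => Nx.
    by rewrite /g' memNset// max_l.
apply: ge0_mono_integral => // x _; rewrite /g' le_max.
have [xN|xN] := boolP (x \in N); first by rewrite leey orbT.
apply/orP; left; rewrite leNgt; apply/negP => gf; move/negP: xN; apply.
by rewrite inE; apply: fgN => /=; apply/negP; rewrite -ltNge.
Qed.

Lemma ae_ge0_eq_integral (f g : T -> \bar R) :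
  (forall x, 0 <= f x) -> (forall x, 0 <= g x) -> measurable_fun setT g ->
  {ae mu, forall x, f x = g x} -> \int[mu]_x f x = \int[mu]_x g x.
Proof.
move=> f0 g0 mg fg; apply/eqP; rewrite eq_le; apply/andP; split.
  by apply: ae_ge0_mono_integral => //; apply: filterS fg => x ->.
have [N [mN N0 fgN]] := fg.
rewrite (ge0_negligible_integral _ _ _ _ N0)// integral_mkcond.
apply: ge0_mono_integral => x _; rewrite /patch; case: ifPn => //.
rewrite inE => -[_ Nx]; rewrite leNgt; apply/negP => fx; apply: Nx; apply: fgN.
by move=> /= fgx; rewrite fgx ltxx in fx.
Qed.

End integral_toolkit.

Section square_integrable.
Context d (T : measurableType d) (R : realType) (P : probability T R).
Implicit Types X Y : T -> R.

Definition L1 X := P.-integrable setT (EFin \o X).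
Definition L2 X := measurable_fun setT X /\ sq_integrable P X.
Definition Ex X : R := (\int[P]_w X w)%R.

Lemma L1_meas X : L1 X -> measurable_fun setT X.
Proof. by move=> /measurable_int/measurable_EFinP. Qed.

Lemma L2_sq X : L2 X -> L1 (fun w => X w ^+ 2).
Proof.
move=> [mX iX]; apply/integrableP; split.
  exact/measurable_EFinP/measurable_funX.
by apply: le_lt_trans iX; under eq_integral do rewrite gee0_abs ?lee_fin ?sqr_ge0//.
Qed.

Lemma L2P X : measurable_fun setT X -> L1 (fun w => X w ^+ 2) -> L2 X.
Proof.
move=> mX /integrableP[_ iX]; split=> //.
apply: le_lt_trans iX; rewrite le_eqVlt; apply/orP; left; apply/eqP.
by apply: eq_integral => w _; rewrite gee0_abs ?lee_fin ?sqr_ge0.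
Qed.

Lemma L1_le X Y : measurable_fun setT X -> L1 Y ->
  (forall w, `|X w| <= `|Y w|) -> L1 X.
Proof.
move=> mX iY XY; apply: (le_integrable _ _ _ iY) => //.
  exact/measurable_EFinP.
by move=> w _ /=; rewrite lee_fin.
Qed.

Lemma L1_cst (c : R) : L1 (fun=> c).
Proof. exact: finite_measure_integrable_cst. Qed.

Lemma L1D X Y : L1 X -> L1 Y -> L1 (fun w => X w + Y w).
Proof. by move=> iX iY; exact: (integrableD _ iX iY). Qed.

Lemma L1Z c X : L1 X -> L1 (fun w => c * X w).
Proof. by move=> iX; exact: (integrableZl _ _ iX). Qed.

Lemma L1N X : L1 X -> L1 (fun w => - X w).
Proof. by move=> iX; exact: (integrableN iX). Qed.

Lemma L1B X Y : L1 X -> L1 Y -> L1 (fun w => X w - Y w).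
Proof. by move=> iX /L1N iY; exact: L1D. Qed.

Lemma L1_sum (I : Type) (s : seq I) (F : I -> T -> R) :
  (forall i, L1 (F i)) -> L1 (fun w => \sum_(i <- s) F i w).
Proof.
move=> iF; elim: s => [|i s IH].
  by under eq_fun do rewrite big_nil; exact: L1_cst.
by under eq_fun do rewrite big_cons; exact: L1D.
Qed.

Lemma L2_cst (c : R) : L2 (fun=> c).
Proof. by apply: L2P => //; exact: L1_cst. Qed.

Lemma L2M X Y : L2 X -> L2 Y -> L1 (fun w => X w * Y w).
Proof.
move=> hX hY; apply: (@L1_le _ (fun w => X w ^+ 2 + Y w ^+ 2)).
- by apply: measurable_funM; [case: hX|case: hY].
- by apply: L1D; exact: L2_sq.
- move=> w; rewrite (@ger0_norm _ (_ + _)) ?addr_ge0 ?sqr_ge0//.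
  rewrite ler_norml; apply/andP; split.
    have := sqr_ge0 (X w + Y w); have := sqr_ge0 (X w); have := sqr_ge0 (Y w).
    rewrite !expr2; nra.
  have := sqr_ge0 (X w - Y w); have := sqr_ge0 (X w); have := sqr_ge0 (Y w).
  by rewrite !expr2; nra.
Qed.

Lemma L2_L1 X : L2 X -> L1 X.
Proof.
move=> hX; have := L2M hX (L2_cst 1); congr L1.
by apply/funext => w; rewrite mulr1.
Qed.

Lemma L2D X Y : L2 X -> L2 Y -> L2 (fun w => X w + Y w).
Proof.
move=> hX hY; apply: L2P.
  by apply: measurable_funD; [case: hX|case: hY].
have := L1D (L1D (L2_sq hX) (L2_sq hY)) (L1Z 2 (L2M hX hY)); congr L1.
by apply/funext => w; ring.
Qed.

Lemma L2Z c X : L2 X -> L2 (fun w => c * X w).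
Proof.
move=> hX; apply: L2P; first by apply: measurable_funM => //; case: hX.
have := L1Z (c ^+ 2) (L2_sq hX); congr L1; apply/funext => w; ring.
Qed.

Lemma L2N X : L2 X -> L2 (fun w => - X w).
Proof. by move=> /(L2Z (-1)); congr L2; apply/funext => w; rewrite mulN1r. Qed.

Lemma L2B X Y : L2 X -> L2 Y -> L2 (fun w => X w - Y w).
Proof. by move=> hX /L2N hY; exact: L2D. Qed.

Lemma L2_sum (I : eqType) (s : seq I) (F : I -> T -> R) :
  (forall i, i \in s -> L2 (F i)) -> L2 (fun w => \sum_(i <- s) F i w).
Proof.
elim: s => [|i s IH] iF.
  by under eq_fun do rewrite big_nil; exact: L2_cst.
under eq_fun do rewrite big_cons; apply: L2D; first exact/iF/mem_head.
by apply: IH => j js; apply: iF; rewrite inE js orbT.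
Qed.

Lemma L2_le X Y : measurable_fun setT X -> L2 Y ->
  (forall w, `|X w| <= `|Y w|) -> L2 X.
Proof.
move=> mX hY XY; apply: L2P => //; apply: L1_le (L2_sq hY) _.
  exact: measurable_funX.
by move=> w; rewrite !normrX lerXn2r ?nnegrE.
Qed.

Lemma L2_norm X : L2 X -> L2 (fun w => `|X w|).
Proof.
move=> hX; apply: (L2_le _ hX); last by move=> w; rewrite normr_id.
by case: hX => mX _; exact: measurableT_comp.
Qed.

Lemma ExD X Y : L1 X -> L1 Y -> Ex (fun w => X w + Y w) = Ex X + Ex Y.
Proof. by move=> iX iY; exact: RintegralD. Qed.

Lemma ExZ c X : L1 X -> Ex (fun w => c * X w) = c * Ex X.
Proof. by move=> iX; exact: RintegralZl. Qed.

Lemma Ex_cst c : Ex (fun=> c) = c.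
Proof.
by rewrite /Ex Rintegral_cst//= probability_setT mulr1.
Qed.

Lemma ExN X : L1 X -> Ex (fun w => - X w) = - Ex X.
Proof.
move=> iX; rewrite -[RHS]mulN1r -ExZ//.
by congr Ex; apply/funext => w; rewrite mulN1r.
Qed.

Lemma ExB X Y : L1 X -> L1 Y -> Ex (fun w => X w - Y w) = Ex X - Ex Y.
Proof. by move=> iX iY; rewrite ExD ?ExN//; exact: L1N. Qed.

Lemma Ex_sum (I : Type) (s : seq I) (F : I -> T -> R) :
  (forall i, L1 (F i)) ->
  Ex (fun w => \sum_(i <- s) F i w) = \sum_(i <- s) Ex (F i).
Proof.
move=> iF; elim: s => [|i s IH].
  by rewrite big_nil; under [in LHS]eq_fun do rewrite big_nil; exact: Ex_cst.
rewrite big_cons; under [in LHS]eq_fun do rewrite big_cons.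
by rewrite ExD ?IH//; exact: L1_sum.
Qed.

Lemma Ex_le X Y : L1 X -> L1 Y -> (forall w, X w <= Y w) -> Ex X <= Ex Y.
Proof. by move=> iX iY XY; exact: le_Rintegral. Qed.

Lemma Ex_ge0 X : (forall w, 0 <= X w) -> 0 <= Ex X.
Proof. by move=> X0; exact: Rintegral_ge0. Qed.

Lemma Ex_int X : L1 X -> (\int[P]_w (X w)%:E)%E = (Ex X)%:E.
Proof. by move=> iX; rewrite /Ex /Rintegral fineK//; exact: integrable_fin_num. Qed.

Lemma Ex_sq_ge X : L2 X -> (Ex X) ^+ 2 <= Ex (fun w => X w ^+ 2).
Proof.
move=> hX; have hX1 := L2_L1 hX; have hX2 := L2_sq hX.
rewrite -subr_ge0.
have -> : Ex (fun w => X w ^+ 2) - Ex X ^+ 2 =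
    Ex (fun w => (X w - Ex X) ^+ 2).
  transitivity (Ex (fun w => X w ^+ 2 - (2 * Ex X * X w - Ex X ^+ 2))).
    rewrite ExB//; last by apply: L1B; [exact: L1Z|exact: L1_cst].
    rewrite ExB; [|exact: L1Z|exact: L1_cst].
    by rewrite ExZ// Ex_cst; ring.
  by congr Ex; apply/funext => w; ring.
by apply: Ex_ge0 => w; exact: sqr_ge0.
Qed.

Lemma Ex_ae_eq X Y : L1 X -> L1 Y -> {ae P, forall w, X w = Y w} -> Ex X = Ex Y.
Proof.
move=> iX iY XY; rewrite /Ex /Rintegral; congr fine; apply: ae_eq_integral => //.
- exact: measurable_int iX.
- exact: measurable_int iY.
- by apply: filterS XY => w -> _.
Qed.

End square_integrable.

(** * Measurability with respect to a generated sigma-algebra *)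

Section generated_measurability.
Context d (T : measurableType d) (R : realType) (G : set (set T)).

(** Stated through the generators [G], so that [F_measurable] for the data filtration at time t is
    convertible to [gmeas] for its generators [data_events]. *)
Definition gmeas (X : T -> R) : Prop :=
  forall A : set R, measurable A -> <<s G >> (X @^-1` A).

Lemma gmeasP (X : T -> R) :
  gmeas X <-> measurable_fun [set: g_sigma_algebraType G] X.
Proof.
split=> [h _ A mA|h A mA]; first by rewrite setTI; exact: h.
by rewrite -[_ @^-1` _]setTI; exact: h.
Qed.

Lemma gmeas_cst (c : R) : gmeas (fun=> c).
Proof. by apply/gmeasP; exact: measurable_cst. Qed.

Lemma gmeasD (X Y : T -> R) :
  gmeas X -> gmeas Y -> gmeas (fun w => X w + Y w).
Proof. by move=> /gmeasP ? /gmeasP ?; apply/gmeasP; exact: measurable_funD. Qed.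

Lemma gmeasB (X Y : T -> R) :
  gmeas X -> gmeas Y -> gmeas (fun w => X w - Y w).
Proof. by move=> /gmeasP ? /gmeasP ?; apply/gmeasP; exact: measurable_funB. Qed.

Lemma gmeasM (X Y : T -> R) :
  gmeas X -> gmeas Y -> gmeas (fun w => X w * Y w).
Proof. by move=> /gmeasP ? /gmeasP ?; apply/gmeasP; exact: measurable_funM. Qed.

Lemma gmeas_comp (f : R -> R) (X : T -> R) :
  measurable_fun setT f -> gmeas X -> gmeas (f \o X).
Proof. by move=> mf /gmeasP mX; apply/gmeasP; exact: measurableT_comp. Qed.

Lemma gmeas_max (X Y : T -> R) :
  gmeas X -> gmeas Y -> gmeas (fun w => Num.max (X w) (Y w)).
Proof. by move=> /gmeasP ? /gmeasP ?; apply/gmeasP; exact: measurable_maxr. Qed.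

Lemma gmeas_sum (I : Type) (s : seq I) (F : I -> T -> R) :
  (forall i, gmeas (F i)) -> gmeas (fun w => \sum_(i <- s) F i w).
Proof.
move=> mF; elim: s => [|i s IH].
  by under eq_fun do rewrite big_nil; exact: gmeas_cst.
by under eq_fun do rewrite big_cons; exact: gmeasD.
Qed.

Lemma gmeas_cvg (X_ : nat -> T -> R) (X : T -> R) :
  (forall n, gmeas (X_ n)) -> (forall w, X_ n w @[n --> \oo] --> X w) ->
  gmeas X.
Proof.
move=> mX XX; apply/gmeasP.
apply: (@measurable_fun_cvg _ (g_sigma_algebraType G) R setT X_) => // n.
exact/gmeasP.
Qed.

Lemma gmeas_setI (A B : set T) : <<s G >> A -> <<s G >> B -> <<s G >> (A `&` B).
Proof. exact: (@measurableI _ (g_sigma_algebraType G)). Qed.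

Lemma gmeas_setU (A B : set T) : <<s G >> A -> <<s G >> B -> <<s G >> (A `|` B).
Proof. exact: (@measurableU _ (g_sigma_algebraType G)). Qed.

Lemma gmeas_setC (A : set T) : <<s G >> A -> <<s G >> (~` A).
Proof. exact: (@measurableC _ (g_sigma_algebraType G)). Qed.

Lemma gmeas_setT : <<s G >> [set: T].
Proof. exact: (@measurableT _ (g_sigma_algebraType G)). Qed.

Lemma gmeas_measurable (X : T -> R) :
  G `<=` measurable -> gmeas X -> measurable_fun setT X.
Proof.
move=> Gm mX _ A mA; rewrite setTI.
by have := mX _ mA; apply: smallest_sub => //; exact: sigma_algebra_measurable.
Qed.

End generated_measurability.

Lemma gmeas_sub d (T : measurableType d) (R : realType) (G H : set (set T))
    (X : T -> R) : G `<=` <<s H >> -> gmeas G X -> gmeas H X.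
Proof.
move=> GH mX A mA; by have := mX _ mA; apply: smallest_sub => //; exact: smallest_sigma_algebra.
Qed.

Section null_sets.
Context d (T : measurableType d) (R : realType) (P : probability T R).
Context (G : set (set T)) (Gnull : forall N, P.-negligible N -> <<s G >> N).

Lemma gmeas_ae_eq (X Y : T -> R) :
  gmeas G X -> {ae P, forall w, X w = Y w} -> gmeas G Y.
Proof.
move=> mX XY A mA.
pose N := [set w | X w <> Y w].
have hN : P.-negligible N by exact: XY.
have -> : Y @^-1` A = (X @^-1` A `&` ~` N) `|` (Y @^-1` A `&` N).
  apply/seteqP; split=> [w /= YA|w /= [[XA Nw]|[]//]].
    have [XYw|XYw] := pselect (X w = Y w).
      by left; rewrite XYw; split => //; exact.
    by right.
  by have -> : Y w = X w by apply/esym; exact: contrapT.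
apply: gmeas_setU; last first.
  apply: Gnull; apply: negligibleS hN; exact: subIsetr.
by apply: gmeas_setI; [exact: mX|apply: gmeas_setC; exact: Gnull].
Qed.

End null_sets.

(** * Independence and expectations of products *)

Section independence.
Context d (T : measurableType d) (R : realType) (P : probability T R).

Definition indep_of (G : set (set T)) (Y : T -> R) : Prop :=
  forall A B, G B -> measurable A ->
    P (B `&` Y @^-1` A) = (P B * P (Y @^-1` A))%E.

(** Uniqueness of measures on a pi-system, applied to [P] restricted to [D] and to [P] scaled by
    [P D]. *)
Lemma pi_system_indep (G : set (set T)) (D : set T) :
  G `<=` measurable -> setI_closed G -> G setT -> measurable D ->
  (forall A, G A -> P (A `&` D) = (P A * P D)%E) ->
  forall A, <<s G >> A -> P (A `&` D) = (P A * P D)%E.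
Proof.
move=> Gm GI GT mD h A GA.
have PD : P D \is a fin_num by exact: fin_num_measure.
have PD0 : 0 <= fine (P D) by rewrite fine_ge0.
have hs B : mscale (NngNum PD0) P B = (P B * P D)%E.
  by rewrite /mscale/= fineK// muleC.
have -> : (P A * P D)%E = mscale (NngNum PD0) P A by rewrite hs.
have -> : P (A `&` D) = mrestr P mD A by [].
apply: (g_sigma_algebra_measure_unique G Gm (fun=> setT)) => //.
- by rewrite bigcup_const//; exists 0%N.
- by move=> B GB; rewrite [RHS]hs; exact: h.
- by move=> _; rewrite /= /mrestr setTI -ge0_fin_numE.
Qed.

Lemma indep_of_sigma (G : set (set T)) (Y : T -> R) :
  G `<=` measurable -> setI_closed G -> G setT -> measurable_fun setT Y ->
  indep_of G Y -> indep_of <<s G >> Y.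
Proof.
move=> Gm GI GT mY h A B GB mA; apply: pi_system_indep GB => //.
  by rewrite -[_ @^-1` _]setTI; exact: mY.
by move=> C GC; exact: h.
Qed.

Lemma indep_of_null (Y : T -> R) (N : set T) (A : set R) :
  measure_is_complete P -> measurable_fun setT Y ->
  P.-negligible N -> measurable A ->
  P (N `&` Y @^-1` A) = (P N * P (Y @^-1` A))%E.
Proof.
move=> Pc mY hN mA.
have mN := Pc _ hN.
have mYA : measurable (Y @^-1` A) by rewrite -[_ @^-1` _]setTI; exact: mY.
have PN : P N = 0%E by apply: measure_negligible.
by rewrite PN mul0e; apply: subset_measure0 PN => //; exact: measurableI.
Qed.

Section product_expectation.
Context (G : set (set T)) (Gm : G `<=` measurable) (X Y : T -> R).
Context (mX : gmeas G X) (mY : measurable_fun setT Y) (XY : indep_of <<s G >> Y).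
Context (iX : L1 P X) (iY : L1 P Y).

Let mX' : measurable_fun setT X := gmeas_measurable Gm mX.
Let X' : {mfun T >-> R} := HB.pack X (isMeasurableFun.Build _ _ _ _ _ mX').
Let Y' : {mfun T >-> R} := HB.pack Y (isMeasurableFun.Build _ _ _ _ _ mY).
Let mXY : measurable_fun setT (fun w => (X w, Y w)).
Proof. exact: measurable_fun_pair. Qed.
Let Z : {mfun T >-> (R * R)%type} :=
  HB.pack (fun w => (X w, Y w)) (isMeasurableFun.Build _ _ _ _ _ mXY).
Let m1 := distribution P X'.
Let m2 := distribution P Y'.

(** On rectangles this is the independence hypothesis, and rectangles determine the product measure.
    Tonelli and Fubini on the product then give both lemmas on [X w * Y w]. *)
Let joint A : measurable A -> (m1 \x m2)%E A = distribution P Z A.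
Proof.
move=> mA; apply: product_measure_unique => // B C mB mC.
by rewrite [LHS](XY _ mC)//; exact: mX.
Qed.

Let mprod : measurable_fun setT (fun p : R * R => p.1 * p.2).
Proof. by apply: measurable_funM; [exact: measurable_fst|exact: measurable_snd]. Qed.

Let mN : measurable_fun [set: R] (fun y : R => (`|y|)%:E).
Proof. by apply/measurable_EFinP; exact: normr_measurable. Qed.

Lemma L1_indepM : L1 P (fun w => X w * Y w).
Proof.
have mE : measurable_fun setT (fun p : R * R => (`|p.1 * p.2|)%:E).
  by apply/measurable_EFinP; exact: measurableT_comp.
apply/integrableP; split.
  by apply/measurable_EFinP; exact: measurable_funM.
have -> : (\int[P]_w `|(EFin \o (fun w => X w * Y w)%R) w| =
    \int[distribution P Z]_p (`|p.1 * p.2|)%:E)%E.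
  by rewrite ge0_integral_distribution.
rewrite (eq_measure_integral (m1 \x m2)%E); last first.
  by move=> A mA _; exact/esym/joint.
rewrite fubini_tonelli1//.
rewrite /fubini_F/=.
have iYf : (\int[m2]_y (`|y|)%:E < +oo)%E.
  rewrite ge0_integral_distribution//.
  by case/integrableP : iY.
have iXf : (\int[m1]_x (`|x|)%:E < +oo)%E.
  rewrite ge0_integral_distribution//.
  by case/integrableP : iX.
under eq_integral => x _.
  under eq_integral do rewrite normrM EFinM.
  rewrite ge0_integralZl//.
  over.
rewrite ge0_integralZr//.
- by rewrite lte_mul_pinfty// ?ge0_fin_numE// ?integral_ge0.
- by apply: integral_ge0.
Qed.

Lemma Ex_indepM : Ex P (fun w => X w * Y w) = Ex P X * Ex P Y.
Proof.
rewrite {1}/Ex /Rintegral.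
have mE : measurable_fun setT (fun p : R * R => (p.1 * p.2)%:E).
  exact/measurable_EFinP.
have iXY := L1_indepM.
have -> : (\int[P]_w (X w * Y w)%:E = \int[distribution P Z]_p (p.1 * p.2)%:E)%E.
  by rewrite integral_distribution.
rewrite (eq_measure_integral (m1 \x m2)%E); last first.
  by move=> A mA _; exact/esym/joint.
have iD : (m1 \x m2)%E.-integrable setT (fun p : R * R => (p.1 * p.2)%:E).
  apply/integrableP; split => //.
  rewrite (eq_measure_integral (distribution P Z)); last first.
    by move=> A mA _; exact: joint.
  rewrite ge0_integral_distribution//; last exact: measurableT_comp.
  by case/integrableP : iXY.
rewrite -integral12_prod_meas1//= /fubini_F/=.
have jY : m2.-integrable setT (EFin \o id).
  apply/integrableP; split; first exact/measurable_EFinP.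
  rewrite ge0_integral_distribution//.
  by case/integrableP : iY.
have jX : m1.-integrable setT (EFin \o id).
  apply/integrableP; split; first exact/measurable_EFinP.
  rewrite ge0_integral_distribution//.
  by case/integrableP : iX.
have -> : (fun x => \int[m2]_y (x * y)%:E)%E = (fun x => x%:E * (Ex P Y)%:E)%E.
  apply/funext => x; rewrite (integralZl _ jY)//=; congr *%E.
  by rewrite integral_distribution//= Ex_int.
rewrite (integralZr _ jX)//= integral_distribution//= Ex_int//.
Qed.

End product_expectation.
End independence.

(** * Independence of increments from the past *)

Section levy_filtration.
Context (R : realType) (d : measure_display) (Omega : measurableType d).
Context (P : probability Omega R) (Pc : measure_is_complete P) (T : R).
Context (x0 : {RV P >-> R}) (z : R -> {RV P >-> R}) (a : R -> {RV P >-> nat}).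
Context (hz : levy_process T z).

Let mz t : measurable_fun setT (z t).
Proof. exact: measurable_funPT. Qed.

Let mincr s t : measurable_fun setT (fun w => z t w - z s w).
Proof. exact: measurable_funB. Qed.

Section finite_times.
Context (n : nat) (tt : nat -> R).
Context (tt0 : tt 0%N = 0) (ttS : forall i, (i < n.+1)%N -> tt i <= tt i.+1).
Context (ttT : tt n.+1 <= T).

Let Z i w := z (tt i.+1) w - z (tt i) w.

Let rect (A : nat -> set R) := \bigcap_(i < n) (Z i @^-1` A i).

(** A pi-system carrying the first [n] increments. Negligible sets are adjoined because [z 0]
    vanishes only almost surely. *)
Let G : set (set Omega) :=
  [set B | exists2 A, (forall i, measurable (A i)) & B = rect A]
  `|` [set N | P.-negligible N].

Let mrect A : (forall i, measurable (A i)) -> measurable (rect A).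
Proof.
move=> mA; rewrite /rect bigcap_mkord; apply: bigsetI_measurable => i _.
by rewrite -[_ @^-1` _]setTI; exact: mincr.
Qed.

Let Gm : G `<=` measurable.
Proof.
by move=> B [[A mA ->]|]; [exact: mrect|exact: Pc].
Qed.

Let GI : setI_closed G.
Proof.
move=> B C [[A mA ->]|hB] [[A' mA' ->]|hC].
- left; exists (fun i => A i `&` A' i); first by move=> i; exact: measurableI.
  by rewrite /rect -bigcapI; apply: eq_bigcapr => i _; rewrite preimage_setI.
- by right; apply: negligibleS hC; exact: subIsetr.
- by right; apply: negligibleS hB; exact: subIsetl.
- by right; apply: negligibleS hC; exact: subIsetr.
Qed.

Let GT : G setT.
Proof.
left; exists (fun=> setT) => //; rewrite /rect.
by apply/esym; rewrite -subTset => w _ i _.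
Qed.

Let Gindep : indep_of P G (Z n).
Proof.
move=> D B [[A mA ->]|hN] mD; last by apply: indep_of_null => //; exact: mincr.
have hI := levy_independent_increments hz (n := n.+1) (tt := tt).
pose A' E i := if (i < n)%N then A i else E.
have mA' E i : measurable E -> measurable (A' E i) by rewrite /A'; case: ifP.
have A'E E : \bigcap_(i < n.+1) (Z i @^-1` A' E i) = rect A `&` Z n @^-1` E.
  rewrite bigcap_mkord big_ord_recr/= /A' ltnn /rect bigcap_mkord.
  by congr (_ `&` _); apply: eq_bigr => i _; rewrite ltn_ord.
(* The independence of the increments is used twice: with last event [D], and with last event
   [setT], which identifies the product of the first [n] factors as the probability of the
   rectangle. *)
have := hI _ ttS ttT (A' D) (fun i => mA' _ i mD).
have := hI _ ttS ttT (A' setT) (fun i => mA' _ i measurableT).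
rewrite tt0 => /(_ (lexx _)) h1 /(_ (lexx _)) h2.
rewrite -A'E h2 -[in RHS](setIT (rect A)) -(@preimage_setT _ _ (Z n)) -A'E h1.
rewrite !big_ord_recr/= /A' ltnn preimage_setT probability_setT mulr1.
rewrite EFinM fineK//; first by congr (_%:E * _)%E; apply: eq_bigr => i _;
  rewrite ltn_ord.
apply: fin_num_measure.
by rewrite -[_ @^-1` _]setTI; exact: mincr.
Qed.

Let Gnull N : P.-negligible N -> <<s G >> N.
Proof. by move=> hN; apply: sub_sigma_algebra; right. Qed.

Let z_gmeas k : (k <= n)%N -> gmeas G (z (tt k)).
Proof.
elim: k => [_|k IH kn].
  rewrite tt0; apply: (@gmeas_ae_eq _ _ _ P G Gnull (fun=> 0 : R)); first exact: gmeas_cst.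
  by apply: filterS (levy_start hz) => w ->.
have -> : z (tt k.+1) = (fun w => z (tt k) w + Z k w) :> (_ -> _).
  by apply/funext => w; rewrite /Z addrC subrK.
apply: (gmeasD (IH (ltnW kn))).
move=> A mA; apply: sub_sigma_algebra; left.
exists (fun i => if i == k then A else setT); first by move=> i; case: ifP.
apply/seteqP; split=> [w ZA i _ /=|w /(_ k kn)]; last by rewrite eqxx.
by case: eqP => // ->.
Qed.

Lemma indep_grid_increment (H : set (set Omega)) :
  (forall B, H B -> exists k A, [/\ (k <= n)%N, measurable A &
     B = z (tt k) @^-1` A]) ->
  indep_of P <<s H >> (Z n).
Proof.
move=> HE A B HB mA.
apply: (@indep_of_sigma _ _ _ P G) => //; first exact: mincr.
move: HB; apply: smallest_sub; first exact: smallest_sigma_algebra.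
by move=> _ /HE[k [C [kn mC ->]]]; exact: z_gmeas.
Qed.

End finite_times.

(** The events that depend on finitely many times up to s form a pi-system generating the past, and
    each finite set of times embeds in a grid that passes through s and ends at t. *)
Lemma levy_indep_past s t : 0 <= s -> s <= t -> t <= T ->
  indep_of P <<s events_upto z s >> (fun w => z t w - z s w).
Proof.
move=> s0 st tT.
pose E (L : seq R) : set (set Omega) :=
  [set B | exists u A, [/\ u \in L, measurable A & B = z u @^-1` A]].
pose ok (L : seq R) := all (fun u => 0 <= u <= s) L.
pose G : set (set Omega) := [set B | exists2 L, ok L & <<s E L >> B].
have Em L : E L `<=` measurable.
  move=> _ [u [A [_ mA ->]]]; rewrite -[_ @^-1` _]setTI; exact: mz.
have Gm : G `<=` measurable.
  move=> B [L _]; apply: smallest_sub => //; exact: sigma_algebra_measurable.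
have ES L L' : {subset L <= L'} -> <<s E L >> `<=` <<s E L' >>.
  move=> LL'; apply: sub_sigma_algebra2 => _ [u [A [uL mA ->]]].
  by exists u, A; split => //; exact: LL'.
have GI : setI_closed G.
  move=> B C [L oL LB] [L' oL' LC]; exists (L ++ L').
    by rewrite /ok all_cat; apply/andP.
  apply: gmeas_setI; [apply: (ES L)|apply: (ES L')] => //.
    by move=> u; rewrite mem_cat => ->.
  by move=> u; rewrite mem_cat => ->; rewrite orbT.
have GT : G setT by exists [::] => //; exact: gmeas_setT.
have Gi : indep_of P G (fun w => z t w - z s w).
  move=> A B [L oL LB] mA.
  (* The grid consists of 0, the sorted times, then s, which is the default value of [nth] at the
     index [size l], and finally t. *)
  pose l := 0 :: sort <=%R L.
  pose n := size l.
  pose tt i := if (i <= n)%N then nth s l i else t.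
  have lsor : path <=%R 0 (sort <=%R L).
    rewrite path_min_sorted ?sort_le_sorted//.
    by apply/allP => u; rewrite mem_sort => /(allP oL)/andP[].
  have ttn : tt n = s by rewrite /tt leqnn nth_default.
  have ttn1 : tt n.+1 = t by rewrite /tt ltnn.
  have ttS i : (i < n.+1)%N -> tt i <= tt i.+1.
    rewrite ltnS leq_eqVlt => /predU1P[->|iltn]; first by rewrite ttn ttn1.
    rewrite /tt (ltnW iltn) iltn.
    have [iltn1|] := ltnP i.+1 n.
      rewrite -[nth s l i.+1]/(nth s (sort <=%R L) i).
      by move/(pathP s) : lsor; apply; rewrite -ltnS.
    move=> ni; rewrite [leRHS]nth_default//.
    have : nth s l i \in l by rewrite mem_nth.
    rewrite inE => /predU1P[->//|].
    by rewrite mem_sort => /(allP oL)/andP[].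
  have := @indep_grid_increment n tt _ ttS _ (E L) _ A B LB mA.
  rewrite ttn ttn1; apply => //.
  move=> _ [u [C [uL mC ->]]].
  have ul : u \in l by rewrite inE mem_sort uL orbT.
  exists (index u l), C; rewrite ltnW ?index_mem//; split => //.
  by rewrite /tt ltnW ?index_mem// nth_index.
move=> A B HB mA; apply: (@indep_of_sigma _ _ _ P G) => //.
move: HB; apply: sub_sigma_algebra2 => _ [u [C [us mC ->]]].
exists [:: u]; first by rewrite /ok/= us.
by apply: sub_sigma_algebra; exists u, C; rewrite inE eqxx.
Qed.

Context (hind : independent_data T x0 z a).

Let F t := data_filtration x0 z a t.

Lemma filtration_null t N : P.-negligible N -> F t N.
Proof. by move=> hN; apply: sub_sigma_algebra; right. Qed.

Lemma filtration_x0 t : F_measurable F t x0.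
Proof.
move=> A mA; apply: sub_sigma_algebra; left; left; left.
by exists A => //; rewrite setTI.
Qed.

Lemma filtration_z s t : 0 <= s <= t -> F_measurable F t (z s).
Proof.
by move=> st A mA; apply: sub_sigma_algebra; left; left; right; exists s, A.
Qed.

Lemma filtration_a s t (A : set nat) : 0 <= s <= t -> F t (a s @^-1` A).
Proof.
by move=> st; apply: sub_sigma_algebra; left; right; exists s, A.
Qed.

Definition data_events t : set (set Omega) :=
  preimage_set_system setT x0 measurable `|` events_upto z t
      `|` events_upto a t `|` [set N | P.-negligible N].

Lemma data_events_measurable t : data_events t `<=` measurable.
Proof.
move=> B [[[|]|]|].
- by move=> [A mA <-]; exact: measurable_funPT.
- by move=> [s [A [_ mA ->]]]; rewrite -[_ @^-1` _]setTI; exact: mz.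
- move=> [s [A [_ mA ->]]]; rewrite -[_ @^-1` _]setTI.
  exact: (@measurable_funPT _ _ _ _ (a s)).
- exact: Pc.
Qed.

Lemma data_events_mono s t : s <= t -> data_events s `<=` data_events t.
Proof.
move=> st B [[[|]|]|].
- by left; left; left.
- move=> [u [A [/andP[u0 us] mA ->]]]; left; left; right.
  by exists u, A; rewrite u0 (le_trans us).
- move=> [u [A [/andP[u0 us] mA ->]]]; left; right.
  by exists u, A; rewrite u0 (le_trans us).
- by right.
Qed.

(** Intersections of an event of [x0], one of the past of [z] and one of the past of [a] form, with
    the negligible sets, a generating pi-system. In the triple independence the increment joins the
    factor of [z], from which [levy_indep_past] splits it off. *)
Lemma filtration_indep s t : 0 <= s -> s <= t -> t <= T ->
  indep_of P (F s) (fun w => z t w - z s w).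
Proof.
move=> s0 st tT.
pose Gx := preimage_set_system setT x0 measurable.
pose Gz := <<s events_upto z s >>.
pose Ga := <<s events_upto a s >>.
pose G : set (set Omega) :=
  [set D | exists A B C, [/\ Gx A, Gz B, Ga C & D = A `&` B `&` C]]
  `|` [set N | P.-negligible N].
have GxI A A' : Gx A -> Gx A' -> Gx (A `&` A').
  move=> [B mB <-] [B' mB' <-]; exists (B `&` B'); first exact: measurableI.
  by rewrite preimage_setI !setTI.
have GxT : Gx setT by exists setT => //; rewrite setTI.
have evz : events_upto z s `<=` measurable.
  by move=> _ [u [A [_ mA ->]]]; rewrite -[_ @^-1` _]setTI; exact: mz.
have eva : events_upto a s `<=` measurable.
  move=> _ [u [A [_ mA ->]]]; rewrite -[_ @^-1` _]setTI.
  exact: (@measurable_funPT _ _ _ _ (a u)).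
have Gxm A : Gx A -> measurable A.
  by move=> [B mB <-]; exact: measurable_funPT.
have Gzm : Gz `<=` measurable.
  by apply: smallest_sub => //; exact: sigma_algebra_measurable.
have Gam : Ga `<=` measurable.
  by apply: smallest_sub => //; exact: sigma_algebra_measurable.
have Gm : G `<=` measurable.
  move=> D [[A [B [C [hA hB hC ->]]]]|]; last exact: Pc.
  by apply: measurableI; [apply: measurableI|]; [exact: Gxm|exact: Gzm|exact: Gam].
have GI : setI_closed G.
  move=> D D' [[A [B [C [hA hB hC ->]]]]|hN] [[A' [B' [C' [hA' hB' hC' ->]]]]|hN'].
  - left; exists (A `&` A'), (B `&` B'), (C `&` C'); split.
    + exact: GxI.
    + exact: gmeas_setI.
    + exact: gmeas_setI.
    + by apply/seteqP; split => w /=; tauto.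
  - by right; apply: negligibleS hN'; exact: subIsetr.
  - by right; apply: negligibleS hN; exact: subIsetl.
  - by right; apply: negligibleS hN; exact: subIsetl.
have GT : G setT.
  left; exists setT, setT, setT; split => //; [exact: gmeas_setT|exact: gmeas_setT|].
  by rewrite !setTI.
have zsT : Gz `<=` <<s events_upto z T >>.
  apply: sub_sigma_algebra2 => _ [u [A [/andP[u0 us] mA ->]]].
  by exists u, A; rewrite u0 (le_trans us)// (le_trans st).
have asT : Ga `<=` <<s events_upto a T >>.
  apply: sub_sigma_algebra2 => _ [u [A [/andP[u0 us] mA ->]]].
  by exists u, A; rewrite u0 (le_trans us)// (le_trans st).
have zi : gmeas (events_upto z T) (fun w => z t w - z s w).
  apply: gmeasB => A mA; apply: sub_sigma_algebra.
    by exists t, A; rewrite tT (le_trans s0).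
  by exists s, A; rewrite s0 (le_trans st).
have hG : indep_of P <<s G >> (fun w => z t w - z s w).
  apply: indep_of_sigma => //.
  move=> D E [[A [B [C [hA hB hC ->]]]]|hN] mD; last first.
    by apply: indep_of_null => //; exact: mincr.
  set Y := (fun w => z t w - z s w).
  have -> : A `&` B `&` C `&` Y @^-1` D = A `&` (B `&` Y @^-1` D) `&` C.
    by apply/seteqP; split => w /=; tauto.
  rewrite (hind hA _ (asT _ hC)); last by apply: gmeas_setI; [exact: zsT|exact: zi].
  rewrite (hind hA (zsT _ hB) (asT _ hC)) levy_indep_past//.
  by rewrite !muleA [(_ * P C)%E]muleAC.
move=> D E HE mD; apply: hG => //.
move: HE; apply: smallest_sub; first exact: smallest_sigma_algebra.
move=> B [[[hB|hB]|hB]|hB]; apply: sub_sigma_algebra.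
- left; exists B, setT, setT; rewrite !setIT; split => //; exact: gmeas_setT.
- left; exists setT, B, setT; rewrite setTI setIT; split => //.
    exact: sub_sigma_algebra.
  exact: gmeas_setT.
- left; exists setT, setT, B; rewrite !setTI; split => //.
    exact: gmeas_setT.
  exact: sub_sigma_algebra.
- by right.
Qed.

End levy_filtration.

(** * Moments of a square integrable Levy process *)

Section additive_functions.
Context (R : realType).

Lemma le_geometric0 (x B : R) : (forall n, x <= B / 2 ^+ n) -> x <= 0.
Proof.
move=> h; rewrite leNgt; apply/negP => x0.
have B0 : 0 < B by have := h 0%N; rewrite expr0 divr1; exact: lt_le_trans.
have := archi_boundP (ltW (divr_gt0 B0 x0)).
set n := Num.bound _ => Bn.
have := h n; apply/negP; rewrite -ltNge ltr_pdivrMr ?exprn_gt0//.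
rewrite mulrC -ltr_pdivrMr//; apply: lt_le_trans Bn _.
by rewrite -natrX ler_nat ltnW// ltn_expl.
Qed.

(* Subtracting the linear interpolant makes [u] vanish at [T]; then u t = - u (T - t),
   and u (t + t) = 2 u t halves any bound of [u]. *)
Lemma additive_bounded_linear (T B : R) (u : R -> R) : 0 < T ->
  (forall s h, 0 <= s -> 0 <= h -> s + h <= T -> u (s + h) = u s + u h) ->
  (forall t, 0 <= t <= T -> `|u t| <= B) ->
  forall t, 0 <= t <= T -> u t = u T / T * t.
Proof.
move=> T0 uD uB t0 t0T.
pose w t := u t - u T / T * t.
have wD s h : 0 <= s -> 0 <= h -> s + h <= T -> w (s + h) = w s + w h.
  by move=> s0 h0 shT; rewrite /w uD//; ring.
have wT : w T = 0 by rewrite /w divfK ?gt_eqF// subrr.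
have wB n : forall t, 0 <= t <= T -> `|w t| <= (B + `|u T|) / 2 ^+ n.
  have half C : (forall t, 0 <= t <= T -> `|w t| <= C) ->
      forall t, 0 <= t <= T -> `|w t| <= C / 2.
    move=> wC.
    have small t : 0 <= t -> t + t <= T -> `|w t| <= C / 2.
      move=> tp ttT; have := wC (t + t); rewrite addr_ge0//= ttT wD//.
      move=> /(_ isT); rewrite -mulr2n normrMn -[_ *+ 2]mulr_natr => h.
      by rewrite ler_pdivlMr.
    move=> t /andP[tp tT].
    have [ttT|ttT] := leP (t + t) T; first exact: small.
    have -> : w t = - w (T - t).
      by apply/eqP; rewrite -addr_eq0 -wD ?subr_ge0// addrC subrK ?wT.
    by rewrite normrN small ?subr_ge0//; lra.
  elim: n => [t /andP[tp tT]|n IH].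
    rewrite expr0 divr1 /w; apply: le_trans (ler_normB _ _) _.
    apply: lerD; first by apply: uB; rewrite tp.
    rewrite !normrM normfV (gtr0_norm T0) (ger0_norm tp) -mulrA ler_piMr// mulrC.
    by rewrite ler_pdivrMr// mul1r.
  by move=> t tT; rewrite exprSr invfM mulrA; exact: half.
have : `|w t0| <= 0 by apply: le_geometric0 => n; exact: wB.
by rewrite normr_le0 subr_eq0 => /eqP.
Qed.

End additive_functions.

Lemma same_law_Ex (R : realType) d (T : measurableType d)
    (P : probability T R) (X Y : T -> R) (f : R -> R) :
  measurable_fun setT X -> measurable_fun setT Y -> measurable_fun setT f ->
  (forall A, measurable A -> P (X @^-1` A) = P (Y @^-1` A)) ->
  L1 P (f \o Y) -> L1 P (f \o X) /\ Ex P (f \o X) = Ex P (f \o Y).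
Proof.
move=> mX mY mf XY ifY.
pose X' : {mfun T >-> R} := HB.pack X (isMeasurableFun.Build _ _ _ _ _ mX).
pose Y' : {mfun T >-> R} := HB.pack Y (isMeasurableFun.Build _ _ _ _ _ mY).
have XYd (g : R -> \bar R) :
    (\int[distribution P X']_x g x = \int[distribution P Y']_x g x)%E.
  by apply: eq_measure_integral => A mA _; exact: XY.
have mfe : measurable_fun setT (fun x => (f x)%:E) by exact/measurable_EFinP.
have mfa : measurable_fun setT (fun x => `|(f x)%:E|%E) by exact: measurableT_comp.
have iX : L1 P (f \o X).
  apply/integrableP; split; first exact/measurable_EFinP/measurableT_comp.
  have := @ge0_integral_distribution _ _ _ _ _ P X' _ mfa (fun=> abse_ge0 _).
  rewrite XYd ge0_integral_distribution// => <-.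
  by case/integrableP : ifY.
split => //; rewrite /Ex /Rintegral; congr fine.
have := @integral_distribution _ _ _ _ _ P X' _ mfe iX.
by rewrite XYd integral_distribution.
Qed.

Section levy_moments.
Context (R : realType) (d : measure_display) (Omega : measurableType d).
Context (P : probability Omega R) (Pc : measure_is_complete P).
Context (T : R) (T0 : 0 < T) (z : R -> {RV P >-> R}) (hz : levy_process T z).
Context (hz2 : forall t, 0 <= t <= T -> sq_integrable P (z t)).

Let mz t : measurable_fun setT (z t).
Proof. exact: measurable_funPT. Qed.

Let zL2 t : 0 <= t <= T -> L2 P (z t).
Proof. by move=> /hz2. Qed.

Let D s t w := z t w - z s w.
Let mD s t : measurable_fun setT (D s t).
Proof. exact: measurable_funB. Qed.

Let law f s h : measurable_fun setT f -> 0 <= s -> 0 <= h -> s + h <= T ->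
  L1 P (f \o z h) ->
  L1 P (f \o D s (s + h)) /\ Ex P (f \o D s (s + h)) = Ex P (f \o z h).
Proof.
move=> mf s0 h0 shT ifz; apply: same_law_Ex => // A mA.
exact: (levy_stationary_increments hz).
Qed.

Let m t := Ex P (z t).
Let q t := Ex P (fun w => z t w ^+ 2).
Let v t := q t - m t ^+ 2.

Let msq : measurable_fun setT (fun x : R => x ^+ 2).
Proof. exact: exprn_measurable. Qed.

Let incr s h : 0 <= s -> 0 <= h -> s + h <= T ->
  [/\ L2 P (D s (s + h)), Ex P (D s (s + h)) = m h &
      Ex P (fun w => D s (s + h) w ^+ 2) = q h].
Proof.
move=> s0 h0 shT; have hh : 0 <= h <= T by rewrite h0/=; lra.
have [i1 e1] := @law id s h (@measurable_id _ _ _) s0 h0 shT (L2_L1 (zL2 hh)).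
have [i2 e2] := law msq s0 h0 shT (L2_sq (zL2 hh)).
by split => //; apply: L2P.
Qed.

Let mE s h : 0 <= s -> 0 <= h -> s + h <= T -> m (s + h) = m s + m h.
Proof.
move=> s0 h0 shT; have [i1 e1 _] := incr s0 h0 shT.
have hs : 0 <= s <= T by rewrite s0/=; lra.
rewrite -e1 /m -ExD; [|exact/L2_L1/zL2|exact: L2_L1].
by congr Ex; apply/funext => w; rewrite /D; ring.
Qed.

Let past s : 0 <= s -> gmeas (events_upto z s) (z s).
Proof.
by move=> s0 A mA; apply: sub_sigma_algebra; exists s, A; rewrite s0 lexx.
Qed.

Let pastm s : events_upto z s `<=` measurable.
Proof.
by move=> _ [u [A [_ mA ->]]]; rewrite -[_ @^-1` _]setTI; exact: mz.
Qed.

(** By independence the cross term of the second moment is [2 * (m s * m h)], which cancels against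
    the square of the mean; the second moment itself is not additive. *)
Let vE s h : 0 <= s -> 0 <= h -> s + h <= T -> v (s + h) = v s + v h.
Proof.
move=> s0 h0 shT; have [i1 e1 e2] := incr s0 h0 shT.
have hs : 0 <= s <= T by rewrite s0/=; lra.
have ssh : s <= s + h by lra.
have h1 := L2_L1 (zL2 hs); have h2 := L2_L1 i1.
have ind := levy_indep_past Pc hz s0 ssh shT.
have iM := L1_indepM (@pastm s) (past s0) (mD s (s + h)) ind h1 h2.
have eM := Ex_indepM (@pastm s) (past s0) (mD s (s + h)) ind h1 h2.
have -> : v (s + h) = q s + q h + 2 * (m s * m h) - (m s + m h) ^+ 2.
  rewrite /v mE//; congr (_ - _).
  rewrite -{1}e2 -{1}e1 -eM /q -ExD; [|exact/L2_sq/zL2|exact: L2_sq].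
  rewrite -ExZ// -ExD; last 2 first.
  - by apply: L1D; [exact/L2_sq/zL2|exact: L2_sq].
  - exact: L1Z.
  by congr Ex; apply/funext => w; rewrite /D; ring.
by rewrite /v; ring.
Qed.

Let v_ge0 t : 0 <= t <= T -> 0 <= v t.
Proof. by move=> /zL2 h; rewrite subr_ge0; exact: Ex_sq_ge. Qed.

Let v_le t : 0 <= t <= T -> v t <= v T.
Proof.
move=> /andP[t0 tT]; have := @vE t (T - t).
rewrite (addrC t) subrK subr_ge0 => /(_ t0 tT (lexx _)) ->.
by rewrite lerDl v_ge0// subr_ge0 tT/=; lra.
Qed.

(** Near 0 the increment [D 0 t] is below 1 in absolute value with probability more than 1/2. If the
    mean exceeded 2 + 2 v T, it would then deviate from its mean by at least k = 1 + 2 v T; since k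
    >= 1, the variance would exceed k / 2 > v T >= v t. *)
Let m_small : exists K e : R, 0 < e /\ forall t, 0 <= t <= T -> t < e -> `|m t| <= K.
Proof.
have T00 : (0 : R) <= 0 <= T by rewrite lexx ltW.
have := levy_stochastically_continuous hz T00 ltr01.
move=> /fine_cvgP[_ /cvgrPdist_lt /(_ 2^-1)].
rewrite invr_gt0 ltr0n => /(_ isT); rewrite near_withinE.
move=> /nbhs_ballP[e /= e0 he].
exists (2 + (v T + v T)), e; split => // t /[dup] tT /andP[t0 tleT] te.
rewrite leNgt; apply/negP => mt.
pose A := [set w | 1 <= `|z t w - z 0 w|].
have PA : fine (P A) < 2^-1.
  have := he t; rewrite /ball/= sub0r normrN ger0_norm// => /(_ te).
  rewrite in_itv/= => /(_ tT); rewrite sub0r normrN.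
  by apply: le_lt_trans; exact: ler_norm.
have mA : measurable A.
  rewrite (_ : A = (fun w => `|D 0 t w|) @^-1` `[1, +oo[%classic); last first.
    by apply/seteqP; split => w /=; rewrite in_itv/= andbT.
  rewrite -[_ @^-1` _]setTI.
  have mN : measurable_fun setT (fun w => `|D 0 t w|) by exact: measurableT_comp.
  exact: mN.
have h00 : 0 + t <= T by rewrite add0r.
have [i1 e1 e2] := incr (lexx 0) t0 h00; rewrite add0r in i1 e1 e2.
have vt0 := v_ge0 tT; have vtT := v_le tT.
pose k := 1 + (v T + v T).
have iD : L2 P (fun w => D 0 t w - m t) by apply: L2B => //; exact: L2_cst.
have vt : Ex P (fun w => (D 0 t w - m t) ^+ 2) = v t.
  transitivity (Ex P (fun w => D 0 t w ^+ 2 - (2 * m t * D 0 t w - m t ^+ 2))).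
    by congr Ex; apply/funext => w; ring.
  rewrite ExB; last 2 first.
  - exact: L2_sq.
  - by apply: L1B; [exact/L1Z/L2_L1|exact: L1_cst].
  rewrite ExB; last 2 first.
  - exact/L1Z/L2_L1.
  - exact: L1_cst.
  rewrite ExZ; last exact: L2_L1.
  by rewrite Ex_cst e1 e2 /v; ring.
have iA : L1 P (\1_A : _ -> R).
  apply: (L1_le _ (L1_cst P 1)); first exact: measurable_indic.
  by move=> w; rewrite indicE normr1; case: (_ \in _); rewrite ?normr1 ?normr0.
have EA : Ex P (\1_A : _ -> R) = fine (P A).
  by rewrite /Ex /Rintegral integral_indic// setIT.
have : Ex P (fun w => k * (1 - \1_A w)) <= Ex P (fun w => (D 0 t w - m t) ^+ 2).
  apply: Ex_le; [|exact: L2_sq|move=> w].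
    by apply: L1Z; apply: L1B => //; exact: L1_cst.
  rewrite indicE; case: (boolP (w \in A)) => [_|wA]; first by rewrite subrr mulr0 sqr_ge0.
  have : `|D 0 t w| < 1.
    by rewrite ltNge; apply: contra wA => h; rewrite inE.
  move=> h; rewrite subr0 mulr1.
  have : k <= `|D 0 t w - m t|.
    rewrite distrC; apply: le_trans (lerB_dist _ _); rewrite /k; lra.
  move=> kD; rewrite -real_normK ?num_real// expr2; apply: (le_trans kD).
  rewrite ler_peMr//; apply: (le_trans _ kD); rewrite /k; lra.
rewrite vt ExZ; last by apply: L1B => //; exact: L1_cst.
rewrite ExB//; last exact: L1_cst.
by rewrite Ex_cst EA /k; nra.
Qed.

(** Additivity carries the bound near 0 to all of [0, T]: t is cut into n equal pieces, with n
    chosen so that T / n < e. *)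
Let m_bounded : exists B, forall t, 0 <= t <= T -> `|m t| <= B.
Proof.
have [K [e [e0 hK]]] := m_small.
have := archi_boundP (ltW (divr_gt0 T0 e0)).
set n := Num.bound _ => Tn.
exists (n%:R * K) => t /andP[t0 tT].
have n0 : (0 < n%:R :> R) by apply: lt_trans Tn; exact: divr_gt0.
pose h := t / n%:R.
have h0 : 0 <= h by rewrite divr_ge0// ltW.
have mk k : k%:R * h <= T -> m (k%:R * h) = k%:R * m h.
  elim: k => [_|k IH].
    rewrite !mul0r; have := @mE 0 0 (lexx _) (lexx _).
    by rewrite addr0 ltW// => /(_ isT)/eqP; rewrite -subr_eq subrr eq_sym => /eqP.
  rewrite -natr1 mulrDl mul1r => kT.
  rewrite mE// ?IH ?mulr_ge0//; last by apply: le_trans kT; rewrite lerDl.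
  by rewrite mulrDl mul1r.
have nh : n%:R * h = t by rewrite /h mulrCA divff ?gt_eqF// mulr1.
have := mk n; rewrite nh => /(_ tT) ->.
rewrite normrM (ger0_norm (ltW n0)) ler_pM2l//.
apply: hK.
  rewrite h0/= (le_trans _ tT)// -nh ler_peMl//.
  by move: n0; rewrite ltr0n -(ler_nat R).
rewrite /h ltr_pdivrMr//; apply: le_lt_trans tT _.
by move: Tn; rewrite ltr_pdivrMr// mulrC.
Qed.

Definition levy_drift : R := Ex P (z T) / T.
Definition levy_var : R := (Ex P (fun w => z T w ^+ 2) - Ex P (z T) ^+ 2) / T.

Lemma levy_var_ge0 : 0 <= levy_var.
Proof. by rewrite divr_ge0 ?(ltW T0)// v_ge0// lexx ltW. Qed.

Definition levy_mart t w := z t w - levy_drift * t.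

Lemma levy_mart_increment s t : 0 <= s -> s <= t -> t <= T ->
  [/\ L2 P (fun w => levy_mart t w - levy_mart s w),
      Ex P (fun w => levy_mart t w - levy_mart s w) = 0 &
      Ex P (fun w => (levy_mart t w - levy_mart s w) ^+ 2) =
        levy_var * (t - s)].
Proof.
move=> s0 st tT; pose h := t - s.
have h0 : 0 <= h by rewrite subr_ge0.
have hT : 0 <= h <= T by rewrite h0 /h/=; lra.
have tE : t = s + h by rewrite /h addrC subrK.
have shT : s + h <= T by rewrite -tE.
have [i1 e1 e2] := incr s0 h0 shT; rewrite -tE in i1 e1 e2.
have [B mB] := m_bounded.
have mh : m h = levy_drift * h by exact: (additive_bounded_linear T0 mE mB).
have vh : v h = levy_var * h.
  apply: (@additive_bounded_linear _ T (v T) v) => // u uT.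
  by rewrite ger0_norm ?v_ge0// v_le.
have E w : levy_mart t w - levy_mart s w = D s t w - levy_drift * h.
  by rewrite /levy_mart /D /h; ring.
have -> : (fun w => levy_mart t w - levy_mart s w) =
    (fun w => D s t w - levy_drift * h) by exact/funext.
have -> : (fun w => (levy_mart t w - levy_mart s w) ^+ 2) =
    (fun w => (D s t w ^+ 2 - (2 * m h * D s t w - m h ^+ 2))).
  by apply/funext => w; rewrite E -mh; ring.
have iD1 := L2_L1 i1.
split.
- by apply: L2B => //; exact: L2_cst.
- by rewrite ExB//; [rewrite e1 mh Ex_cst subrr|exact: L1_cst].
- rewrite ExB; last 2 first.
  + exact: L2_sq.
  + by apply: L1B; [exact: L1Z|exact: L1_cst].
  rewrite ExB; [|exact: L1Z|exact: L1_cst].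
  by rewrite ExZ// Ex_cst e1 e2 -vh /v; ring.
Qed.

End levy_moments.

(** * Step processes and their integrals *)

Lemma indep_of_comp (R : realType) d (T : measurableType d)
    (P : probability T R) (G : set (set T)) (Y : T -> R) (f : R -> R) :
  measurable_fun setT f -> indep_of P G Y -> indep_of P G (f \o Y).
Proof.
move=> mf GY A B GB mA; rewrite comp_preimage; apply: GY => //.
by rewrite -[_ @^-1` _]setTI; exact: mf.
Qed.

(* Pathwise Doob inequality for the running maximum [S] of [N]: for a martingale [N]
   the sum has mean zero, which leaves the L^2 maximal inequality. *)
Lemma doob_pathwise (R : realType) (N S : nat -> R) (n : nat) :
  N 0%N = 0 -> S 0%N = 0 -> (forall k, S k.+1 = Num.max (S k) (N k.+1)) ->
  S n ^+ 2 <= 4 * N n ^+ 2 - 4 * \sum_(i < n) S i * (N i.+1 - N i).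
Proof.
move=> N0 S0 SE.
(* Summation by parts: nothing is lost while [S] is constant, and a jump of [S] to [N] loses half a
   square. What then remains of the claim is (2 N - S)^2 >= 0. *)
have h : \sum_(i < n) S i * (N i.+1 - N i) <= S n * N n - S n ^+ 2 / 2.
  elim: n => [|n IH]; first by rewrite big_ord0 S0 mul0r expr2 !mul0r subr0.
  rewrite big_ord_recr/=; apply: (le_trans (lerD IH (lexx _))).
  rewrite SE; have [_|SN] := leP (N n.+1) (S n); first by rewrite !expr2; nra.
  have := sqr_ge0 (N n.+1 - S n); rewrite !expr2; nra.
have := sqr_ge0 (2 * N n - S n); move: h; rewrite !expr2; nra.
Qed.

(** * Quadratic forms of step functions *)

Section interval_sums.
Context (R : realType).
Notation leb := (@lebesgue_measure R).

(** For nonnegative [a] and [c], the length of the common part of the intervals ]a, b], ]c, e] and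
    ]0, t]. *)
Definition overlap (t a b c e : R) : R :=
  Num.max 0 (Num.min t (Num.min b e) - Num.max a c).

Definition step2 (a b c e s : R) : R := (a < s <= b)%R%:R * (c < s <= e)%R%:R.

Lemma integral_itv_indic (t a b c e : R) : 0 <= a -> 0 <= c ->
  leb.-integrable `]0, t] (EFin \o step2 a b c e) /\
  (\int[leb]_(s in `]0%R, t]) (step2 a b c e s)%:E = (overlap t a b c e)%:E)%E.
Proof.
move=> a0 c0.
pose A := `](Num.max a c), (Num.min b e)]%classic : set R.
have E : step2 a b c e = (\1_A : R -> R).
  apply/funext => s /=; rewrite /step2 indicE -natrM mulnb; congr (_%:R).
  rewrite /A mem_setE in_itv/= gt_max le_min.
  by case: (a < s); case: (s <= b); case: (c < s); case: (s <= e).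
have mA : measurable A by exact: measurable_itv.
have mT : measurable (`]0, t]%classic : set R) by exact: measurable_itv.
split.
  rewrite E; apply: (integrableS measurableT) => //.
  exact: integrable_indic_itv.
rewrite E integral_indic//.
have -> : A `&` `]0, t] = `](Num.max a c), (Num.min t (Num.min b e))]%classic.
  apply/seteqP; split => s; rewrite /A /= !in_itv/= !gt_max !le_min.
    by move=> [/andP[/andP[-> ->] /andP[-> ->]] /andP[_ ->]].
  move=> /andP[/andP[h1 h2] /andP[h3 /andP[h4 h5]]].
  by rewrite h1 h2 h3 h4 h5 (le_lt_trans a0).
rewrite [LHS](lebesgue_measure_itv `](Num.max a c), (Num.min t (Num.min b e))])/=.
rewrite lte_fin /overlap.
have [h|h] := ltP (Num.max a c) (Num.min t (Num.min b e)).
  by rewrite -EFinB; congr (_%:E); rewrite [Num.max 0 _]max_r// subr_ge0 ltW.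
by rewrite [Num.max 0 _]max_l// subr_le0.
Qed.

Context (I : finType) (lo hi : I -> R) (lo0 : forall i, 0 <= lo i).

Definition step_sum (x : I -> R) (s : R) : R :=
  \sum_i x i * (lo i < s <= hi i)%R%:R.

(** The Gram form of the indicators of the intervals, which may overlap. It turns the time integral
    of a squared step function into a finite sum, so that expectations can be taken term by term. *)
Definition step_quad (x : I -> R) (t : R) : R :=
  \sum_i \sum_j x i * x j * overlap t (lo i) (hi i) (lo j) (hi j).

Lemma integral_step_quad (x : I -> R) (t : R) :
  (\int[leb]_(s in `]0%R, t]) (step_sum x s ^+ 2)%:E = (step_quad x t)%:E)%E.
Proof.
have E s : (step_sum x s ^+ 2)%:E = (\sum_i \sum_j (x i * x j)%:E *
    (step2 (lo i) (hi i) (lo j) (hi j) s)%:E)%E.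
  transitivity (\sum_i \sum_j x i * x j *
      step2 (lo i) (hi i) (lo j) (hi j) s)%:E.
    congr (_%:E); rewrite /step_sum expr2 mulr_suml; apply: eq_bigr => i _.
    by rewrite mulr_sumr; apply: eq_bigr => j _; rewrite /step2; ring.
  rewrite -sumEFin; apply: eq_bigr => i _.
  by rewrite -sumEFin; apply: eq_bigr => j _; rewrite EFinM.
under eq_integral do rewrite E.
have ii i j := (integral_itv_indic t (hi i) (hi j) (lo0 i) (lo0 j)).1.
have iE i j := (integral_itv_indic t (hi i) (hi j) (lo0 i) (lo0 j)).2.
rewrite integral_sum//=; last first.
  by move=> i; apply: integrable_sum => // j _; apply: integrableZl => //; exact: ii.
rewrite /step_quad -sumEFin; apply: eq_bigr => i _.
rewrite integral_sum//=; last by move=> j; apply: integrableZl => //; exact: ii.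
rewrite -sumEFin; apply: eq_bigr => j _.
rewrite integralZl//; last exact: ii.
by rewrite [RHS]EFinM; congr (_ * _)%E; exact: iE.
Qed.

Lemma step_quad_ge0 x t : 0 <= step_quad x t.
Proof.
rewrite -lee_fin -integral_step_quad; apply: integral_ge0 => s _.
by rewrite lee_fin sqr_ge0.
Qed.

End interval_sums.

(** Cauchy-Schwarz on ]0, t] for the step function, whose integral is the sum on the left: it
    expresses that the square of the function minus its mean [D / t] has a nonnegative integral. *)
Lemma step_quad_drift (R : realType) (I : finType) (lo hi : I -> R)
    (x : I -> R) (t T : R) :
  (forall i, 0 <= lo i) -> (forall i, lo i <= hi i) -> (forall i, hi i <= T) ->
  0 <= t -> t <= T ->
  (\sum_i x i * (Num.min t (hi i) - Num.min t (lo i))) ^+ 2 <=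
    t * step_quad lo hi x t.
Proof.
move=> lo0 lohi hiT t0 tT; set D := \sum_i _.
have [t00|tn0] := eqVneq t 0.
  rewrite {1}t00 mul0r /D big1 ?expr2 ?mul0r// => i _.
  by have h := le_trans (lo0 i) (lohi i); rewrite t00 !min_l// subrr mulr0.
have tp : 0 < t by rewrite lt_def tn0.
(* Adjoin the constant step -D/t: the enlarged quadratic form is nonnegative. *)
pose lo' (o : option I) := if o is Some i then lo i else 0.
pose hi' (o : option I) := if o is Some i then hi i else T.
pose x' (o : option I) := if o is Some i then x i else - (D / t).
have lo'0 o : 0 <= lo' o by case: o => //=.
have := step_quad_ge0 hi' lo'0 x' t.
have ovS i : overlap t (lo i) (hi i) 0 T = Num.min t (hi i) - Num.min t (lo i).
  rewrite /overlap (min_l (hiT i)) (max_l (lo0 i)).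
  have := lohi i.
  case: (leP t (hi i)) => h1; case: (leP t (lo i)) => h2 h3.
  - by rewrite max_l ?subrr// subr_le0.
  - by rewrite max_r// subr_ge0 ltW.
  - by exfalso; lra.
  - by rewrite max_r// subr_ge0.
have ovC i j : overlap t (lo' i) (hi' i) (lo' j) (hi' j) =
    overlap t (lo' j) (hi' j) (lo' i) (hi' i).
  by rewrite /overlap [Num.min (hi' i) _]minC [Num.max (lo' i) _]maxC.
have big_opt (f : option I -> R) : \sum_o f o = f None + \sum_i f (Some i).
  rewrite (bigD1 None)//=; congr (_ + _).
  rewrite (reindex_omap Some id)/=; last by case.
  by apply: eq_bigl => i; rewrite /= eqxx.
rewrite /step_quad big_opt big_opt/=.
under [X in _ + X]eq_bigr do rewrite big_opt/=.
rewrite big_split/=.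
have -> : overlap t 0 T 0 T = t.
  by rewrite /overlap !minxx !maxxx subr0 (min_l tT) max_r.
have e1 : \sum_i - (D / t) * x i * overlap t 0 T (lo i) (hi i) = - (D ^+ 2 / t).
  under eq_bigr => i _.
    rewrite (ovC None (Some i)) ovS -mulrA.
    over.
  by rewrite -mulr_sumr -/D; field.
have e2 : \sum_i x i * - (D / t) * overlap t (lo i) (hi i) 0 T = - (D ^+ 2 / t).
  rewrite -e1; apply: eq_bigr => i _; rewrite (ovC None (Some i))/=; ring.
rewrite e1 e2 => h.
have {}h : D ^+ 2 / t <= \sum_i \sum_j x i * x j * overlap t (lo i) (hi i) (lo j) (hi j).
  suff -> : D ^+ 2 / t = - (D / t) * - (D / t) * t.
    have : - (D / t) * - (D / t) * t = D ^+ 2 / t by field.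
    move: h; lra.
  by field.
by rewrite mulrC -ler_pdivrMr.
Qed.

(** * Ito isometry and Doob's inequality for finite sums *)

Section martingale_sums.
Context (R : realType) (d : measure_display) (Omega : measurableType d).
Context (P : probability Omega R) (T : R) (G : R -> set (set Omega)).
Context (Gm : forall t, G t `<=` measurable).
Context (GS : forall s t, s <= t -> G s `<=` G t).
Context (M : R -> Omega -> R) (c : R).
Context (M_incr : forall s t, 0 <= s -> s <= t -> t <= T ->
  [/\ L2 P (fun w => M t w - M s w), Ex P (fun w => M t w - M s w) = 0 &
      Ex P (fun w => (M t w - M s w) ^+ 2) = c * (t - s)]).
Context (M_indep : forall s t, 0 <= s -> s <= t -> t <= T ->
  indep_of P <<s G s >> (fun w => M t w - M s w)).
Context (M_adapted : forall t, 0 <= t <= T -> gmeas (G t) (M t)).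

Let gm t (X : Omega -> R) : gmeas (G t) X -> measurable_fun setT X.
Proof. exact: gmeas_measurable. Qed.

Let gS s t (X : Omega -> R) : s <= t -> gmeas (G s) X -> gmeas (G t) X.
Proof.
by move=> st; apply: gmeas_sub => B GB; apply: sub_sigma_algebra; exact: GS GB.
Qed.

Lemma mart_incr_adapted s t : 0 <= s -> s <= t -> t <= T ->
  gmeas (G t) (fun w => M t w - M s w).
Proof.
move=> s0 st tT; apply: gmeasB.
  by apply: M_adapted; rewrite tT (le_trans s0).
by apply: (gS st); apply: M_adapted; rewrite s0 (le_trans st).
Qed.

Lemma mart_incr0 s t S : 0 <= s -> s <= t -> t <= T ->
  gmeas (G s) S -> L1 P S ->
  L1 P (fun w => S w * (M t w - M s w)) /\
  Ex P (fun w => S w * (M t w - M s w)) = 0.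
Proof.
move=> s0 st tT mS iS; have [i1 e1 _] := M_incr s0 st tT.
have mD : measurable_fun setT (fun w => M t w - M s w) by case: i1.
have ind := M_indep s0 st tT.
have := Ex_indepM (@Gm s) mS mD ind iS (L2_L1 i1).
rewrite e1 mulr0 => ->; split => //.
exact: (L1_indepM (@Gm s) mS mD ind iS (L2_L1 i1)).
Qed.

Lemma mart_incr_sq s t S : 0 <= s -> s <= t -> t <= T ->
  gmeas (G s) S -> L1 P S ->
  L1 P (fun w => S w * (M t w - M s w) ^+ 2) /\
  Ex P (fun w => S w * (M t w - M s w) ^+ 2) = c * (t - s) * Ex P S.
Proof.
move=> s0 st tT mS iS; have [i1 _ e1] := M_incr s0 st tT.
have mD : measurable_fun setT (fun w => (M t w - M s w) ^+ 2).
  by apply: measurable_funX; case: i1.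
have ind : indep_of P <<s G s >> (fun w => (M t w - M s w) ^+ 2).
  exact: (@indep_of_comp _ _ _ _ _ (fun w => M t w - M s w)
    (fun x : R => x ^+ 2) (@exprn_measurable _ _ _) (M_indep s0 st tT)).
have := Ex_indepM (@Gm s) mS mD ind iS (L2_sq i1).
rewrite e1 => ->; rewrite [RHS]mulrC; split => //.
exact: (L1_indepM (@Gm s) mS mD ind iS (L2_sq i1)).
Qed.

Lemma mart_incr_L2 s t S : 0 <= s -> s <= t -> t <= T ->
  gmeas (G s) S -> L2 P S -> L2 P (fun w => S w * (M t w - M s w)).
Proof.
move=> s0 st tT mS iS; apply: L2P.
  apply: measurable_funM; first exact: gm mS.
  by have [[]] := M_incr s0 st tT.
have mS2 : gmeas (G s) (fun w => S w ^+ 2).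
  exact: (gmeas_comp (@exprn_measurable _ _ _) mS).
have [+ _] := mart_incr_sq s0 st tT mS2 (L2_sq iS).
by congr L1; apply/funext => w; rewrite exprMn.
Qed.

Let ov a b e f : R := Num.max 0 (Num.min b f - Num.max a e).

(** If the intervals are disjoint, the later increment has mean zero given the rest. Otherwise, with
    p and q the smaller and the larger right end, cutting at e and p leaves three terms: two contain
    a later increment of mean zero, and the square over ]e, p] gives the overlap. *)
Let cov_le a b e f X Y : 0 <= a -> a <= b -> b <= T -> e <= f -> f <= T ->
  a <= e -> gmeas (G a) X -> L2 P X -> gmeas (G e) Y -> L2 P Y ->
  Ex P (fun w => (X w * (M b w - M a w)) * (Y w * (M f w - M e w))) =
  c * (Ex P (fun w => X w * Y w) * ov a b e f).
Proof.
move=> a0 ab bT ef fT ae mX iX mY iY.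
have e0 : 0 <= e := le_trans a0 ae.
rewrite /ov (max_r ae).
have [be|eb] := leP b e.
  have iXM := mart_incr_L2 a0 ab bT mX iX.
  have mS : gmeas (G e) (fun w => X w * (M b w - M a w) * Y w).
    apply: gmeasM => //; apply: gmeasM; first exact: gS ae mX.
    by apply: gS be _; exact: mart_incr_adapted.
  have [_ h] := mart_incr0 e0 ef fT mS (L2M iXM iY).
  rewrite max_l ?mulr0; last by rewrite subr_le0 ge_min be.
  rewrite ?mulr0 -[RHS]h; congr Ex; apply/funext => w; ring.
have aeT : e <= T by exact: le_trans fT.
have iXM := mart_incr_L2 a0 ae aeT mX iX.
have mXe : gmeas (G e) X := gS ae mX.
have mS1 : gmeas (G e) (fun w => X w * (M e w - M a w) * Y w).
  by do 2 apply: gmeasM => //; exact: mart_incr_adapted.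
have [j1 h1] := mart_incr0 e0 ef fT mS1 (L2M iXM iY).
have mXY : gmeas (G e) (fun w => X w * Y w) by exact: gmeasM.
have iXY := L2M iX iY.
pose p := Num.min b f; pose q := Num.max b f.
have ep : e <= p by rewrite /p le_min ef ltW.
have pq : p <= q by rewrite /p /q ge_min le_max lexx.
have qT : q <= T by rewrite /q ge_max bT.
have pT : p <= T := le_trans pq qT.
have p0 : 0 <= p := le_trans e0 ep.
have [j2 h2] := mart_incr_sq e0 ep pT mXY iXY.
have [j3' _] := mart_incr0 e0 ep pT mXY iXY.
have mS3 : gmeas (G p) (fun w => X w * Y w * (M p w - M e w)).
  by apply: gmeasM; [exact: gS ep mXY|exact: mart_incr_adapted].
have [j3 h3] := mart_incr0 p0 pq qT mS3 j3'.
transitivity (Ex P (fun w => X w * (M e w - M a w) * Y w * (M f w - M e w) +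
    (X w * Y w * (M p w - M e w) ^+ 2 +
     X w * Y w * (M p w - M e w) * (M q w - M p w)))).
  congr Ex; apply/funext => w; rewrite /p /q.
  by have [bf|fb] := leP b f; ring.
rewrite ExD//; last exact: L1D.
rewrite -/p ExD// h1 h2 h3 max_r ?subr_ge0// addr0 add0r; ring.
Qed.

Lemma mart_cov a b e f X Y : 0 <= a -> a <= b -> b <= T ->
  0 <= e -> e <= f -> f <= T ->
  gmeas (G a) X -> L2 P X -> gmeas (G e) Y -> L2 P Y ->
  Ex P (fun w => (X w * (M b w - M a w)) * (Y w * (M f w - M e w))) =
  c * (Ex P (fun w => X w * Y w) * ov a b e f).
Proof.
move=> a0 ab bT e0 ef fT mX iX mY iY.
have [ae|/ltW ea] := leP a e; first exact: cov_le.
have := cov_le e0 ef fT ab bT ea mY iY mX iX.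
rewrite /ov [Num.min f _]minC [Num.max e _]maxC => h.
transitivity (c * (Ex P (fun w => Y w * X w) *
    Num.max 0 (Num.min b f - Num.max a e))).
  by rewrite -h; congr Ex; apply/funext => w; rewrite mulrC.
by congr (_ * (_ * _)); congr Ex; apply/funext => w; rewrite mulrC.
Qed.

Section finite_sum.
Context (I : finType) (lo hi : I -> R) (xi : I -> Omega -> R).
Context (lo0 : forall i, 0 <= lo i) (lohi : forall i, lo i <= hi i).
Context (hiT : forall i, hi i <= T).
Context (mxi : forall i, gmeas (G (lo i)) (xi i)) (ixi : forall i, L2 P (xi i)).

Definition mart_sum (t : R) (w : Omega) : R :=
  \sum_i xi i w * (M (Num.min t (hi i)) w - M (Num.min t (lo i)) w).

Definition mart_quad (t : R) (w : Omega) : R :=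
  step_quad lo hi (fun i => xi i w) t.

(* A term whose interval lies after [t] vanishes; otherwise its left end is not truncated. *)
Let term t i w := xi i w * (M (Num.min t (hi i)) w - M (Num.min t (lo i)) w).

Let term0 t i : t <= lo i -> term t i = fun=> 0.
Proof.
move=> tlo; apply/funext => w; rewrite /term (min_l tlo) min_l ?subrr ?mulr0//.
exact: le_trans (lohi i).
Qed.

Let termE t i : lo i <= t ->
  term t i = fun w => xi i w * (M (Num.min t (hi i)) w - M (lo i) w).
Proof. by move=> tlo; rewrite /term (min_r tlo). Qed.

Let term_L2 t i : t <= T -> L2 P (term t i).
Proof.
move=> tT; have [tlo|/ltW tlo] := leP t (lo i).
  by rewrite term0//; exact: L2_cst.
rewrite termE//; apply: mart_incr_L2 => //.
- by rewrite le_min tlo lohi.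
- by rewrite ge_min tT.
Qed.

Lemma mart_sum_L2 t : t <= T -> L2 P (mart_sum t).
Proof. by move=> tT; apply: L2_sum => i _; exact: term_L2. Qed.

Let quadE t i j : Ex P (fun w => xi i w * xi j w * overlap t (lo i) (hi i) (lo j) (hi j))
  = Ex P (fun w => xi i w * xi j w) * overlap t (lo i) (hi i) (lo j) (hi j).
Proof.
rewrite [RHS]mulrC -ExZ; last exact: L2M.
by congr Ex; apply/funext => w; rewrite mulrC.
Qed.

Let quad_L1 t i j : L1 P (fun w => xi i w * xi j w * overlap t (lo i) (hi i) (lo j) (hi j)).
Proof.
have := L1Z (overlap t (lo i) (hi i) (lo j) (hi j)) (L2M (ixi i) (ixi j)).
by congr L1; apply/funext => w; rewrite mulrC.
Qed.

Lemma mart_quad_L1 t : L1 P (mart_quad t).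
Proof. by apply: L1_sum => i; exact: L1_sum. Qed.

Let term_cov t i j : 0 <= t -> t <= T ->
  Ex P (fun w => term t i w * term t j w) =
  c * Ex P (fun w => xi i w * xi j w * overlap t (lo i) (hi i) (lo j) (hi j)).
Proof.
move=> t0 tT; rewrite quadE.
have [tlo|/ltW tlo] := leP t (lo i).
  rewrite term0// [overlap _ _ _ _ _](_ : _ = 0) ?mulr0.
    by under [in LHS]eq_fun do rewrite mul0r; rewrite Ex_cst.
  by rewrite /overlap max_l// subr_le0 ge_min le_max tlo.
have [tlo'|/ltW tlo'] := leP t (lo j).
  rewrite (@term0 t j)// [overlap _ _ _ _ _](_ : _ = 0) ?mulr0.
    by under [in LHS]eq_fun do rewrite mulr0; rewrite Ex_cst.
  by rewrite /overlap max_l// subr_le0 ge_min le_max tlo' !orbT.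
rewrite !termE// mart_cov//.
- congr (_ * (_ * Num.max 0 (_ - _))).
  by rewrite minACA minxx.
- by rewrite le_min tlo lohi.
- by rewrite ge_min tT.
- by rewrite le_min tlo' lohi.
- by rewrite ge_min tT.
Qed.

Lemma mart_sum_isometry t : 0 <= t -> t <= T ->
  Ex P (fun w => mart_sum t w ^+ 2) = c * Ex P (mart_quad t).
Proof.
move=> t0 tT.
have E w : mart_sum t w ^+ 2 = \sum_i \sum_j term t i w * term t j w.
  by rewrite expr2 mulr_suml; apply: eq_bigr => i _; rewrite mulr_sumr.
under [in LHS]eq_fun do rewrite E.
have iT i j : L1 P (fun w => term t i w * term t j w).
  by apply: L2M; exact: term_L2.
rewrite Ex_sum; last by move=> i; exact: L1_sum.
rewrite /mart_quad /step_quad Ex_sum; last by move=> i; exact: L1_sum.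
rewrite mulr_sumr; apply: eq_bigr => i _.
rewrite Ex_sum// Ex_sum//; rewrite mulr_sumr; apply: eq_bigr => j _.
exact: term_cov.
Qed.

(** The martingale property, tested against square integrable variables of the past instead of
    stated with conditional expectations. Only the part ]u, v] of each interval inside ]s, t]
    contributes, and at u = max s lo both [S] and the coefficient are known. *)
Lemma mart_sum_martingale s t S : 0 <= s -> s <= t -> t <= T ->
  gmeas (G s) S -> L2 P S ->
  L1 P (fun w => S w * (mart_sum t w - mart_sum s w)) /\
  Ex P (fun w => S w * (mart_sum t w - mart_sum s w)) = 0.
Proof.
move=> s0 st tT mS iS.
have E w : S w * (mart_sum t w - mart_sum s w) =
    \sum_i S w * (term t i w - term s i w).
  by rewrite /mart_sum -sumrB mulr_sumr.
suff h i : L1 P (fun w => S w * (term t i w - term s i w)) /\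
    Ex P (fun w => S w * (term t i w - term s i w)) = 0.
  under [fun w => _]eq_fun do rewrite E.
  split; first by apply: L1_sum => i; exact: (h i).1.
  by rewrite Ex_sum; [rewrite big1// => i _; exact: (h i).2|move=> i; exact: (h i).1].
split.
  by apply: L2M => //; apply: L2B; apply: term_L2 => //; exact: le_trans tT.
have [tlo|/ltW tlo] := leP t (lo i).
  rewrite !term0//; last exact: le_trans tlo.
  by under eq_fun do rewrite subrr mulr0; exact: Ex_cst.
have [his|/ltW his] := leP (hi i) s.
  have lis := le_trans (lohi i) his.
  rewrite !termE// (min_r his) min_r; last exact: le_trans st.
  by under eq_fun do rewrite subrr mulr0; exact: Ex_cst.
pose v := Num.min t (hi i); pose u := Num.max s (lo i).
have u0 : 0 <= u by rewrite /u le_max s0.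
have uv : u <= v by rewrite /u /v ge_max !le_min st tlo lohi his.
have vT : v <= T by rewrite /v ge_min tT.
have mU : gmeas (G u) (fun w => S w * xi i w).
  apply: gmeasM; first by apply: (gS _ mS); rewrite /u le_max lexx.
  by apply: (gS _ (@mxi i)); rewrite /u le_max lexx orbT.
have [_ <-] := mart_incr0 u0 uv vT mU (L2M iS (ixi i)).
congr Ex; apply/funext => w; rewrite termE// /u.
have [slo|/ltW slo] := leP s (lo i); first by rewrite term0// /v subr0; ring.
by rewrite termE// (min_l his) /v; ring.
Qed.

Lemma mart_sum_adapted s t : 0 <= s -> s <= t -> t <= T -> gmeas (G t) (mart_sum s).
Proof.
move=> s0 st tT; apply: (gS st); apply: gmeas_sum => i; rewrite -/(term s i).
have [slo|/ltW slo] := leP s (lo i); first by rewrite term0//; exact: gmeas_cst.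
rewrite termE//; apply: gmeasM; first exact: gS slo (@mxi i).
have [shi|/ltW his] := leP s (hi i).
  by apply: mart_incr_adapted => //; exact: le_trans st tT.
apply: gS his _; apply: mart_incr_adapted => //.
Qed.

Lemma mart_sum0 w : 0 <= T -> mart_sum 0 w = 0.
Proof.
by move=> T0; rewrite /mart_sum big1// => i _; rewrite -/(term 0 i w) term0.
Qed.

Section maximal_inequality.
Context (u : nat -> R) (u0 : u 0%N = 0) (uS : forall k, u k <= u k.+1).
Context (uT : forall k, u k <= T).

Let u_ge0 k : 0 <= u k.
Proof. by elim: k => [|k IH]; [rewrite u0|exact: le_trans IH (uS k)]. Qed.

(** Used with [e] equal to 1 and -1 to control both signs of the sum; the start at 0 keeps the
    maximum nonnegative. *)
Fixpoint running_max (e : R) (k : nat) (w : Omega) : R :=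
  if k is k'.+1 then Num.max (running_max e k' w) (e * mart_sum (u k) w) else 0.

Let rm_adapted e k : gmeas (G (u k)) (running_max e k).
Proof.
elim: k => [|k IH]; first exact: gmeas_cst.
apply: gmeas_max; first exact: gS (uS k) IH.
by apply: gmeasM; [exact: gmeas_cst|exact: mart_sum_adapted].
Qed.

Let rm_L2 e k : L2 P (running_max e k).
Proof.
elim: k => [|k IH]; first exact: L2_cst.
have iN : L2 P (fun w => e * mart_sum (u k.+1) w) by apply/L2Z/mart_sum_L2.
apply: (L2_le _ (L2D (L2_norm IH) (L2_norm iN))); first exact: gm (@rm_adapted e k.+1).
move=> w /=; rewrite [leRHS]ger0_norm ?addr_ge0//.
case: (leP (running_max e k w) (e * mart_sum (u k.+1) w)) => _.
  by rewrite lerDr.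
by rewrite lerDl.
Qed.

Let rm_sq e n : e ^+ 2 = 1 ->
  Ex P (fun w => running_max e n w ^+ 2) <= 4 * Ex P (fun w => mart_sum (u n) w ^+ 2).
Proof.
move=> e1; have T0 : 0 <= T by rewrite -u0.
have iN : L2 P (mart_sum (u n)) by exact: mart_sum_L2.
have hk k := mart_sum_martingale (u_ge0 k) (uS k) (uT k.+1) (@rm_adapted e k) (rm_L2 e k).
have ik k : L1 P (fun w => e * (running_max e k w * (mart_sum (u k.+1) w - mart_sum (u k) w))).
  by apply: L1Z; exact: (hk k).1.
have -> : 4 * Ex P (fun w => mart_sum (u n) w ^+ 2) =
    Ex P (fun w => 4 * mart_sum (u n) w ^+ 2 - 4 * \sum_(k <- index_iota 0 n)
      e * (running_max e k w * (mart_sum (u k.+1) w - mart_sum (u k) w))).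
  rewrite ExB; last 2 first.
  - exact/L1Z/L2_sq.
  - by apply: L1Z; exact: L1_sum.
  rewrite !ExZ; last 2 first.
  - exact: L1_sum.
  - exact: L2_sq.
  rewrite Ex_sum// big1 ?mulr0 ?subr0// => k _.
  by rewrite ExZ ?(hk k).2 ?mulr0//; exact: (hk k).1.
apply: Ex_le; [exact: L2_sq| |move=> w].
  by apply: L1B; [exact/L1Z/L2_sq|apply: L1Z; exact: L1_sum].
have := @doob_pathwise _ (fun k => e * mart_sum (u k) w) (running_max e ^~ w) n.
rewrite u0 mart_sum0// mulr0 => /(_ erefl erefl (fun=> erefl)).
rewrite exprMn e1 mul1r big_mkord => h; apply: le_trans h _.
rewrite lerD2l lerN2 ler_pM2l// le_eqVlt; apply/orP; left; apply/eqP.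
by apply: eq_bigr => k _; ring.
Qed.

Let rm_ge e k n w : (0 < k <= n)%N -> e * mart_sum (u k) w <= running_max e n w.
Proof.
elim: n => [|n IH]; first by case: k.
case/andP => k0; rewrite leq_eqVlt => /predU1P[->|kn]; rewrite /= le_max ?lexx ?orbT//.
by rewrite IH ?k0.
Qed.

Let rm_ge0 e n w : 0 <= running_max e n w.
Proof. by elim: n => [|n IH] //=; rewrite le_max IH. Qed.

(** According to its sign, the sum is bounded by one of the two running maxima, and each contributes
    4 by Doob's inequality. The bound depends on the grid only through its last point, so the grid
    can be refined. *)
Lemma mart_sum_maximal n : exists V : Omega -> R,
  [/\ L1 P V, forall w, 0 <= V w,
      forall k w, (k <= n)%N -> mart_sum (u k) w ^+ 2 <= V w &
      Ex P V <= 8 * c * Ex P (mart_quad (u n))].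
Proof.
have T0 : 0 <= T by rewrite -u0.
exists (fun w => running_max 1 n w ^+ 2 + running_max (-1) n w ^+ 2); split.
- by apply: L1D; exact: L2_sq.
- by move=> w; rewrite addr_ge0 ?sqr_ge0.
- move=> k w kn; case: (posnP k) => [->|k0].
    by rewrite u0 mart_sum0// expr0n/= addr_ge0 ?sqr_ge0.
  have k0n : (0 < k <= n)%N by rewrite k0.
  have := rm_ge 1 w k0n; have := rm_ge (-1) w k0n; rewrite mul1r mulN1r.
  have := rm_ge0 1 n w; have := rm_ge0 (-1) n w.
  by case: (leP 0 (mart_sum (u k) w)) => h; rewrite !expr2; nra.
- rewrite ExD; [|exact: L2_sq|exact: L2_sq].
  have h1 := rm_sq n (expr1n R 2).
  have h2 : Ex P (fun w => running_max (-1) n w ^+ 2) <= 4 * Ex P (fun w => mart_sum (u n) w ^+ 2).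
    by apply: rm_sq; rewrite sqrrN expr1n.
  rewrite mart_sum_isometry// in h1 h2; lra.
Qed.

End maximal_inequality.

End finite_sum.
End martingale_sums.

(** * Cadlag paths *)

Section cadlag_paths.
Context (R : realType) (T : R).
Implicit Types f g : R -> R.

Lemma cadlag_onD f g : cadlag_on T f -> cadlag_on T g ->
  cadlag_on T (fun t => f t + g t).
Proof.
move=> [fr fl] [gr gl]; split=> t tT; first by apply: cvgD; [exact: fr|exact: gr].
by apply: is_cvgD; [exact: fl|exact: gl].
Qed.

Lemma cadlag_onZ c f : cadlag_on T f -> cadlag_on T (fun t => c * f t).
Proof.
move=> [fr fl]; split=> t tT; first by apply: cvgM; [exact: cvg_cst|exact: fr].
by apply: is_cvgM; [exact: is_cvg_cst|exact: fl].
Qed.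

Lemma cadlag_on_cst c : cadlag_on T (fun=> c : R).
Proof. by split=> t tT; [exact: cvg_cst|exact: is_cvg_cst]. Qed.

Lemma cadlag_on_sum (I : Type) (s : seq I) (F : I -> R -> R) :
  (forall i, cadlag_on T (F i)) -> cadlag_on T (fun t => \sum_(i <- s) F i t).
Proof.
move=> hF; elim: s => [|i s IH].
  by under eq_fun do rewrite big_nil; exact: cadlag_on_cst.
by under eq_fun do rewrite big_cons; exact: cadlag_onD.
Qed.

Lemma cadlag_on_min f h : cadlag_on T f -> cadlag_on T (fun t => f (Num.min t h)).
Proof.
move=> [fr fl]; split=> t tT.
  have [ht|th] := leP h t.
    apply: (@cvg_trans _ (f h @[_ --> t^'+])); last exact: cvg_cst.
    apply: near_eq_cvg; near=> s; rewrite min_r//; apply: (le_trans ht).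
    by near: s; exact: nbhs_right_ge.
  apply: (@cvg_trans _ (f @ t^'+)); last exact: fr.
  apply: near_eq_cvg; near=> s; rewrite min_l//.
  by near: s; apply: nbhs_right_le.
have [ht|th] := ltP h t.
  apply/cvg_ex; exists (f h).
  apply: (@cvg_trans _ (f h @[_ --> t^'-])); last exact: cvg_cst.
  apply: near_eq_cvg; near=> s; rewrite min_r//.
  by near: s; exact: nbhs_left_ge.
apply/cvg_ex; exists (lim (f @ t^'-)).
apply: (@cvg_trans _ (f @ t^'-)); last exact: fl.
apply: near_eq_cvg; near=> s; rewrite min_l//; apply: le_trans th.
by near: s; exact: nbhs_left_le.
Unshelve. all: by end_near. Qed.

Lemma cadlag_on_uniform_limit (f_ : nat -> R -> R) f (e : nat -> R) :
  (forall n, cadlag_on T (f_ n)) -> e n @[n --> \oo] --> 0 ->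
  (forall n t, 0 <= t <= T -> `|f_ n t - f t| <= e n) -> cadlag_on T f.
Proof.
move=> hf e0 fe.
have small eps : 0 < eps -> exists n, e n < eps.
  move=> ep; have /cvgrPdist_lt/(_ _ ep)[n _ hn] := e0.
  exists n; have := hn n (leqnn n); rewrite sub0r normrN.
  by apply: le_lt_trans; exact: ler_norm.
split=> t tT.
  apply/cvgrPdist_lt => eps ep.
  have [n en] := small (eps / 3) ltac:(by rewrite divr_gt0).
  have [/(_ t tT)/cvgrPdist_lt/(_ (eps / 3))] := hf n.
  rewrite divr_gt0// => /(_ isT) hn _.
  have /andP[t0 tT'] := tT.
  have tt : `|f_ n t - f t| <= e n by apply: fe; rewrite t0 ltW.
  near=> s.
  have h1 : `|f_ n t - f_ n s| < eps / 3 by near: s; exact: hn.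
  have h2 : `|f_ n s - f s| <= e n.
    apply: fe; rewrite (le_trans t0)/=.
      by near: s; exact: nbhs_right_le.
    by near: s; exact: nbhs_right_ge.
  have := ler_distD (f_ n t) (f t) (f s); have := ler_distD (f_ n s) (f_ n t) (f s).
  rewrite (distrC (f t) (f_ n t)) => h3 h4; lra.
apply/cauchy_cvgP; apply: cauchy_exP => eps ep.
have [n en] := small (eps / 2) ltac:(by rewrite divr_gt0).
have [_ /(_ t tT)/cvgrPdist_lt/(_ (eps / 2))] := hf n.
rewrite divr_gt0// => /(_ isT) hn.
have /andP[t0 tT'] := tT.
(* [cauchy_exP] asks only for a centre of a small ball: the left limit of one close [f_ n]
   serves. *)
exists (lim (f_ n @ t^'-)).
rewrite /= near_simpl; near=> s; rewrite /ball/=.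
have h1 : `|lim (f_ n @ t^'-) - f_ n s| < eps / 2 by near: s; exact: hn.
have h2 : `|f_ n s - f s| <= e n.
  apply: fe; apply/andP; split.
    by near: s; exact: nbhs_left_ge.
  by apply: le_trans tT'; near: s; exact: nbhs_left_le.
have := ler_distD (f_ n s) (lim (f_ n @ t^'-)) (f s); lra.
Unshelve. all: by end_near. Qed.

Definition dyadic (j k : nat) : R := k%:R * (T / 2 ^+ j).

Lemma dyadic_dense (s t : R) : 0 < T -> 0 <= s -> s < t -> t <= T ->
  exists j k, (k <= 2 ^ j)%N /\ s < dyadic j k < t.
Proof.
move=> T0 s0 st tT.
have ts : 0 < t - s by rewrite subr_gt0.
have := archi_boundP (ltW (divr_gt0 T0 ts)); set j := Num.bound _ => jT.
have hj : T / 2 ^+ j < t - s.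
  rewrite ltr_pdivrMr ?exprn_gt0// mulrC -ltr_pdivrMr//; apply: lt_le_trans jT _.
  by rewrite -natrX ler_nat ltnW// ltn_expl.
have p0 : 0 < T / 2 ^+ j by rewrite divr_gt0// exprn_gt0.
have := truncn_itv (divr_ge0 s0 (ltW p0)); set k := Num.trunc _ => /andP[k1 k2].
have h1 : s < dyadic j k.+1 by rewrite -ltr_pdivrMr.
have h2 : dyadic j k.+1 < t.
  have : k%:R * (T / 2 ^+ j) <= s by rewrite -ler_pdivlMr.
  by rewrite /dyadic -(natr1 k) mulrDl mul1r; lra.
exists j, k.+1; rewrite h1 h2; split => //.
have : dyadic j k.+1 < T by exact: lt_le_trans tT.
rewrite /dyadic mulrCA gtr_pMr// ltr_pdivrMr ?exprn_gt0// mul1r.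
by rewrite -natrX ltr_nat => /ltnW.
Qed.

Lemma dyadic_mem j k : 0 < T -> (k <= 2 ^ j)%N -> 0 <= dyadic j k <= T.
Proof.
move=> T0 kj; rewrite /dyadic mulr_ge0 ?divr_ge0 ?(ltW T0)//=.
by rewrite mulrCA ger_pMr// ler_pdivrMr ?exprn_gt0// mul1r -natrX ler_nat.
Qed.

Lemma right_continuous_le f (v : \bar R) : 0 < T ->
  (forall t, 0 <= t < T -> f @ t^'+ --> f t) ->
  (forall j k, (k <= 2 ^ j)%N -> ((f (dyadic j k))%:E <= v)%E) ->
  forall t, 0 <= t <= T -> ((f t)%:E <= v)%E.
Proof.
move=> T0 fr fv t /andP[t0 tT].
(* Right continuity says nothing at T, but T is itself a dyadic time, of level 0. *)
move: tT; rewrite le_eqVlt => /predU1P[->|tT].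
  by have := fv 0%N 1%N isT; rewrite /dyadic expr0 divr1 mul1r.
case: v fv => [v| |] fv; [|by rewrite leey|]; last first.
  by have := fv 0%N 0%N isT; rewrite leeNy_eq.
rewrite lee_fin leNgt; apply/negP => vf.
have t0T : 0 <= t < T by rewrite t0.
have /cvgrPdist_lt/(_ (f t - v)) := fr t t0T; rewrite subr_gt0 => /(_ vf).
move=> [e /= e0 he].
have [j [k [kj /andP[tk ke]]]] : exists j k, (k <= 2 ^ j)%N /\
    t < dyadic j k < Num.min (t + e) T.
  by apply: dyadic_dense => //; rewrite ?lt_min ?tT ?ltrDl ?e0// ge_min lexx orbT.
have := fv j k kj; rewrite lee_fin; apply/negP; rewrite -ltNge.
have : `|f t - f (dyadic j k)| < f t - v.
  apply: he => //=; move: ke; rewrite lt_min => /andP[+ _].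
  by rewrite ltr_distl => ?; apply/andP; split; lra.
by move/(le_lt_trans (ler_norm _)); lra.
Qed.

End cadlag_paths.

(** * Almost sure limits and integrable majorants *)

Section limits_of_random_variables.
Context d (Omega : measurableType d) (R : realType) (P : probability Omega R).

Lemma gmeas_cvg_ae (G : set (set Omega)) (X_ : nat -> Omega -> R) (X : Omega -> R) :
  (forall N, P.-negligible N -> <<s G >> N) ->
  (forall n, gmeas G (X_ n)) ->
  {ae P, forall w, X_ n w @[n --> \oo] --> X w} -> gmeas G X.
Proof.
move=> Gnull mX XX.
pose N := [set w | ~ (X_ n w @[n --> \oo] --> X w)].
have hN : P.-negligible N by exact: XX.
pose i w : R := \1_(~` N) w.
have mi : gmeas G i.
  apply/gmeasP; apply: measurable_indic.
  by apply: (@measurableC _ (g_sigma_algebraType G)); exact: Gnull.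
have mXi : gmeas G (fun w => X w * i w).
  apply: (@gmeas_cvg _ _ _ G (fun n w => X_ n w * i w)).
    by move=> n; exact: gmeasM.
  move=> w; rewrite /i indicE; case: (boolP (w \in ~` N)) => [|_].
    by rewrite inE => /contrapT hw; apply: cvgM => //; exact: cvg_cst.
  by under eq_cvg do rewrite mulr0; rewrite mulr0; exact: cvg_cst.
apply: (gmeas_ae_eq Gnull mXi); apply: filterS XX => w hw.
by rewrite /i indicE mem_set ?mulr1// => /(_ hw).
Qed.

Lemma Ex_dominated (X_ : nat -> Omega -> R) (X Y : Omega -> R) :
  (forall n, measurable_fun setT (X_ n)) -> measurable_fun setT X ->
  {ae P, forall w, X_ n w @[n --> \oo] --> X w} -> L1 P Y ->
  {ae P, forall w n, `|X_ n w| <= Y w} ->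
  L1 P X /\ Ex P (X_ n) @[n --> \oo] --> Ex P X.
Proof.
move=> mX_ mX XX iY XY.
have h1 : {ae P, forall w, setT w -> (EFin \o X_ n) w @[n --> \oo] --> (EFin \o X) w}.
  by apply: filterS XX => w hw _; apply: cvg_EFin => //; exact: nearW.
have h2 : {ae P, forall w n, setT w -> (`|(EFin \o X_ n) w| <= (EFin \o Y) w)%E}.
  by apply: filterS XY => w hw n _; rewrite /= lee_fin.
have mX_' n : measurable_fun setT (EFin \o X_ n) by exact/measurable_EFinP.
have mX' : measurable_fun setT (EFin \o X) by exact/measurable_EFinP.
have [iX _ h] := dominated_convergence measurableT mX_' mX' h1 iY h2.
split=> //; have iX_ n : L1 P (X_ n).
  apply/integrableP; split; first exact/measurable_EFinP.
  have /integrableP[_ +] := iY; apply: le_lt_trans.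
  apply: ae_ge0_mono_integral => //.
    by apply: measurableT_comp => //; exact: measurable_int iY.
  apply: filterS XY => w /(_ n) hw; rewrite /= lee_fin (le_trans hw)//.
  exact: ler_norm.
have {}h : (\int[P]_w (X_ n w)%:E)%E @[n --> \oo] --> (Ex P X)%:E by rewrite -Ex_int.
move/fine_cvgP : h => [_]; apply: cvg_trans.
by apply: near_eq_cvg; apply: nearW => n.
Qed.

Lemma L1_ae_le (X Y : Omega -> R) : measurable_fun setT X -> L1 P Y ->
  {ae P, forall w, `|X w| <= Y w} -> L1 P X.
Proof.
move=> mX iY XY; apply/integrableP; split; first exact/measurable_EFinP.
have /integrableP[_ +] := iY; apply: le_lt_trans.
apply: ae_ge0_mono_integral => //.
  by apply: measurableT_comp => //; exact: measurable_int iY.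
by apply: filterS XY => w hw; rewrite /= lee_fin (le_trans hw)// ler_norm.
Qed.

Lemma Ex_ae_le (X Y : Omega -> R) : L1 P X -> L1 P Y ->
  {ae P, forall w, X w <= Y w} -> Ex P X <= Ex P Y.
Proof.
move=> iX iY XY.
have iM : L1 P (fun w => Num.min (X w) (Y w)).
  apply: (L1_le (Y := fun w => `|X w| + `|Y w|)).
  - by apply: measurable_minr; [exact: L1_meas iX|exact: L1_meas iY].
  - by apply: L1D; [exact: (integrable_norm iX)|exact: (integrable_norm iY)].
  - move=> w; rewrite [leRHS]ger0_norm ?addr_ge0//.
    by case: (leP (X w) (Y w)) => _; [rewrite lerDl|rewrite lerDr].
rewrite (@Ex_ae_eq _ _ _ P X (fun w => Num.min (X w) (Y w)))//.
  by apply: Ex_le => // w; rewrite ge_min lexx orbT.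
by apply: filterS XY => w /min_l.
Qed.

Lemma finite_dominating (W : Omega -> \bar R) (C : R) :
  measurable_fun setT W -> (forall w, 0 <= W w)%E ->
  (\int[P]_w W w <= C%:E)%E ->
  exists V : Omega -> R, [/\ L1 P V, forall w, 0 <= V w, Ex P V <= C &
    {ae P, forall w, W w = (V w)%:E}].
Proof.
move=> mW W0 WC.
have iW : P.-integrable setT W.
  apply/integrableP; split => //; under eq_integral do rewrite gee0_abs//.
  by apply: le_lt_trans WC _; rewrite ltry.
have WV : {ae P, forall w, W w = (fine (W w))%:E}.
  by apply: filterS (integrable_ae measurableT iW) => w /(_ Logic.I) /fineK.
have mV : measurable_fun setT (fine \o W) by exact: measurableT_comp.
have EV : (\int[P]_w (fine (W w))%:E = \int[P]_w W w)%E.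
  apply: ae_ge0_eq_integral => //.
    by move=> w; rewrite lee_fin fine_ge0.
  by apply: filterS WV => w /esym.
have iV : L1 P (fine \o W).
  apply/integrableP; split; first exact/measurable_EFinP.
  under eq_integral do rewrite gee0_abs ?lee_fin ?fine_ge0//.
  by rewrite EV; apply: le_lt_trans WC _; rewrite ltry.
exists (fine \o W); split => //.
- by move=> w; rewrite fine_ge0.
- by rewrite -lee_fin -Ex_int// EV.
Qed.

(** Fatou's lemma: [W] is the lower limit of the [V n], made real-valued off a null set. The [V n]
    need not be monotone, since only values that lie below [V n] from some n on have to stay below
    [W]. *)
Lemma liminf_dominating (V : nat -> Omega -> R) (C : R) :
  (forall n, L1 P (V n)) -> (forall n w, 0 <= V n w) ->
  (forall n, Ex P (V n) <= C) ->
  exists W : Omega -> R, [/\ L1 P W, forall w, 0 <= W w, Ex P W <= C &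
    {ae P, forall w v, (\forall n \near \oo, v <= V n w) -> v <= W w}].
Proof.
move=> iV V0 VC.
pose W w := limn_einf (fun j => (V j w)%:E).
have mV j : measurable_fun setT (fun w => (V j w)%:E).
  exact/measurable_EFinP/L1_meas.
have V0' n w : (0 <= (V n w)%:E)%E by rewrite lee_fin.
have mW : measurable_fun setT W.
  apply: (emeasurable_fun_cvg (fun n w => einfs (fun j => (V j w)%:E) n)).
    by move=> n; exact: measurable_fun_einfs.
  by move=> w _; rewrite /W limn_einf_lim; exact: is_cvg_einfs.
have W0 w : (0 <= W w)%E.
  rewrite /W limn_einf_lim; apply: lime_ge; first exact: is_cvg_einfs.
  by apply: nearW => n; apply: le_ereal_inf_tmp => _ [k _ <-].
have WC : (\int[P]_w W w <= C%:E)%E.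
  apply: (le_trans (fatou P measurableT mV (fun n w _ => V0' n w))).
  rewrite limn_einf_lim; apply: lime_le; first exact: is_cvg_einfs.
  apply: nearW => n; apply: ereal_inf_le => /=.
  exists (\int[P]_w (V n w)%:E)%E; first by exists n => /=.
  by rewrite Ex_int// lee_fin.
have [W' [iW W'0 W'C WW']] := finite_dominating mW W0 WC.
exists W'; split => //; apply: filterS WW' => w hw v [k _ vk].
rewrite -lee_fin -hw /W limn_einf_lim; apply: lime_ge; first exact: is_cvg_einfs.
near=> n; apply: le_ereal_inf_tmp => _ [i /= ni <-].
rewrite lee_fin; apply: vk => /=; apply: leq_trans ni.
by near: n; exact: nbhs_infty_ge.
Unshelve. all: by end_near. Qed.

End limits_of_random_variables.

Lemma step_quad_mono (R : realType) (I : finType) (lo hi : I -> R) (x : I -> R)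
    (s t : R) : (forall i, 0 <= lo i) -> s <= t ->
  step_quad lo hi x s <= step_quad lo hi x t.
Proof.
move=> lo0 st; rewrite -lee_fin -!integral_step_quad//.
rewrite integral_mkcond [leRHS]integral_mkcond.
apply: ge0_mono_integral => u _; rewrite /patch.
  by case: ifP => // _; rewrite lee_fin sqr_ge0.
case: ifPn => [|_]; last by case: ifP => // _; rewrite lee_fin sqr_ge0.
rewrite inE/= in_itv/= => /andP[u0 us].
by rewrite ifT// inE/= in_itv/= u0 (le_trans us).
Qed.

(** * Finite sums against the Levy process *)

Section levy_integral.
Context (R : realType) (d : measure_display) (Omega : measurableType d).
Context (P : probability Omega R) (Pc : measure_is_complete P).
Context (T : R) (T0 : 0 < T).
Context (x0 : {RV P >-> R}) (z : R -> {RV P >-> R}) (a : R -> {RV P >-> nat}).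
Context (hz : levy_process T z) (hind : independent_data T x0 z a).
Context (hz2 : forall t, 0 <= t <= T -> sq_integrable P (z t)).

Let G := data_events x0 z a.
Let b := levy_drift T z.
Let c := levy_var T z.
Let M := levy_mart T z.

Let Gm t : G t `<=` measurable. Proof. exact: data_events_measurable. Qed.

Let GS s t : s <= t -> G s `<=` G t. Proof. exact: data_events_mono. Qed.

Let M_incr s t : 0 <= s -> s <= t -> t <= T ->
  [/\ L2 P (fun w => M t w - M s w), Ex P (fun w => M t w - M s w) = 0 &
      Ex P (fun w => (M t w - M s w) ^+ 2) = c * (t - s)].
Proof. exact: levy_mart_increment. Qed.

Let M_adapted t : 0 <= t <= T -> gmeas (G t) (M t).
Proof.
move=> /andP[t0 tT]; apply: gmeasB; last exact: gmeas_cst.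
by apply: filtration_z; rewrite t0 lexx.
Qed.

Let M_indep s t : 0 <= s -> s <= t -> t <= T ->
  indep_of P <<s G s >> (fun w => M t w - M s w).
Proof.
move=> s0 st tT; have h := filtration_indep Pc hz hind s0 st tT.
have -> : (fun w => M t w - M s w) =
    (fun y => y - b * (t - s)) \o (fun w => z t w - z s w).
  by apply/funext => w; rewrite /M /levy_mart /= -/b; ring.
by apply: indep_of_comp h; exact: measurable_funB.
Qed.

Section finite_sum.
Context (I : finType) (lo hi : I -> R) (xi : I -> Omega -> R).
Context (lo0 : forall i, 0 <= lo i) (lohi : forall i, lo i <= hi i).
Context (hiT : forall i, hi i <= T).
Context (mxi : forall i, gmeas (G (lo i)) (xi i)) (ixi : forall i, L2 P (xi i)).

Definition levy_sum (t : R) (w : Omega) : R :=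
  \sum_i xi i w * (z (Num.min t (hi i)) w - z (Num.min t (lo i)) w).

Let quad t w := step_quad lo hi (fun i => xi i w) t.

Let drift t w := \sum_i xi i w * (Num.min t (hi i) - Num.min t (lo i)).

Let levy_sumE t w : levy_sum t w = mart_sum M lo hi xi t w + b * drift t w.
Proof.
rewrite mulr_sumr -big_split; apply: eq_bigr => i _.
by rewrite /M /levy_mart -/b /=; ring.
Qed.

Let quad_L1 t : L1 P (quad t). Proof. exact: mart_quad_L1. Qed.

Let levy_sum_le t w : 0 <= t -> t <= T ->
  levy_sum t w ^+ 2 <=
  2 * mart_sum M lo hi xi t w ^+ 2 + 2 * b ^+ 2 * T * quad t w.
Proof.
move=> t0 tT; rewrite levy_sumE.
have := @step_quad_drift _ _ lo hi (fun i => xi i w) t T lo0 lohi hiT t0 tT.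
rewrite -/(drift t w) -/(quad t w) => h.
have q0 : 0 <= quad t w by exact: step_quad_ge0.
have h' : drift t w ^+ 2 <= T * quad t w.
  by apply: (le_trans h); rewrite ler_wpM2r.
have : b ^+ 2 * drift t w ^+ 2 <= b ^+ 2 * (T * quad t w).
  by rewrite ler_wpM2l ?sqr_ge0.
have := sqr_ge0 (mart_sum M lo hi xi t w - b * drift t w).
rewrite !expr2; nra.
Qed.

Lemma levy_sum_L2 t : 0 <= t -> t <= T -> L2 P (levy_sum t).
Proof.
move=> t0 tT; have iM : L2 P (mart_sum M lo hi xi t).
  by apply: (mart_sum_L2 Gm M_incr M_indep).
have -> : levy_sum t = fun w => mart_sum M lo hi xi t w + b * drift t w.
  by apply/funext => w; exact: levy_sumE.
apply: L2D => //; apply: L2Z; apply: L2_sum => i _.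
have := L2Z (Num.min t (hi i) - Num.min t (lo i)) (ixi i).
by congr L2; apply/funext => w; rewrite mulrC.
Qed.

(* 16 = 2 (4 + 4): Doob's inequality is applied to the martingale part and to its
   opposite; the second term is Cauchy-Schwarz for the drift. *)
Definition levy_const : R := 16 * c + 2 * b ^+ 2 * T.

Let c0 : 0 <= c. Proof. exact: (levy_var_ge0 T0 hz2). Qed.

Let b0 : 0 <= 2 * b ^+ 2 * T.
Proof. by apply: mulr_ge0; [rewrite mulr_ge0 ?sqr_ge0|exact: ltW]. Qed.

Lemma levy_const_ge0 : 0 <= levy_const.
Proof. by apply: addr_ge0; [exact: mulr_ge0|exact: b0]. Qed.

Lemma levy_sum_sq t : 0 <= t -> t <= T ->
  Ex P (fun w => levy_sum t w ^+ 2) <= levy_const * Ex P (quad t).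
Proof.
move=> t0 tT; have iM : L2 P (mart_sum M lo hi xi t).
  by apply: (mart_sum_L2 Gm M_incr M_indep).
apply: (@le_trans _ _ (Ex P (fun w =>
    2 * mart_sum M lo hi xi t w ^+ 2 + 2 * b ^+ 2 * T * quad t w))).
  apply: Ex_le => [||w]; last exact: levy_sum_le.
  - exact/L2_sq/levy_sum_L2.
  - by apply: L1D; [exact/L1Z/L2_sq|exact: L1Z].
rewrite ExD; [|exact/L1Z/L2_sq|exact: L1Z].
rewrite ExZ; last exact: L2_sq.
rewrite ExZ// (mart_sum_isometry Gm GS M_incr M_indep M_adapted)//.
have q0 : 0 <= Ex P (quad t) by apply: Ex_ge0 => w; exact: step_quad_ge0.
rewrite -/(quad t) /levy_const; have := mulr_ge0 c0 q0; nra.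
Qed.

Lemma levy_sum_cadlag w : cadlag_on T (z ^~ w) -> cadlag_on T (levy_sum ^~ w).
Proof.
move=> zw; apply: cadlag_on_sum => i; apply: cadlag_onZ.
apply: cadlag_onD; first exact: (@cadlag_on_min _ _ (z ^~ w)).
have := cadlag_onZ (-1) (@cadlag_on_min _ _ _ (lo i) zw).
by congr cadlag_on; apply/funext => t; rewrite mulN1r.
Qed.

Lemma levy_sum_adapted t : 0 <= t -> t <= T -> gmeas (G t) (levy_sum t).
Proof.
move=> t0 tT; apply: gmeas_sum => i.
have [tlo|/ltW lot] := leP t (lo i).
  rewrite min_l ?(le_trans tlo)//.
  by under eq_fun do rewrite subrr mulr0; exact: gmeas_cst.
apply: gmeasM.
  apply: gmeas_sub (@mxi i) => B GB; apply: sub_sigma_algebra; exact: GS GB.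
apply: gmeasB; apply: filtration_z; last by rewrite lo0.
by rewrite le_min t0 (le_trans (lo0 i))// ge_min lexx.
Qed.

(** Doob's bound is uniform over the dyadic grids. A dyadic time belongs to all finer grids, so the
    square at this time is eventually below their majorants, hence below the lower limit [W]; right
    continuity of the paths covers the other times. *)
Lemma levy_sum_sup : exists W : Omega -> R,
  [/\ L1 P W, forall w, 0 <= W w, Ex P W <= levy_const * Ex P (quad T) &
      {ae P, forall w, forall t, 0 <= t <= T -> levy_sum t w ^+ 2 <= W w}].
Proof.
(* [mart_sum_maximal] takes an infinite sequence of times in [0, T]: past the index 2 ^ j the grid
   is stopped at T. *)
pose u j k := Num.min (dyadic T j k) T.
have V_ex j : exists V : Omega -> R,
  [/\ L1 P V, forall w, 0 <= V w,
      forall k w, (k <= 2 ^ j)%N -> mart_sum M lo hi xi (u j k) w ^+ 2 <= V w &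
      Ex P V <= 8 * c * Ex P (quad T)].
  have uT : u j (2 ^ j)%N = T.
    by rewrite /u /dyadic natrX mulrC divfK ?minxx// gt_eqF// exprn_gt0.
  have := @mart_sum_maximal _ _ _ P T G Gm GS M c M_incr M_indep M_adapted
    I lo hi xi lo0 lohi hiT mxi ixi (u j) _ _ _ (2 ^ j)%N.
  rewrite uT; apply.
  - by rewrite /u /dyadic mul0r min_l// ltW.
  - move=> k; rewrite /u le_min !ge_min lexx orbT andbT; apply/orP; left.
    by rewrite /dyadic ler_wpM2r ?ler_nat// divr_ge0 ?(ltW T0)// exprn_ge0.
  - by move=> k; rewrite /u ge_min lexx orbT.
have [V hV] := choice V_ex.
pose V' j w := 2 * V j w + 2 * b ^+ 2 * T * quad T w.
have q0 w : 0 <= quad T w by exact: step_quad_ge0.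
have V'L1 j : L1 P (V' j).
  by have [iV _ _ _] := hV j; apply: L1D; exact: L1Z.
have V'0 j w : 0 <= V' j w.
  by have [_ V0 _ _] := hV j; apply: addr_ge0; apply: mulr_ge0.
have EV' j : Ex P (V' j) <= levy_const * Ex P (quad T).
  have [iV V0 _ eV] := hV j; rewrite ExD; [|exact: L1Z|exact: L1Z].
  by rewrite !ExZ// /levy_const; nra.
have [W [iW W0 WC hW]] := liminf_dominating V'L1 V'0 EV'.
exists W; split => //.
apply: filterS2 (levy_cadlag hz) hW => w zw hWw t tT; rewrite -lee_fin.
have [cr _] := levy_sum_cadlag zw.
apply: (@right_continuous_le _ T (fun t => levy_sum t w ^+ 2)) t tT => //.
  by move=> t /cr h; exact: (cvgM h h).
move=> j k kj; rewrite lee_fin; apply: hWw; near=> i.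
have ji : (j <= i)%N by near: i; exact: nbhs_infty_ge.
have /andP[d0 dT] := dyadic_mem T0 kj.
apply: (le_trans (levy_sum_le _ d0 dT)).
have [_ _ hVi _] := hV i.
have E : dyadic T j k = u i (k * 2 ^ (i - j))%N.
  have : dyadic T j k = dyadic T i (k * 2 ^ (i - j))%N.
    rewrite /dyadic -{2}(subnK ji) natrM natrX exprD invfM.
    have : (2 : R) ^+ (i - j) != 0 by rewrite gt_eqF// exprn_gt0.
    move=> h; field; rewrite h/=.
    by rewrite gt_eqF// exprn_gt0.
  by move=> e1; rewrite /u -e1 min_l.
have ki : (k * 2 ^ (i - j) <= 2 ^ i)%N.
  by rewrite -{2}(subnK ji) addnC expnD leq_pmul2r ?expn_gt0.
apply: lerD; first by rewrite ler_pM2l// E; exact: hVi.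
by rewrite ler_wpM2l//; exact: step_quad_mono.
Unshelve. all: by end_near. Qed.

End finite_sum.
End levy_integral.

(** * The Wasserstein metric and the coefficients *)

Section wasserstein_coupling.
Context (R : realType) (d : measure_display) (Omega : measurableType d).
Context (P : probability Omega R).
Implicit Types X Y : Omega -> R.

(** Made total by an arbitrary value for non-measurable [X], so that the law of a process at time t
    can be written before measurability at t is known; left limits are controlled only on ]0, T]. *)
Definition lawof X : probability R R :=
  if pselect (measurable_fun setT X) is left mX
  then distribution P (HB.pack X (isMeasurableFun.Build _ _ _ _ _ mX) : {mfun Omega >-> R})
  else \d_(0 : R).

Lemma lawofP X : measurable_fun setT X -> has_law P X (lawof X).
Proof. by move=> mX A mA; rewrite /lawof; case: pselect. Qed.

Lemma has_law_dirac0 : has_law P (fun=> 0) \d_(0 : R).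
Proof.
move=> A mA; rewrite /= diracE; case: (boolP (0 \in A)) => [|]; rewrite ?inE ?notin_setE => A0.
  rewrite (_ : _ @^-1` A = setT) ?probability_setT//.
  by apply/seteqP; split => w.
by rewrite (_ : _ @^-1` A = set0) ?measure0//; apply/seteqP; split => w.
Qed.

Lemma integral_has_law X mu (f : R -> \bar R) : measurable_fun setT X ->
  has_law P X mu -> measurable_fun setT f -> (forall x, 0 <= f x)%E ->
  (\int[mu]_x f x = \int[P]_w f (X w))%E.
Proof.
move=> mX hX mf f0.
pose X' : {mfun Omega >-> R} := HB.pack X (isMeasurableFun.Build _ _ _ _ _ mX).
rewrite -[RHS](@ge0_integral_distribution _ _ _ _ _ P X')//.
by apply: eq_measure_integral => A mA _; exact: hX.
Qed.

Lemma has_law_P2 X mu : L2 P X -> has_law P X mu -> in_P2 mu.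
Proof.
move=> [mX iX] hX; rewrite /in_P2 (integral_has_law mX hX)//.
  by apply/measurable_EFinP; exact: exprn_measurable.
by move=> x; rewrite lee_fin sqr_ge0.
Qed.

(* The law of the pair (X, Y) is a coupling. *)
Lemma W2_le X Y mu nu : measurable_fun setT X -> measurable_fun setT Y ->
  has_law P X mu -> has_law P Y nu -> L2 P (fun w => X w - Y w) ->
  (W2 mu nu <= (Num.sqrt (Ex P (fun w => (X w - Y w) ^+ 2)))%:E)%E.
Proof.
move=> mX mY hX hY iXY.
have mXY : measurable_fun setT (fun w => (X w, Y w)) by exact: measurable_fun_pair.
pose Z : {mfun Omega >-> (R * R)%type} :=
  HB.pack (fun w => (X w, Y w)) (isMeasurableFun.Build _ _ _ _ _ mXY).
have mf : measurable_fun setT (fun p : R * R => ((p.1 - p.2) ^+ 2)%:E).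
  apply/measurable_EFinP/measurable_funX/measurable_funB.
    exact: measurable_fst.
  exact: measurable_snd.
apply: ereal_inf_lbound; exists (distribution P Z).
  move=> A mA; split.
    rewrite hX//; congr (P _).
    by apply/seteqP; split => w /=; [case|].
  rewrite hY//; congr (P _).
  by apply/seteqP; split => w /=; [case|].
rewrite ge0_integral_distribution//=; last by move=> p; rewrite lee_fin sqr_ge0.
rewrite Ex_int ?poweR_EFin ?powR12_sqrt//; last exact: L2_sq.
by apply: Ex_ge0 => w; exact: sqr_ge0.
Qed.

Section lipschitz.
Context (T : R) (sigma : R -> R -> probability R R -> R).
Context (hsigma : lipschitz_on_P2 T sigma).

(** The Wasserstein distance is replaced by the L^2 distance of the coupled variables, and the bound
    is squared so that it can be integrated. The factor 2 is that of (p + q)^2 <= 2 (p^2 + q^2); the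
    given constant may be negative, hence the absolute value in the proof. *)
Lemma lipschitz_law : exists2 K : R, 0 <= K &
  forall t X Y mu nu x y, 0 <= t <= T -> L2 P X -> L2 P Y ->
    has_law P X mu -> has_law P Y nu ->
    (sigma t x mu - sigma t y nu) ^+ 2 <=
    K * ((x - y) ^+ 2 + Ex P (fun w => (X w - Y w) ^+ 2)).
Proof.
have [K hK] := hsigma.
exists (2 * K ^+ 2); first by rewrite mulr_ge0 ?sqr_ge0.
move=> t X Y mu nu x y tT iX iY hX hY.
set e := Ex P _; have e0 : 0 <= e by apply: Ex_ge0 => w; exact: sqr_ge0.
have := hK t tT x y mu nu (has_law_P2 iX hX) (has_law_P2 iY hY).
have mX : measurable_fun setT X by case: iX.
have mY : measurable_fun setT Y by case: iY.
have := W2_le mX mY hX hY (L2B iX iY); rewrite -/e => hW h.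
have W0 : (0 <= W2 mu nu)%E.
  by apply: le_ereal_inf_tmp => _ [Q _ <-]; exact: poweR_ge0.
have {h hW} : `|sigma t x mu - sigma t y nu| <= `|K| * (`|x - y| + Num.sqrt e).
  rewrite -lee_fin; apply: (le_trans h).
  rewrite EFinM EFinD; apply: (@le_trans _ _ (`|K|%:E * (`|x - y|%:E + W2 mu nu))%E).
    rewrite lee_wpmul2r//; first by rewrite adde_ge0.
    by rewrite lee_fin ler_norm.
  by rewrite lee_wpmul2l//; rewrite leeD2l.
move=> h; rewrite -real_normK ?num_real//.
apply: (@le_trans _ _ ((`|K| * (`|x - y| + Num.sqrt e)) ^+ 2)).
  by rewrite lerXn2r ?nnegrE ?mulr_ge0 ?addr_ge0 ?sqrtr_ge0.
rewrite exprMn real_normK ?num_real// -mulrA.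
have -> : 2 * (K ^+ 2 * ((x - y) ^+ 2 + e)) = K ^+ 2 * (2 * ((x - y) ^+ 2 + e)).
  by rewrite mulrCA.
rewrite ler_wpM2l ?sqr_ge0//.
have h1 := sqr_sqrtr e0; have h2 := real_normK (num_real (x - y)).
have := sqr_ge0 (`|x - y| - Num.sqrt e).
by move: h1 h2; rewrite !expr2; nra.
Qed.

End lipschitz.

End wasserstein_coupling.

(** Compactness of [0, T] in its near-covering form, the bound being the parameter that tends to
    +oo. Around t the two one-sided limits bound [f] on either side, the value [f t] is counted
    apart, and at an end point one side is empty. *)
Lemma caglad_on_bounded (R : realType) (T : R) (f : R -> R) :
  caglad_on T f -> exists B, forall t, 0 <= t <= T -> `|f t| <= B.
Proof.
move=> [fl fr].
have /compact_near_coveringP/(_ R (+oo%R : set_system R) (fun i x => 0 <= x <= T -> `|f x| <= i)) :=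
  @segment_compact R 0 T.
move=> /(_ _); case.
  move=> t; rewrite /= in_itv/= => /andP[t0 tT].
  have [e1 [B1 [e1p h1]]] : exists e B : R, 0 < e /\
      forall s, 0 <= s -> t - e < s < t -> `|f s| <= B.
    move: t0; rewrite le_eqVlt => /predU1P[<-|t0].
      exists 1, 0; split => // s s0; rewrite sub0r => /andP[_]; lra.
    have t0T : 0 < t <= T by rewrite t0.
    have /cvgrPdist_lt/(_ 1 ltr01)[e /= e0 he] := fl t t0T.
    exists e, (`|f t| + 1); split => // s _ /andP[s1 s2].
    have : `|f t - f s| < 1.
      by apply: he => //=; rewrite ltr_distl; apply/andP; split; lra.
    move=> h; have := ler_normB (f t) (f t - f s); rewrite subKr; lra.
  have [e2 [B2 [e2p h2]]] : exists e B : R, 0 < e /\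
      forall s, s <= T -> t < s < t + e -> `|f s| <= B.
    move: tT; rewrite le_eqVlt => /predU1P[->|tT].
      exists 1, 0; split => // s sT /andP[]; lra.
    have t0T : 0 <= t < T by rewrite t0.
    have /cvgrPdist_lt/(_ 1 ltr01)[e /= e0 he] := fr t t0T.
    exists e, (`|lim (f @ t^'+)| + 1); split => // s _ /andP[s1 s2].
    have : `|lim (f @ t^'+) - f s| < 1.
      by apply: he => //=; rewrite ltr_distl; apply/andP; split; lra.
    by move=> h; have := ler_normB (lim (f @ t^'+)) (lim (f @ t^'+) - f s); rewrite subKr; lra.
  exists (ball t (Num.min e1 e2), [set i | Num.max `|f t| (Num.max B1 B2) <= i]).
    split => /=; first by apply: nbhsx_ballx; rewrite lt_min e1p.
    exact: nbhs_pinfty_ge (num_real _).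
  move=> [s i] /= []; rewrite /ball/= lt_min => /andP[d1 d2].
  rewrite !ge_max => /and3P[i1 i2 i3] /andP[s0 sT].
  move: d1 d2; rewrite !ltr_distl => /andP[d1 d1'] /andP[d2 d2'].
  have [st|ts|->//] := ltgtP s t.
    by apply: le_trans i2; apply: h1 => //; apply/andP; split; lra.
  by apply: le_trans i3; apply: h2 => //; apply/andP; split; lra.
move=> M [_ hM]; exists (M + 1) => t tT.
have := hM (M + 1); rewrite ltrDl ltr01 => /(_ isT t).
by rewrite /= in_itv/= => /(_ tT tT).
Qed.

(** * Dyadic sampling and the norm of L^2(dt * P) *)

Section dyadic_grid.
Context (R : realType) (T : R) (T0 : 0 < T).

(** The left end of the level-n dyadic interval that contains s, for s in ]0, T]. The sum has the
    shape of [sp_val], so that a step process with sampled coefficients can be evaluated by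
    [grid_ptE]. *)
Definition grid_pt (n : nat) (s : R) : R :=
  \sum_(k < 2 ^ n) dyadic T n k * (dyadic T n k < s <= dyadic T n k.+1)%R%:R.

Lemma grid_ptP n s : 0 < s <= T -> exists2 k, (k < 2 ^ n)%N &
  dyadic T n k < s <= dyadic T n k.+1 /\
  forall f : R -> R, \sum_(i < 2 ^ n)
    f (dyadic T n i) * (dyadic T n i < s <= dyadic T n i.+1)%R%:R
    = f (dyadic T n k).
Proof.
move=> /andP[s0 sT].
have p0 : 0 < T / 2 ^+ n by rewrite divr_gt0// exprn_gt0.
have hm i j : (i <= j)%N -> dyadic T n i <= dyadic T n j.
  by move=> ij; rewrite /dyadic ler_wpM2r ?ler_nat// ltW.
have dT : dyadic T n (2 ^ n) = T.
  by rewrite /dyadic natrX mulrC divfK// gt_eqF// exprn_gt0.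
have [k kn hk] : exists2 k, (k < 2 ^ n)%N & dyadic T n k < s <= dyadic T n k.+1.
  have ex : exists k, s <= dyadic T n k by exists (2 ^ n)%N; rewrite dT.
  case: (ex_minnP ex) => -[|k] sk kmin.
    by exfalso; move: sk; rewrite /dyadic mul0r leNgt s0.
  exists k; first by apply: kmin; rewrite dT.
  by rewrite sk andbT ltNge; apply/negP => /kmin; rewrite ltnn.
exists k => //; split => // f.
rewrite (bigD1 (Ordinal kn))//= hk mulr1 big1 ?addr0// => i ik.
suff -> : (dyadic T n i < s <= dyadic T n i.+1) = false by rewrite mulr0.
apply/negP => /andP[h1 h2]; move/andP : hk => [h3 h4].
have [ilk|kli|iEk] := ltngtP i k.
- by have := le_lt_trans (le_trans h2 (hm _ _ ilk)) h3; rewrite ltxx.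
- by have := le_lt_trans (le_trans h4 (hm _ _ kli)) h1; rewrite ltxx.
- by move/eqP : ik; apply; apply/val_inj.
Qed.

Lemma grid_ptE n s (f : R -> R) : 0 < s <= T ->
  \sum_(i < 2 ^ n) f (dyadic T n i) * (dyadic T n i < s <= dyadic T n i.+1)%R%:R
    = f (grid_pt n s).
Proof.
move=> sT; have [k kn [_ h]] := grid_ptP n sT.
by rewrite h -(h id).
Qed.

Lemma grid_pt_itv n s : 0 < s <= T ->
  [/\ 0 <= grid_pt n s, grid_pt n s <= T, grid_pt n s < s & s - T / 2 ^+ n <= grid_pt n s].
Proof.
move=> sT; have [k kn [/andP[h1 h2] h]] := grid_ptP n sT.
rewrite /grid_pt (h id); have /andP[d0 dT] := dyadic_mem T0 (ltnW kn).
split => //; move: h2; rewrite /dyadic -(natr1 k) mulrDl mul1r; lra.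
Qed.

(** The intervals are open on the left, so the sampling times are strictly below s and sampling a
    path recovers its left limit. *)
Lemma grid_pt_cvg s : 0 < s <= T -> grid_pt n s @[n --> \oo] --> s^'-.
Proof.
move=> sT A [e /= e0 he]; rewrite nbhs_filterE/=.
have := archi_boundP (ltW (divr_gt0 T0 e0)); set j := Num.bound _ => jT.
exists j => // n /= jn.
have [_ _ h1 h2] := grid_pt_itv n sT.
apply: he => //=.
have hT : T / 2 ^+ n < e.
  rewrite ltr_pdivrMr ?exprn_gt0// mulrC -ltr_pdivrMr//; apply: lt_le_trans jT _.
  by rewrite -natrX ler_nat (leq_trans jn)// ltnW// ltn_expl.
by rewrite ltr_distl; apply/andP; split; lra.
Qed.

End dyadic_grid.

Section time_square_norm.
Context d (Omega : measurableType d) (R : realType) (P : probability Omega R).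
Context (T : R).
Notation leb := (@lebesgue_measure R).
Implicit Types f g : R -> Omega -> R.

Definition jmeas f := measurable_fun setT (fun p : Omega * R => f p.2 p.1).

(* The integrands are jointly measurable only up to a null set of samples, and only at
   times in (0, T]: left limits need not exist elsewhere. *)
Definition regular f := exists2 g, jmeas g &
  {ae P, forall w, forall s, 0 < s <= T -> f s w = g s w}.

Definition sqnorm f (t : R) : \bar R :=
  (\int[P]_w \int[leb]_(s in `]0%R, t]) ((f s w) ^+ 2)%:E)%E.

Lemma regularB f g : regular f -> regular g -> regular (fun s w => f s w - g s w).
Proof.
move=> [f' mf ff'] [g' mg gg']; exists (fun s w => f' s w - g' s w).
  exact: measurable_funB.
by apply: filterS2 ff' gg' => w hf hg s sT; rewrite hf// hg.
Qed.

(** Extension by 0 outside ]0, t], so that Tonelli's theorem applies on the whole product space. *)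
Let cut t g (p : Omega * R) : \bar R := ((g p.2 p.1 ^+ 2) * (0 < p.2 <= t)%R%:R)%:E.

Let cut_ge0 t g p : (0 <= cut t g p)%E.
Proof. by rewrite lee_fin mulr_ge0 ?sqr_ge0. Qed.

Let mcut t g : jmeas g -> measurable_fun setT (cut t g).
Proof.
move=> mg; apply/measurable_EFinP/measurable_funM; first exact: measurable_funX.
have -> : (fun p : Omega * R => (0 < p.2 <= t)%R%:R) =
    (\1_(`]0, t]%classic) : R -> R) \o snd.
  by apply/funext => p; rewrite /= indicE mem_setE in_itv.
apply: measurableT_comp; last exact: measurable_snd.
exact: measurable_indic.
Qed.

Let int_cut t g w : (\int[leb]_(s in `]0%R, t]) ((g s w) ^+ 2)%:E =
  \int[leb]_s cut t g (w, s))%E.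
Proof.
rewrite integral_mkcond; apply: eq_integral => s _.
rewrite /patch /cut /= mem_setE in_itv/=.
by case: ifP => _; rewrite ?mulr1 ?mulr0.
Qed.

Lemma sqnorm_inner_meas g t : jmeas g ->
  measurable_fun setT (fun w => \int[leb]_(s in `]0%R, t]) ((g s w) ^+ 2)%:E)%E.
Proof.
move=> mg; under eq_fun do rewrite int_cut.
exact: (@measurable_fun_fubini_tonelli_F _ _ Omega (measurableTypeR R) R leb _ (mcut t mg) (cut_ge0 t g)).
Qed.

Lemma sqnorm_swap g t : jmeas g ->
  sqnorm g t = (\int[leb]_(s in `]0%R, t]) \int[P]_w ((g s w) ^+ 2)%:E)%E.
Proof.
move=> mg; rewrite /sqnorm.
transitivity (\int[P]_w \int[leb]_s cut t g (w, s))%E.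
  by apply: eq_integral => w _; exact: int_cut.
rewrite (@fubini_tonelli _ _ Omega (measurableTypeR R) R P leb _ (mcut t mg) (cut_ge0 t g)).
rewrite [RHS]integral_mkcond; apply: eq_integral => s _.
rewrite /patch mem_setE in_itv/=; case: ifPn => st; rewrite /cut/=.
  by apply: eq_integral => w _; rewrite st mulr1.
rewrite integral0_eq// => w _; rewrite (negbTE st) mulr0//.
Qed.

Lemma sqnorm_outer_meas g : jmeas g ->
  measurable_fun (`]0, T]%classic : set R) (fun s => \int[P]_w ((g s w) ^+ 2)%:E)%E.
Proof.
move=> mg.
have h := @measurable_fun_fubini_tonelli_G _ _ Omega (measurableTypeR R) R P _
  (mcut T mg) (cut_ge0 T g).
apply: (eq_measurable_fun (fun s => \int[P]_w cut T g (w, s))%E).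
  move=> s; rewrite inE/= in_itv/= => sT.
  by apply: eq_integral => w _; rewrite /cut/= sT mulr1.
exact: (@measurable_funTS _ _ (measurableTypeR R)).
Qed.

Let inner_ge0 f t w : (0 <= \int[leb]_(s in `]0%R, t]) ((f s w) ^+ 2)%:E)%E.
Proof. by apply: integral_ge0 => s _; rewrite lee_fin sqr_ge0. Qed.

Lemma sqnorm_ae f g t : t <= T -> jmeas g ->
  {ae P, forall w, forall s, 0 < s <= T -> f s w = g s w} ->
  sqnorm f t = sqnorm g t.
Proof.
move=> tT mg fg; apply: ae_ge0_eq_integral => //; first exact: sqnorm_inner_meas.
apply: filterS fg => w hw; apply: eq_integral => s.
by rewrite inE/= in_itv/= => /andP[s0 st]; rewrite hw// s0 (le_trans st).
Qed.

Lemma sqnorm_closed f : regular f ->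
  (\int[P]_w \int[leb]_(s in `[0%R, T]) ((f s w) ^+ 2)%:E)%E = sqnorm f T.
Proof.
move=> [g mg fg]; rewrite (sqnorm_ae (lexx T) mg fg).
apply: ae_ge0_eq_integral => //; first by move=> w; apply: integral_ge0 => s _; rewrite lee_fin sqr_ge0.
  exact: sqnorm_inner_meas.
apply: filterS fg => w hw.
have E : {in `]0, T]%classic, (fun s => ((f s w) ^+ 2)%:E) =1 (fun s => ((g s w) ^+ 2)%:E)}.
  by move=> s; rewrite inE/= in_itv/= => /hw ->.
rewrite -integral_itv_obnd_cbnd; first exact: eq_integral.
apply: (eq_measurable_fun (fun s => ((g s w) ^+ 2)%:E)).
  by move=> s sT; rewrite -E.
apply: (@measurable_funTS _ _ (measurableTypeR R)).
apply/measurable_EFinP/measurable_funX.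
exact: (@measurable_fun_pair2 _ _ _ Omega (measurableTypeR R) R (fun p => g p.2 p.1) w mg).
Qed.

Lemma sqnorm_mono_time f s t : s <= t -> (sqnorm f s <= sqnorm f t)%E.
Proof.
move=> st; apply: ge0_mono_integral => // w _.
rewrite integral_mkcond [leRHS]integral_mkcond; apply: ge0_mono_integral => u _.
  by rewrite /patch; case: ifP => // _; rewrite lee_fin sqr_ge0.
rewrite /patch; case: ifPn => [|_]; last by case: ifP => // _; rewrite lee_fin sqr_ge0.
rewrite inE/= in_itv/= => /andP[u0 us].
by rewrite ifT// inE/= in_itv/= u0 (le_trans us).
Qed.

(** A squared triangle inequality with two intermediate processes, typically the integrands lying
    between two step processes. Regularity provides the measurability under which the integrals add
    up. *)
Lemma sqnorm_sum3 f1 f2 f3 f t : t <= T ->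
  regular f1 -> regular f2 -> regular f3 ->
  {ae P, forall w, forall s, 0 < s <= T -> f s w = f1 s w + f2 s w + f3 s w} ->
  (sqnorm f t <= 3%:E * (sqnorm f1 t + sqnorm f2 t + sqnorm f3 t))%E.
Proof.
move=> tT [g1 m1 h1] [g2 m2 h2] [g3 m3 h3] h.
rewrite (sqnorm_ae tT m1 h1) (sqnorm_ae tT m2 h2) (sqnorm_ae tT m3 h3).
pose g s w := g1 s w + g2 s w + g3 s w.
have mg : jmeas g by apply: measurable_funD => //; exact: measurable_funD.
rewrite (@sqnorm_ae _ g)//; last first.
  apply: filterS2 h (filterI h1 (filterI h2 h3)) => w hw [hw1 [hw2 hw3]] s sT.
  by rewrite hw// hw1// hw2// hw3.
have q0 u w (k : R -> Omega -> R) : (0 <= (k u w ^+ 2)%:E)%E by rewrite lee_fin sqr_ge0.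
have mk k w : jmeas k -> measurable_fun `]0, t] (fun s => ((k s w) ^+ 2)%:E).
  move=> mk; apply: (@measurable_funTS _ _ (measurableTypeR R)).
  apply/measurable_EFinP/measurable_funX.
  exact: (@measurable_fun_pair2 _ _ _ Omega (measurableTypeR R) R (fun p => k p.2 p.1) w mk).
rewrite /sqnorm -ge0_integralD//; [|exact: sqnorm_inner_meas..].
rewrite -ge0_integralD//; [|by move=> w _; exact: adde_ge0| |exact: sqnorm_inner_meas]; last first.
  by apply: emeasurable_funD; exact: sqnorm_inner_meas.
rewrite -ge0_integralZl//; last 2 first.
- by do 2 (apply: emeasurable_funD; last exact: sqnorm_inner_meas); exact: sqnorm_inner_meas.
- by move=> w _; do 2 apply: adde_ge0 => //.
apply: ge0_mono_integral => // w _.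
rewrite -ge0_integralD//; [|exact: mk..].
rewrite -ge0_integralD//; [|by move=> s _; exact: adde_ge0|by apply: emeasurable_funD; exact: mk|exact: mk].
rewrite -ge0_integralZl//; last 2 first.
- by do 2 (apply: emeasurable_funD; last exact: mk); exact: mk.
- by move=> s _; do 2 apply: adde_ge0 => //.
apply: ge0_mono_integral => // s _.
rewrite -!EFinD -EFinM lee_fin /g.
have := sqr_ge0 (g1 s w - g2 s w); have := sqr_ge0 (g1 s w - g3 s w).
have := sqr_ge0 (g2 s w - g3 s w); rewrite !expr2; nra.
Qed.

End time_square_norm.

(** The factor 1 / b gained here is what makes the estimates contract once b is large. *)
Lemma integral_expR_le (R : realType) (b t : R) : 0 < b -> 0 <= t ->
  (\int[lebesgue_measure]_(s in `]0%R, t]) (expR (b * s))%:E <= (expR (b * t) / b)%:E)%E.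
Proof.
move=> b0; rewrite le_eqVlt => /predU1P[<-|t0].
  by rewrite set_itvoc0 integral_set0 lee_fin divr_ge0 ?expR_ge0// ltW.
pose F s : R := expR (b * s) / b.
have dF (s : R) : is_derive s (1 : R) F (expR (b * s)).
  rewrite /F; apply: is_derive_eq.
  by rewrite /GRing.scale/=; field; rewrite gt_eqF.
have cf : continuous (fun s => expR (b * s) : R).
  by move=> s; apply: continuous_comp; [exact: mulrl_continuous|exact: continuous_expR].
have cF : continuous F by move=> s; apply: differentiable_continuous; apply/derivable1_diffP.
rewrite integral_itv_obnd_cbnd; last first.
  apply: (@measurable_funTS _ _ (measurableTypeR R)).
  by apply/measurable_EFinP; exact: continuous_measurable_fun.
rewrite (@continuous_FTC2 _ _ F)//.
- by rewrite -EFinB lee_fin lerBlDr lerDl divr_ge0 ?expR_ge0// ltW.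
- exact: continuous_subspaceT.
- split; first by move=> s _; exact: ex_derive.
    by apply: cvg_at_right_filter; exact: cF.
  by apply: cvg_at_left_filter; exact: cF.
- by move=> s _; rewrite derive1E; exact: derive_val.
Qed.

(** * Processes with integrable supremum *)

Section processes.
Context (R : realType) (d : measure_display) (Omega : measurableType d).
Context (P : probability Omega R) (Pc : measure_is_complete P).
Context (T : R) (T0 : 0 < T).
Context (x0 : {RV P >-> R}) (z : R -> {RV P >-> R}) (a : R -> {RV P >-> nat}).

Implicit Types (x y : R -> Omega -> R).

Let G := data_events x0 z a.

(* [W] stands for the supremum of x_t^2, whose measurability is not evident. *)
Definition sup_process (x : R -> Omega -> R) : Prop :=
  [/\ forall t, 0 <= t <= T -> gmeas (G t) (x t),
      {ae P, forall w, cadlag_on T (x ^~ w)} &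
      exists W : Omega -> R, [/\ L1 P W, forall w, 0 <= W w &
        {ae P, forall w, forall t, 0 <= t <= T -> x t w ^+ 2 <= W w}]].

Definition left_proc (x : R -> Omega -> R) (t : R) (w : Omega) : R :=
  left_lim (x ^~ w) t.

Let Gm t : G t `<=` measurable. Proof. exact: data_events_measurable. Qed.

Let GS s t : s <= t -> G s `<=` G t. Proof. exact: data_events_mono. Qed.

Let gS s t (X : Omega -> R) : s <= t -> gmeas (G s) X -> gmeas (G t) X.
Proof.
by move=> st; apply: gmeas_sub => B GB; apply: sub_sigma_algebra; exact: GS GB.
Qed.

Let Gnull t N : P.-negligible N -> <<s G t >> N.
Proof. exact: filtration_null. Qed.

Lemma sup_process_meas x t : sup_process x -> 0 <= t <= T ->
  measurable_fun setT (x t).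
Proof. by move=> [ax _ _] tT; exact: gmeas_measurable (@Gm t) (ax t tT). Qed.

Lemma sup_process_L2 x t : sup_process x -> 0 <= t <= T -> L2 P (x t).
Proof.
move=> hx tT; have mx := sup_process_meas hx tT; have [_ _ [W [iW _ hW]]] := hx.
apply: L2P => //; apply: (L1_ae_le _ iW); first exact: measurable_funX.
by apply: filterS hW => w hw; rewrite ger0_norm ?sqr_ge0// hw.
Qed.

Let cvg_sqr (f : nat -> R) (l : R) :
  f n @[n --> \oo] --> l -> f n ^+ 2 @[n --> \oo] --> l ^+ 2.
Proof. by move=> h; rewrite expr2; exact: cvgM. Qed.

Let comp_grid (V : topologicalType) (f : R -> V) (l : V) s : 0 < s <= T ->
  f @ s^'- --> l -> f (grid_pt T n s) @[n --> \oo] --> l.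
Proof. by move=> sT; apply: cvg_comp; exact: (grid_pt_cvg T0 sT). Qed.

Lemma left_proc_cvg x : sup_process x ->
  {ae P, forall w, forall s, 0 < s <= T ->
    x (grid_pt T n s) w @[n --> \oo] --> left_proc x s w}.
Proof.
move=> [_ cx _]; apply: filterS cx => w [_ cl] s sT.
by apply: (comp_grid sT (f := x ^~ w)); exact: cl.
Qed.

Let gp n s : 0 < s <= T -> 0 <= grid_pt T n s <= T.
Proof. by move=> /(grid_pt_itv T0 n)[-> ->]. Qed.

Lemma left_proc_gmeas x s : sup_process x -> 0 < s <= T ->
  gmeas (G s) (left_proc x s).
Proof.
move=> hx sT; apply: (gmeas_cvg_ae (@Gnull s) (X_ := fun n => x (grid_pt T n s))).
  move=> n; have [ax _ _] := hx; apply: gS (ax _ (gp n sT)).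
  by have [_ _ /ltW] := grid_pt_itv T0 n sT.
by apply: filterS (left_proc_cvg hx) => w; apply.
Qed.

Lemma left_proc_meas x s : sup_process x -> 0 < s <= T ->
  measurable_fun setT (left_proc x s).
Proof. by move=> hx sT; apply: gmeas_measurable (@Gm s) (left_proc_gmeas hx sT). Qed.

Lemma left_proc_le x (W : Omega -> R) :
  {ae P, forall w, cadlag_on T (x ^~ w)} ->
  {ae P, forall w, forall t, 0 <= t <= T -> x t w ^+ 2 <= W w} ->
  {ae P, forall w, forall s, 0 < s <= T -> left_proc x s w ^+ 2 <= W w}.
Proof.
move=> cx hW; apply: filterS2 cx hW => w [_ cl] hw s sT.
have h : x (grid_pt T n s) w @[n --> \oo] --> left_proc x s w.
  by apply: (comp_grid sT (f := x ^~ w)); exact: cl.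
have h2 := cvg_sqr h.
rewrite -(cvg_lim _ h2)//; apply: limr_le; first exact: cvgP h2.
by apply: nearW => n; apply: hw; exact: gp.
Qed.

Lemma left_proc_L2 x s : sup_process x -> 0 < s <= T -> L2 P (left_proc x s).
Proof.
move=> hx sT; have mx := left_proc_meas hx sT; have [_ cx [W [iW _ hW]]] := hx.
apply: L2P => //; apply: (L1_ae_le _ iW); first exact: measurable_funX.
apply: filterS (left_proc_le cx hW) => w /(_ s sT) hw.
by rewrite ger0_norm ?sqr_ge0.
Qed.

Let sqB (p q : R) : (p - q) ^+ 2 <= 2 * (p ^+ 2 + q ^+ 2).
Proof. by have := sqr_ge0 (p + q); rewrite !expr2; nra. Qed.

(** Dominated convergence along the grid: bounds on mean square differences at times before s pass
    to the left limits at s. *)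
Lemma Ex_left_diff x y s : sup_process x -> sup_process y -> 0 < s <= T ->
  Ex P (fun w => (x (grid_pt T n s) w - y (grid_pt T n s) w) ^+ 2) @[n --> \oo]
    --> Ex P (fun w => (left_proc x s w - left_proc y s w) ^+ 2).
Proof.
move=> hx hy sT.
have [_ _ [W [iW _ hW]]] := hx; have [_ _ [V [iV _ hV]]] := hy.
apply: (@Ex_dominated _ _ _ P _ _ (fun w => 2 * (W w + V w)) _ _ _ _ _).2.
- by move=> n; apply/measurable_funX/measurable_funB; apply: sup_process_meas => //; exact: gp.
- by apply/measurable_funX/measurable_funB; exact: left_proc_meas.
- apply: filterS2 (left_proc_cvg hx) (left_proc_cvg hy) => w /(_ s sT) h1 /(_ s sT) h2.
  by apply: cvg_sqr; exact: cvgB.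
- by apply: L1Z; exact: L1D.
- apply: filterS2 hW hV => w h1 h2 n; rewrite ger0_norm ?sqr_ge0//.
  apply: (le_trans (sqB _ _)); rewrite ler_pM2l//.
  by apply: lerD; [apply: h1|apply: h2]; exact: gp.
Qed.

Lemma Ex_left_cvg x s : sup_process x -> 0 < s <= T ->
  Ex P (fun w => (x (grid_pt T n s) w - left_proc x s w) ^+ 2) @[n --> \oo] --> 0.
Proof.
move=> hx sT; have [_ cx [W [iW _ hW]]] := hx.
have -> : 0 = Ex P (fun=> 0 : R) by rewrite Ex_cst.
apply: (@Ex_dominated _ _ _ P _ _ (fun w => 2 * (W w + W w)) _ _ _ _ _).2.
- move=> n; apply/measurable_funX/measurable_funB; last exact: left_proc_meas.
  by apply: sup_process_meas => //; exact: gp.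
- exact: measurable_cst.
- apply: filterS (left_proc_cvg hx) => w /(_ s sT) h.
  have h' : left_proc x s w @[_ --> \oo] --> left_proc x s w by exact: cvg_cst.
  rewrite [X in _ --> X](_ : _ = (left_proc x s w - left_proc x s w) ^+ 2); last first.
    by rewrite subrr expr0n.
  by apply: cvg_sqr; exact: cvgB.
- by apply: L1Z; exact: L1D.
- apply: filterS2 hW (left_proc_le cx hW) => w h1 h2 n; rewrite ger0_norm ?sqr_ge0//.
  apply: (le_trans (sqB _ _)); rewrite ler_pM2l//.
  by apply: lerD; [apply: h1; exact: gp|exact: h2].
Qed.

(** * The integrand of the equation *)

Section integrands.
Context (m : nat) (ha : markov_chain T m a).
Context (sigma : R -> R -> probability R R -> R) (r : R -> R).
Context (hlip : lipschitz_on_P2 T sigma).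
Context (hcag : forall (u : R) nu, in_P2 nu -> caglad_on T (fun t => sigma t u nu)).

Definition integrand (x : R -> Omega -> R) (nu : R -> probability R R) t w : R :=
  sigma t (left_lim (x ^~ w) t) (nu t) * r (left_lim (fun s => a s w) t)%:R.

Definition left_laws (x : R -> Omega -> R) (nu : R -> probability R R) :=
  forall t, 0 < t <= T -> has_law P (fun w => left_lim (x ^~ w) t) (nu t).

(* The integrand without left limits: sampled at grid points increasing to [t] it
   converges to [integrand x nu t]. *)
Let pre x t w : R := sigma t (x t w) (lawof P (x t)) * r (a t w)%:R.

(** A sum of squares over the states bounds each of them, in place of a maximum. *)
Let rb : R := \sum_(k < m.+1) r k%:R ^+ 2.

Let rb_ge0 : 0 <= rb. Proof. by apply: sumr_ge0 => i _; exact: sqr_ge0. Qed.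

Let r_le k : (k <= m)%N -> r k%:R ^+ 2 <= rb.
Proof.
move=> km; have km' : (k < m.+1)%N by [].
rewrite /rb (bigD1 (Ordinal km'))//= lerDl.
by apply: sumr_ge0 => i _; exact: sqr_ge0.
Qed.

Let chain_left : {ae P, forall w, forall s, 0 < s <= T ->
  (\forall n \near \oo, a (grid_pt T n s) w = left_lim (fun s => a s w) s) /\
  (left_lim (fun s => a s w) s <= m)%N}.
Proof.
apply: filterS (chain_cadlag ha) => w [_ cl] s sT.
have h : a (grid_pt T n s) w @[n --> \oo] --> left_lim (fun s => a s w) s.
  by apply: (comp_grid sT (f := fun s => a s w)); exact: cl.
(* [nat] is discrete, so convergence is eventual equality, and the left limit is a state that the
   chain visits. *)
have near_eq : \forall n \near \oo, a (grid_pt T n s) w = left_lim (fun s => a s w) s.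
  exact: (h _ (discrete_set1 _)).
split => //; have [n _ hn] := near_eq.
rewrite -(hn n (leqnn n)).
by have /andP[] := chain_state ha w (gp n sT).
Qed.

Lemma sigma_lip : exists2 K : R, 0 <= K &
  forall t X Y mu nu (u v : R), 0 <= t <= T -> L2 P X -> L2 P Y ->
    has_law P X mu -> has_law P Y nu ->
    (sigma t u mu - sigma t v nu) ^+ 2 <=
    K * ((u - v) ^+ 2 + Ex P (fun w => (X w - Y w) ^+ 2)).
Proof. exact: lipschitz_law. Qed.

Let growth_arith (A S b K u e : R) : 0 <= b -> 0 <= K -> 0 <= u -> 0 <= e ->
  A <= K * (u + e) -> S <= b -> 2 * (A + S) <= 2 * (b + K) * (1 + u + e).
Proof.
move=> b0 K0 u0 e0 h1 h2.
have bu := mulr_ge0 b0 u0; have be := mulr_ge0 b0 e0.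
by rewrite -[leRHS]mulrA ler_pM2l//; nra.
Qed.

(** Comparison with the constant variable 0, whose law is the Dirac mass at 0: the path of [sigma]
    at this point is bounded on [0, T], being left continuous with right limits. *)
Let sigma_growth : exists2 B : R, 0 <= B &
  forall t X mu (u : R), 0 <= t <= T -> L2 P X -> has_law P X mu ->
    sigma t u mu ^+ 2 <= B * (1 + u ^+ 2 + Ex P (fun w => X w ^+ 2)).
Proof.
have [K K0 hK] := sigma_lip.
have i0 : L2 P (fun=> 0 : R) by exact: L2_cst.
have [B0 hB0] := caglad_on_bounded
  (hcag 0 (has_law_P2 i0 (has_law_dirac0 P))).
have B00 : 0 <= B0 by apply: (le_trans (normr_ge0 _)); apply: (hB0 0); rewrite lexx ltW.
exists (2 * (B0 ^+ 2 + K)); first by rewrite mulr_ge0// addr_ge0// sqr_ge0.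
move=> t X mu u tT iX hX.
have := hK t X (fun=> 0) mu _ u 0 tT iX i0 hX (has_law_dirac0 P).
under [in X in X -> _]eq_fun do rewrite subr0.
rewrite subr0; set e := Ex P _ => h.
have e0 : 0 <= e by apply: Ex_ge0 => w; exact: sqr_ge0.
have hb : sigma t 0 \d_(0 : R) ^+ 2 <= B0 ^+ 2.
  by rewrite -real_normK ?num_real// lerXn2r ?nnegrE//; exact: hB0.
have := sqB (sigma t u mu - sigma t 0 \d_(0 : R)) (- sigma t 0 \d_(0 : R)).
rewrite opprK subrK sqrrN => h2; apply: (le_trans h2).
by apply: growth_arith; rewrite ?sqr_ge0.
Qed.

(** A single integrable variable dominates all times at once, as dominated convergence along the
    grid requires. *)
Let pre_le x (W : Omega -> R) : sup_process x -> L1 P W ->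
  {ae P, forall w, forall t, 0 <= t <= T -> x t w ^+ 2 <= W w} ->
  exists2 D : Omega -> R, L1 P D &
    {ae P, forall w, forall t, 0 <= t <= T -> pre x t w ^+ 2 <= D w}.
Proof.
move=> hx iW hW; have [B B0 hB] := sigma_growth.
exists (fun w => rb * (B * (1 + W w + Ex P W))).
  by do 2 apply: L1Z; apply: L1D; [apply: L1D => //|]; exact: L1_cst.
have hW0 := hW; apply: filterS hW => w hw t tT.
have ix := sup_process_L2 hx tT.
have mx : measurable_fun setT (x t) by case: ix.
rewrite /pre exprMn mulrC; apply: ler_pM; rewrite ?sqr_ge0//.
  by apply: r_le; have /andP[] := chain_state ha w tT.
apply: (le_trans (hB t _ _ (x t w) tT ix (lawofP P mx))).
rewrite ler_wpM2l//; apply: lerD; first by rewrite lerD2l hw.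
apply: Ex_ae_le => //; first exact: L2_sq.
by apply: filterS hW0 => w' /(_ t tT).
Qed.

Let pre_gmeas x t : sup_process x -> 0 <= t <= T -> gmeas (G t) (pre x t).
Proof.
move=> hx tT; have [ax _ _] := hx; have ix := sup_process_L2 hx tT.
have [K K0 hK] := sigma_lip.
have mx : measurable_fun setT (x t) by case: ix.
apply: gmeasM.
  apply: (gmeas_comp (f := fun u => sigma t u (lawof P (x t)))); last exact: ax.
  apply: continuous_measurable_fun => u; apply/cvgrPdist_lt => e e0.
  (* K may vanish; K + 1 can be divided by, and its square exceeds K. *)
  have K1 : 0 < K + 1 by rewrite ltr_wpDl.
  near=> v.
  (* With the same variable on both sides the expectation in the Lipschitz bound vanishes, which
     leaves continuity in the space variable. *)
  have := hK t (x t) (x t) _ _ u v tT ix ix (lawofP P mx) (lawofP P mx).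
  under [in X in X -> _]eq_fun do rewrite subrr expr0n.
  rewrite Ex_cst addr0 => h.
  have huv : `|u - v| < e / (K + 1).
    by near: v; apply/nbhs_ballP; exists (e / (K + 1)); rewrite /= ?divr_gt0.
  rewrite ltr_pdivlMr// in huv.
  rewrite -(@ltr_pXn2r _ 2%N)// ?nnegrE ?(ltW e0)// real_normK ?num_real//.
  apply: (le_lt_trans h); rewrite -(real_normK (num_real (u - v))).
  have n0 : 0 <= `|u - v| by [].
  have := ler_pM (mulr_ge0 n0 (ltW K1)) (mulr_ge0 n0 (ltW K1)) (ltW huv) (ltW huv).
  rewrite !expr2; move: (mulr_gt0 e0 e0) (mulr_ge0 n0 n0) => h1 h2 h3.
  have [n00|n00] := eqVneq `|u - v| 0; first by rewrite n00 !mul0r mulr0.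
  have n1 : 0 < `|u - v| * `|u - v| by rewrite mulr_gt0// lt_def n00.
  nra.
move=> A mA; rewrite (_ : _ @^-1` A = a t @^-1` [set k | A (r k%:R)])//.
by apply: filtration_a; case/andP : tT => -> _; rewrite lexx.
Unshelve. all: by end_near. Qed.

(** The state and its law are first replaced by their left limits at the sampling time, at a cost
    that vanishes because the Lipschitz constant does not depend on time. The remaining time
    dependence, with state and law frozen, is handled by left continuity of [sigma]. *)
Let pre_cvg x nu : sup_process x -> left_laws x nu ->
  {ae P, forall w, forall s, 0 < s <= T ->
    pre x (grid_pt T n s) w @[n --> \oo] --> integrand x nu s w}.
Proof.
move=> hx hnu; have [K K0 hK] := sigma_lip.
apply: filterS2 (left_proc_cvg hx) chain_left => w hxw haw s sT.
have [ha1 _] := haw s sT.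
have iL := left_proc_L2 hx sT.
set l := left_proc x s w.
have h1 : sigma (grid_pt T n s) l (nu s) @[n --> \oo] --> sigma s l (nu s).
  apply: (comp_grid sT (f := fun t => sigma t l (nu s))).
  by have [hc _] := hcag l (has_law_P2 iL (hnu s sT)); exact: hc.
pose b n := K * ((x (grid_pt T n s) w - l) ^+ 2 +
  Ex P (fun w' => (x (grid_pt T n s) w' - left_proc x s w') ^+ 2)).
have hb : Num.sqrt (b n) @[n --> \oo] --> (0 : R).
  have b0 : b n @[n --> \oo] --> (0 : R).
    have -> : (0 : R) = K * ((l - l) ^+ 2 + 0) by rewrite subrr expr0n addr0 mulr0.
    apply: cvgM; first exact: cvg_cst.
    apply: cvgD; last exact: Ex_left_cvg.
    by apply: cvg_sqr; apply: cvgB; [exact: hxw|exact: cvg_cst].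
  rewrite -[X in _ --> X](@sqrtr0 R).
  exact: (cvg_comp _ _ b0 (@sqrt_continuous R 0)).
have h2 : sigma (grid_pt T n s) (x (grid_pt T n s) w) (lawof P (x (grid_pt T n s)))
    - sigma (grid_pt T n s) l (nu s) @[n --> \oo] --> (0 : R).
  apply: (@squeeze_cvgr _ _ _ _ (fun n => - Num.sqrt (b n)) (fun n => Num.sqrt (b n))).
  - apply: nearW => n; rewrite -ler_norml -sqrtr_sqr ler_sqrt.
      have ix := sup_process_L2 hx (gp n sT).
      have mx : measurable_fun setT (x (grid_pt T n s)) by case: ix.
      by apply: hK => //; [exact: gp|exact: lawofP|exact: hnu].
    rewrite /b mulr_ge0// addr_ge0 ?sqr_ge0//.
    by apply: Ex_ge0 => w'; exact: sqr_ge0.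
  - by rewrite -oppr0; exact: cvgN.
  - exact: hb.
have h3 : sigma (grid_pt T n s) (x (grid_pt T n s) w) (lawof P (x (grid_pt T n s)))
    @[n --> \oo] --> sigma s l (nu s).
  rewrite -[X in _ --> X]add0r; apply: cvg_trans (cvgD h2 h1).
  by apply: near_eq_cvg; apply: nearW => n /=; rewrite subrK.
have h4 : r (a (grid_pt T n s) w)%:R @[n --> \oo] --> r (left_lim (fun s => a s w) s)%:R.
  apply: (cvg_trans _ (@cvg_cst _ (r (left_lim (fun s => a s w) s)%:R) nat \oo _)).
  by apply: near_eq_cvg; apply: filterS ha1 => n ->.
exact: cvgM h3 h4.
Qed.

Let pre_L2 x t : sup_process x -> 0 <= t <= T -> L2 P (pre x t).
Proof.
move=> hx tT; have [_ _ [W [iW W0 hW]]] := hx.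
have [D iD hD] := pre_le hx iW hW.
have mp : measurable_fun setT (pre x t).
  exact: gmeas_measurable (@Gm t) (pre_gmeas hx tT).
apply: L2P => //; apply: (L1_ae_le _ iD); first exact: measurable_funX.
by apply: filterS hD => w hw; rewrite ger0_norm ?sqr_ge0// hw.
Qed.

Let F := data_filtration x0 z a.

Lemma sp_val_jmeas (phi : simple_process P T F) : jmeas (sp_val phi).
Proof.
apply: measurable_sum => i; apply: measurable_funM.
  apply: (measurableT_comp _ (@measurable_fst _ _ _ _)).
  exact: gmeas_measurable (@Gm (sp_time phi i)) (sp_adapted (ltn_ord i)).
have -> : (fun p : Omega * R => (sp_time phi i < p.2 <= sp_time phi i.+1)%R%:R) =
    (\1_(`](sp_time phi i), (sp_time phi i.+1)]%classic) : R -> R) \o snd.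
  by apply/funext => p; rewrite /= indicE mem_setE in_itv.
by apply: measurableT_comp; [exact: measurable_indic|exact: measurable_snd].
Qed.

Lemma sp_val_regular (phi : simple_process P T F) : regular P T (sp_val phi).
Proof. by exists (sp_val phi); [exact: sp_val_jmeas|exact: aeW]. Qed.

(** Sampling [pre x] at the left ends of the dyadic intervals gives step processes that are adapted
    and jointly measurable. Their pointwise limit is therefore regular, and the common majorant [D]
    turns pointwise convergence into convergence of the norms. *)
Lemma integrand_approx x nu : sup_process x -> left_laws x nu ->
  regular P T (integrand x nu) /\
  forall eps, 0 < eps -> exists phi : simple_process P T F,
    (sqnorm P (fun s w => (sp_val phi s w - integrand x nu s w)%R) T <= eps%:E)%E.
Proof.
move=> hx hnu; have [_ cx [W [iW W0 hW]]] := hx.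
have [D iD hD] := pre_le hx iW hW.
have [N [mN PN hN]] := filterI (pre_cvg hx hnu) hD.
have good w : ~ N w ->
    (forall s, 0 < s <= T -> pre x (grid_pt T n s) w @[n --> \oo] --> integrand x nu s w) /\
    (forall t, 0 <= t <= T -> pre x t w ^+ 2 <= D w).
  by move=> Nw; apply: contrapT => h; apply: Nw; apply: hN.
(* The factors [i] and [j] remove the exceptional samples and the times outside ]0, T], so that
   convergence and domination hold at every point of the product. *)
pose i w : R := \1_(~` N) w.
pose j (s : R) : R := (0 < s <= T)%R%:R.
have ij1 w s : ~ N w -> 0 < s <= T -> i w * j s = 1.
  by move=> Nw sT; rewrite /i /j sT indicE mem_set// mulr1.
have ij0 w s : ~ (~ N w /\ 0 < s <= T) -> i w * j s = 0.
  rewrite /i /j indicE => h; case: (boolP (0 < s <= T)) => [sT|_]; last by rewrite mulr0.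
  rewrite memNset ?mul0r// => Nw; exact: h.
pose h n s w := pre x (grid_pt T n s) w * (i w * j s).
pose hh s w := integrand x nu s w * (i w * j s).
have time n : [/\ 0 <= dyadic T n 0,
    forall k, (k < 2 ^ n)%N -> dyadic T n k <= dyadic T n k.+1 &
    dyadic T n (2 ^ n) <= T].
  split; first by rewrite /dyadic mul0r.
    by move=> k _; rewrite /dyadic ler_wpM2r ?ler_nat// divr_ge0 ?(ltW T0)// exprn_ge0.
  by have /andP[] := dyadic_mem (T := T) (j := n) T0 (leqnn (2 ^ n)).
have dT n k : (k < 2 ^ n)%N -> 0 <= dyadic T n k <= T.
  by move=> /ltnW; exact: dyadic_mem.
pose phi n : simple_process P T F := @SimpleProcess _ _ _ P T F (2 ^ n) (dyadic T n)
  (fun k => pre x (dyadic T n k)) (let: And3 p _ _ := time n in p)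
  (let: And3 _ p _ := time n in p) (let: And3 _ _ p := time n in p)
  (fun k kn => pre_gmeas hx (dT n k kn)) (fun k kn => (pre_L2 hx (dT n k kn)).2).
have phiE n s w : 0 < s <= T -> sp_val (phi n) s w = pre x (grid_pt T n s) w.
  by move=> sT; rewrite -(grid_ptE T0 n (fun u => pre x u w) sT).
have hE n s w : h n s w = sp_val (phi n) s w * (i w * j s).
  rewrite /h; case: (boolP (0 < s <= T)) => sT; first by rewrite phiE.
  by rewrite /j (negbTE sT) !mulr0.
have mij : measurable_fun setT (fun p : Omega * R => i p.1 * j p.2).
  apply: measurable_funM.
    apply: (measurableT_comp _ (@measurable_fst _ _ _ _)).
    by apply: measurable_indic; exact: measurableC.
  have -> : (fun p : Omega * R => j p.2) = (\1_(`]0, T]%classic) : R -> R) \o snd.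
    by apply/funext => p; rewrite /= indicE mem_setE in_itv.
  by apply: measurableT_comp; [exact: measurable_indic|exact: measurable_snd].
have mh n : jmeas (h n).
  have -> : h n = fun s w => sp_val (phi n) s w * (i w * j s).
    by apply/funext => s; apply/funext => w; exact: hE.
  by apply: measurable_funM => //; exact: sp_val_jmeas.
have h_hh s w : h n s w @[n --> \oo] --> hh s w.
  have [[Nw sT]|b] := pselect (~ N w /\ 0 < s <= T).
    by apply: cvgM; [exact: (good w Nw).1|exact: cvg_cst].
  by rewrite /h /hh ij0//; under eq_cvg do rewrite mulr0; rewrite mulr0; exact: cvg_cst.
have mhh : jmeas hh.
  apply: (@measurable_fun_cvg _ _ _ _ (fun n (p : Omega * R) => h n p.2 p.1)) => //.
have aeN : {ae P, forall w, ~ N w} by exists N; split => // w /= /contrapT.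
have hhE : {ae P, forall w, forall s, 0 < s <= T -> integrand x nu s w = hh s w}.
  by apply: filterS aeN => w Nw s sT; rewrite /hh ij1// mulr1.
split; first by exists hh.
have hn2 n s w : h n s w ^+ 2 <= `|D w|.
  have [[Nw sT]|b] := pselect (~ N w /\ 0 < s <= T); last by rewrite /h ij0// mulr0 expr2 mul0r normr_ge0.
  rewrite /h ij1// mulr1; apply: le_trans (ler_norm _); apply: (good w Nw).2; exact: gp.
have hh2 s w : hh s w ^+ 2 <= `|D w|.
  have h2 := cvg_sqr (h_hh s w); rewrite -(cvg_lim _ h2)//.
  by apply: limr_le; [exact: cvgP h2|apply: nearW => n; exact: hn2].
have diff2 n s w : `|(h n s w - hh s w) ^+ 2| <= 2 * (`|D w| + `|D w|).
  rewrite ger0_norm ?sqr_ge0//; apply: (le_trans (sqB _ _)).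
  by rewrite ler_pM2l// lerD.
have iDD : L1 P (fun w => 2 * (`|D w| + `|D w|)).
  by apply: L1Z; apply: L1D; exact: (integrable_norm iD).
have msec n s : measurable_fun setT (fun w => (h n s w - hh s w) ^+ 2).
  apply: measurable_funX; apply: measurable_funB.
    exact: (@measurable_fun_pair1 _ _ _ Omega (measurableTypeR R) R (fun p => h n p.2 p.1) s (mh n)).
  exact: (@measurable_fun_pair1 _ _ _ Omega (measurableTypeR R) R (fun p => hh p.2 p.1) s mhh).
have iE n s : L1 P (fun w => (h n s w - hh s w) ^+ 2).
  apply: (L1_le (msec n s) iDD) => w; apply: (le_trans (diff2 n s w)); exact: ler_norm.
have En0 s : Ex P (fun w => (h n s w - hh s w) ^+ 2) @[n --> \oo] --> (0 : R).
  have <- : Ex P (fun=> 0 : R) = 0 by exact: Ex_cst.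
  apply: (Ex_dominated (X := fun=> 0) _ _ _ iDD _).2 => //.
    apply: aeW => w; have -> : (0 : R) = (hh s w - hh s w) ^+ 2 by rewrite subrr expr0n.
    by apply: cvg_sqr; apply: cvgB; [exact: h_hh|exact: cvg_cst].
  by apply: aeW => w n; exact: diff2.
pose c := Ex P (fun w => 2 * (`|D w| + `|D w|)).
(* Second use of dominated convergence, now in time: at each s the expectation tends to 0 by [En0],
   and it is bounded by the constant [c]. *)
have [_ _ hlim] : [/\ (@lebesgue_measure R).-integrable `]0, T] (cst 0%E : R -> \bar R),
   [sequence (\int[@lebesgue_measure R]_(s in `]0%R, T])
     `|(\int[P]_w ((h n s w - hh s w) ^+ 2)%:E) - cst 0 s|)%E]_n @ \oo --> 0%E &
   [sequence (\int[@lebesgue_measure R]_(s in `]0%R, T])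
     (\int[P]_w ((h n s w - hh s w) ^+ 2)%:E))%E]_n @ \oo -->
   (\int[@lebesgue_measure R]_(s in `]0%R, T]) cst 0 s)%E].
  apply: (@dominated_convergence _ _ _ _ _ _ _ _ (cst c%:E)) => //.
  - move=> n; apply: (@sqnorm_outer_meas _ _ _ P T (fun s w => h n s w - hh s w)).
    by apply: measurable_funB; [exact: mh|exact: mhh].
  - apply: aeW => s _.
    under eq_cvg do rewrite Ex_int//.
    by apply: cvg_EFin; [exact: nearW|exact: En0].
  - apply: measurable_bounded_integrable => //.
      by rewrite /= lebesgue_measure_itv/=; case: ifP; rewrite ltry.
    exact: bounded_cst.
  - apply: aeW => s n _; rewrite Ex_int// abse_EFin lee_fin ger0_norm.
      by apply: Ex_le => // w; apply: le_trans (ler_norm _) (diff2 n s w).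
    by apply: Ex_ge0 => w; exact: sqr_ge0.
rewrite integral0 in hlim.
move=> eps e0; move/fine_cvgP : hlim => [fin /cvgrPdist_lt/(_ eps e0) hn].
have [n _ /(_ n (leqnn n)) [hf hl]] := filterI fin hn.
exists (phi n).
have mg : jmeas (fun s w => h n s w - hh s w) by apply: measurable_funB; [exact: mh|exact: mhh].
rewrite (sqnorm_ae (lexx T) mg); last first.
  apply: filterS2 aeN hhE => w Nw hw s sT.
  by rewrite hw// phiE// /h ij1// mulr1.
rewrite sqnorm_swap//; move: hf hl => /= hf hl.
rewrite -(fineK hf) lee_fin ltW//; apply: le_lt_trans hl.
by rewrite sub0r normrN ler_norm.
Qed.

(** Both integrands carry the same chain factor, so their difference reduces to that of the values
    of [sigma]. The exponential weight bounds the left limits at s because it increases in time. *)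
Lemma integrand_lip : exists2 L : R, 0 <= L &
  forall x y nux nuy A b, sup_process x -> sup_process y ->
    left_laws x nux -> left_laws y nuy -> 0 <= A -> 0 < b ->
    (forall u, 0 <= u <= T -> Ex P (fun w => (x u w - y u w) ^+ 2) <= A * expR (b * u)) ->
    forall t, 0 <= t <= T ->
    (sqnorm P (fun s w => (integrand x nux s w - integrand y nuy s w)%R) t
      <= (L * A * (expR (b * t) / b))%:E)%E.
Proof.
have [K K0 hK] := sigma_lip.
(* The 2 arises because, in mean, the state term and the law term of the Lipschitz bound both equal
   [e]. *)
exists (2 * (rb * K)); first by rewrite !mulr_ge0.
move=> x y nux nuy A b hx hy hnx hny A0 b0 hA t /andP[t0 tT].
have [gx mgx hgx] := (integrand_approx hx hnx).1.
have [gy mgy hgy] := (integrand_approx hy hny).1.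
have mg : jmeas (fun s w => gx s w - gy s w) by exact: measurable_funB.
have gE : {ae P, forall w, forall s, 0 < s <= T ->
    integrand x nux s w - integrand y nuy s w = gx s w - gy s w}.
  by apply: filterS2 hgx hgy => w h1 h2 s sT; rewrite h1// h2.
rewrite (sqnorm_ae tT mg gE) sqnorm_swap//.
apply: (@le_trans _ _ (\int[lebesgue_measure]_(s in `]0%R, t])
    ((2 * (rb * K) * A)%:E * (expR (b * s))%:E))%E); last first.
  rewrite ge0_integralZl//; last 2 first.
  - apply: (@measurable_funTS _ _ (measurableTypeR R)).
    apply/measurable_EFinP; apply: continuous_measurable_fun => s.
    by apply: continuous_comp; [exact: mulrl_continuous|exact: continuous_expR].
  - by rewrite lee_fin !mulr_ge0.
  rewrite [leRHS]EFinM lee_wpmul2l ?lee_fin ?mulr_ge0//.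
  exact: integral_expR_le.
apply: ge0_mono_integral => s.
  by move=> _; apply: integral_ge0 => w _; rewrite lee_fin sqr_ge0.
rewrite /= in_itv/= => /andP[s0 st].
have sT : 0 < s <= T by rewrite s0 (le_trans st).
have sT' : 0 <= s <= T by rewrite (ltW s0) (le_trans st).
have ix := left_proc_L2 hx sT; have iy := left_proc_L2 hy sT.
pose e := Ex P (fun w => (left_proc x s w - left_proc y s w) ^+ 2).
have e_le : e <= A * expR (b * s).
  have h := Ex_left_diff hx hy sT; rewrite /e -(cvg_lim _ h)//.
  apply: limr_le; first exact: cvgP h.
  apply: nearW => n; apply: (le_trans (hA _ (gp n sT))).
  rewrite ler_wpM2l// ler_expR ler_pM2l//.
  by have [_ _ /ltW] := grid_pt_itv T0 n sT.
have iD : L1 P (fun w => (left_proc x s w - left_proc y s w) ^+ 2).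
  exact/L2_sq/L2B.
pose B w := rb * (K * ((left_proc x s w - left_proc y s w) ^+ 2 + e)).
have iB : L1 P B by do 2 apply: L1Z; apply: L1D => //; exact: L1_cst.
have e0 : 0 <= e by apply: Ex_ge0 => w; exact: sqr_ge0.
apply: (@le_trans _ _ (\int[P]_w (B w)%:E)%E).
  apply: ae_ge0_mono_integral.
  - by move=> w; rewrite lee_fin sqr_ge0.
  - by move=> w; rewrite lee_fin !mulr_ge0// addr_ge0 ?sqr_ge0.
  - by apply/measurable_EFinP; exact: L1_meas iB.
  - apply: filterS2 gE chain_left => w gw /(_ s sT)[_ hm]; rewrite lee_fin -gw//.
    rewrite /integrand -mulrBl exprMn mulrC.
    apply: ler_pM; rewrite ?sqr_ge0//; first exact: r_le.
    by apply: (hK s (left_proc x s) (left_proc y s)) => //; [exact: hnx|exact: hny].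
rewrite Ex_int// -EFinM lee_fin /B ExZ; last first.
  by apply: L1Z; apply: L1D => //; exact: L1_cst.
rewrite ExZ; last by apply: L1D => //; exact: L1_cst.
rewrite ExD//; last exact: L1_cst.
rewrite Ex_cst -/e.
have -> : rb * (K * (e + e)) = 2 * (rb * K) * e by ring.
by rewrite -[leRHS]mulrA ler_wpM2l// !mulr_ge0.
Qed.

End integrands.
End processes.

(** * The Ito integral *)

Section simple_integrals.
Context (R : realType) (d : measure_display) (Omega : measurableType d).
Context (P : probability Omega R) (Pc : measure_is_complete P).
Context (T : R) (T0 : 0 < T).
Context (x0 : {RV P >-> R}) (z : R -> {RV P >-> R}) (a : R -> {RV P >-> nat}).
Context (hx0 : sq_integrable P x0).
Context (hz : levy_process T z) (hind : independent_data T x0 z a).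
Context (hz2 : forall t, 0 <= t <= T -> sq_integrable P (z t)).

Let F := data_filtration x0 z a.
Let G := data_events x0 z a.

Implicit Types phi psi : simple_process P T F.

Lemma sp_time_mono phi i j : (i <= j <= sp_size phi)%N ->
  sp_time phi i <= sp_time phi j.
Proof.
move=> /andP[]; elim: j => [|j IH]; first by rewrite leqn0 => /eqP ->.
rewrite leq_eqVlt => /predU1P[->//|ij] js.
by apply: le_trans (IH ij (ltnW js)) _; exact: sp_timeS.
Qed.

Lemma sp_time_ge0 phi i : (i <= sp_size phi)%N -> 0 <= sp_time phi i.
Proof. by move=> h; apply: le_trans (sp_time0 phi) _; exact: sp_time_mono. Qed.

Lemma sp_time_leT phi i : (i <= sp_size phi)%N -> sp_time phi i <= T.
Proof.
by move=> h; apply: le_trans (sp_timeT phi); apply: sp_time_mono; rewrite h leqnn.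
Qed.

Lemma sp_coef_L2 phi i : (i < sp_size phi)%N -> L2 P (sp_coef phi i).
Proof.
move=> h; split; last exact: sp_sq_integrable.
by apply: gmeas_measurable (sp_adapted h); exact: data_events_measurable.
Qed.

Lemma sp_integral0 phi w : sp_integral phi z 0 w = 0.
Proof.
rewrite /sp_integral big1// => i _.
by rewrite !min_l ?subrr ?mulr0//; apply: sp_time_ge0; rewrite // ltnW.
Qed.

Lemma sqnorm_step_sum (I : finType) (lo hi : I -> R) (xi : I -> Omega -> R) t :
  (forall i, 0 <= lo i) -> (forall i, L2 P (xi i)) ->
  sqnorm P (fun s w => step_sum lo hi (xi ^~ w) s) t =
  (Ex P (fun w => step_quad lo hi (xi ^~ w) t))%:E.
Proof.
move=> lo0 ixi; rewrite /sqnorm.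
under eq_integral do rewrite integral_step_quad//.
by rewrite Ex_int//; exact: mart_quad_L1.
Qed.

(* The two processes have different grids: the difference is a step process on the
   disjoint union of their intervals, which may overlap. *)
Lemma sp_integral_diff phi psi :
  (forall t, 0 <= t <= T ->
    L2 P (fun w => sp_integral phi z t w - sp_integral psi z t w) /\
    ((Ex P (fun w => (sp_integral phi z t w - sp_integral psi z t w) ^+ 2))%:E
      <= (levy_const T z)%:E *
         sqnorm P (fun s w => (sp_val phi s w - sp_val psi s w)%R) t)%E) /\
  exists W : Omega -> R, [/\ L1 P W, forall w, 0 <= W w,
    ((Ex P W)%:E <= (levy_const T z)%:E *
         sqnorm P (fun s w => (sp_val phi s w - sp_val psi s w)%R) T)%E &
    {ae P, forall w, forall t, 0 <= t <= T ->
      (sp_integral phi z t w - sp_integral psi z t w) ^+ 2 <= W w}].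
Proof.
pose I : finType := ('I_(sp_size phi) + 'I_(sp_size psi))%type.
pose lo (i : I) := match i with inl j => sp_time phi j | inr j => sp_time psi j end.
pose hi (i : I) := match i with
  inl j => sp_time phi j.+1 | inr j => sp_time psi j.+1 end.
pose xi (i : I) w := match i with
  inl j => sp_coef phi j w | inr j => - sp_coef psi j w end.
have lo0 i : 0 <= lo i by case: i => j; apply: sp_time_ge0; rewrite ltnW.
have lohi i : lo i <= hi i by case: i => j; exact: sp_timeS.
have hiT i : hi i <= T by case: i => j; exact: sp_time_leT.
have ixi i : L2 P (xi i) by case: i => j; [|apply: L2N]; exact: sp_coef_L2.
have mxi i : gmeas (G (lo i)) (xi i).
  case: i => j; first exact (sp_adapted (ltn_ord j)).
  apply: (gmeas_comp (f := fun u => - u)); last exact (sp_adapted (ltn_ord j)).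
  by apply: continuous_measurable_fun; exact: opp_continuous.
have sumE t w : sp_integral phi z t w - sp_integral psi z t w =
    levy_sum z lo hi xi t w.
  rewrite /levy_sum big_sumType/= -sumrN; congr (_ + _).
  by apply: eq_bigr => j _; rewrite mulNr.
have valE : (fun s w => sp_val phi s w - sp_val psi s w) =
    fun s w => step_sum lo hi (xi ^~ w) s.
  apply/funext => s; apply/funext => w.
  rewrite /step_sum big_sumType/= -sumrN; congr (_ + _).
  by apply: eq_bigr => j _; rewrite mulNr.
rewrite valE; split.
  move=> t /andP[t0 tT]; under eq_fun do rewrite sumE.
  split; first exact: (levy_sum_L2 Pc T0 hz hind hz2).
  rewrite sqnorm_step_sum// -EFinM lee_fin.
  under [X in Ex _ X <= _]eq_fun do rewrite sumE.
  exact: (levy_sum_sq Pc T0 hz hind hz2).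
have [W [iW W0 eW hW]] := levy_sum_sup Pc T0 hz hind hz2 lo0 lohi hiT mxi ixi.
exists W; split => //; first by rewrite sqnorm_step_sum// -EFinM lee_fin.
by apply: filterS hW => w hw t tT; rewrite sumE; exact: hw.
Qed.

Lemma sup_process_cst : sup_process T x0 z a (fun=> x0).
Proof.
split.
- by move=> t /andP[t0 _]; exact (@filtration_x0 _ _ _ _ x0 z a t).
- by apply: aeW => w; exact: cadlag_on_cst.
- exists (fun w => x0 w ^+ 2); split; first exact: L2_sq.
    by move=> w; exact: sqr_ge0.
  exact: aeW.
Qed.

Lemma sup_process_integral phi :
  sup_process T x0 z a (fun t w => x0 w + sp_integral phi z t w).
Proof.
have lo0 (i : 'I_(sp_size phi)) : 0 <= sp_time phi i.
  by apply: sp_time_ge0; rewrite ltnW.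
have lohi (i : 'I_(sp_size phi)) : sp_time phi i <= sp_time phi i.+1.
  exact: sp_timeS.
have hiT (i : 'I_(sp_size phi)) : sp_time phi i.+1 <= T by exact: sp_time_leT.
have ixi (i : 'I_(sp_size phi)) : L2 P (sp_coef phi i) by exact: sp_coef_L2.
have mxi (i : 'I_(sp_size phi)) : gmeas (G (sp_time phi i)) (sp_coef phi i).
  exact (sp_adapted (ltn_ord i)).
split.
- move=> t /andP[t0 tT]; apply: gmeasD; first exact (@filtration_x0 _ _ _ _ x0 z a t).
  exact: (levy_sum_adapted lo0 lohi mxi).
- apply: filterS (levy_cadlag hz) => w hw; apply: cadlag_onD.
    exact: cadlag_on_cst.
  exact: (@levy_sum_cadlag _ _ _ _ T z 'I_(sp_size phi) (fun i => sp_time phi i)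
    (fun i => sp_time phi i.+1) (fun i => sp_coef phi i) w hw).
- have [W [iW W0 _ hW]] := levy_sum_sup Pc T0 hz hind hz2 lo0 lohi hiT mxi ixi.
  exists (fun w => 2 * (x0 w ^+ 2 + W w)); split.
  + by apply: L1Z; apply: L1D => //; exact: L2_sq.
  + by move=> w; rewrite mulr_ge0// addr_ge0 ?sqr_ge0.
  + apply: filterS hW => w hw t tT; have := hw t tT.
    set u := levy_sum _ _ _ _ _ _ => h; rewrite -[sp_integral _ _ _ _]/u.
    by have := sqr_ge0 (x0 w - u); rewrite !expr2 in h *; nra.
Qed.

End simple_integrals.

Lemma ae_eq0_Ex (d : measure_display) (Omega : measurableType d) (R : realType)
    (P : probability Omega R) (X : Omega -> R) :
  L1 P X -> (forall w, 0 <= X w) -> Ex P X <= 0 -> {ae P, forall w, X w = 0}.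
Proof.
move=> iX X0 h; have mX : measurable_fun setT (EFin \o X).
  by apply/measurable_EFinP; exact: L1_meas iX.
have h0 : (\int[P]_(w in setT) `|(EFin \o X) w| = 0)%E.
  under eq_integral do rewrite /= ger0_norm//.
  by rewrite Ex_int//; congr _%:E; apply/eqP; rewrite eq_le h Ex_ge0.
have /ae_eq_integral_abs := h0; move=> /(_ measurableT mX).
by apply: filterS => w /(_ I)/= [->].
Qed.

Lemma near_le_ereal (R : realType) (u : nat -> \bar R) (e : R) : 0 < e ->
  (u n @[n --> \oo] --> 0)%E -> \forall n \near \oo, (u n <= e%:E)%E.
Proof.
move=> e0 /fine_cvgP[fin /cvgrPdist_lt/(_ e e0) h].
apply: filterS2 fin h => n hf hl; rewrite -(fineK hf) lee_fin ltW//.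
by apply: le_lt_trans hl; rewrite sub0r normrN ler_norm.
Qed.

(** * Comparison of Ito integrals *)

Section integral_differences.
Context (R : realType) (d : measure_display) (Omega : measurableType d).
Context (P : probability Omega R) (Pc : measure_is_complete P).
Context (T : R) (T0 : 0 < T).
Context (x0 : {RV P >-> R}) (z : R -> {RV P >-> R}) (a : R -> {RV P >-> nat}).
Context (hx0 : sq_integrable P x0).
Context (hz : levy_process T z) (hind : independent_data T x0 z a).
Context (hz2 : forall t, 0 <= t <= T -> sq_integrable P (z t)).

Let F := data_filtration x0 z a.
Let C := levy_const T z.

Let C0 : 0 <= C. Proof. exact: levy_const_ge0. Qed.

Lemma sp_integral_L2 (phi : simple_process P T F) t : 0 <= t <= T ->
  L2 P (sp_integral phi z t).
Proof.
move=> tT; have h := sup_process_integral Pc T0 hx0 hz hind hz2 phi.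
have -> : sp_integral phi z t = fun w => (x0 w + sp_integral phi z t w) - x0 w.
  by apply/funext => w; rewrite addrC addKr.
by apply: L2B; [exact: sup_process_L2 h tT|].
Qed.

Lemma sqnormBC (f g : R -> Omega -> R) t :
  sqnorm P (fun s w => f s w - g s w) t = sqnorm P (fun s w => g s w - f s w) t.
Proof.
rewrite /sqnorm; apply: eq_integral => w _; apply: eq_integral => s _.
by rewrite -sqrrN opprB.
Qed.

Let sq3 (p q s : R) : (p + q + s) ^+ 2 <= 3 * (p ^+ 2 + q ^+ 2 + s ^+ 2).
Proof.
have := sqr_ge0 (p - q); have := sqr_ge0 (q - s); have := sqr_ge0 (p - s).
by rewrite !expr2; nra.
Qed.

(** The two approximating sequences are arbitrary, so integrals and integrands are both compared
    through step processes. Each comparison splits a square into three terms, whence 9 = 3 * 3. *)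
Lemma stochastic_integral_diff (H1 H2 Y1 Y2 : R -> Omega -> R) t (Q : R) :
  regular P T H1 -> regular P T H2 -> 0 <= t <= T ->
  L2 P (Y1 t) -> L2 P (Y2 t) ->
  stochastic_integral P T F H1 z Y1 -> stochastic_integral P T F H2 z Y2 ->
  (sqnorm P (fun s w => (H1 s w - H2 s w)%R) t <= Q%:E)%E ->
  Ex P (fun w => (Y1 t w - Y2 t w) ^+ 2) <= 9 * C * Q.
Proof.
move=> r1 r2 tT i1 i2 [phi [phiH phiY]] [psi [psiH psiY]] hQ.
have tT' : t <= T by case/andP : tT.
apply/ler_addgt0Pr => e e0.
(* Chosen so that 3 (eps + 3 C (eps + Q + eps) + eps) = 9 C Q + e. *)
pose eps := e / (6 + 18 * C).
have c0 : 0 < 6 + 18 * C by rewrite ltr_pwDl// mulr_ge0.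
have eps0 : 0 < eps by rewrite divr_gt0.
have near1 := near_le_ereal eps0 phiH; have near2 := near_le_ereal eps0 psiH.
have near3 := near_le_ereal eps0 (phiY t tT).
have near4 := near_le_ereal eps0 (psiY t tT).
have [n _ /(_ n (leqnn n)) [[h1 h2] [h3 h4]]] :=
  filterI (filterI near1 near2) (filterI near3 near4).
have rphi := sp_val_regular Pc (phi n); have rpsi := sp_val_regular Pc (psi n).
rewrite sqnorm_closed in h1; last exact: regularB.
rewrite sqnorm_closed in h2; last exact: regularB.
have j1 := sp_integral_L2 (phi n) tT; have j2 := sp_integral_L2 (psi n) tT.
have k1 := L2B j1 i1; have k2 := L2B j2 i2; have k3 := L2B j1 j2.
rewrite Ex_int ?lee_fin in h3; last exact: L2_sq.
rewrite Ex_int ?lee_fin in h4; last exact: L2_sq.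
have [/(_ t tT)[_ hD] _] := sp_integral_diff Pc T0 hz hind hz2 (phi n) (psi n).
have hS : (sqnorm P (fun s w => (sp_val (phi n) s w - sp_val (psi n) s w)%R) t
    <= (3 * (eps + Q + eps))%:E)%E.
  have h1' := le_trans (sqnorm_mono_time P (fun s w => sp_val (phi n) s w - H1 s w) tT') h1.
  have := le_trans (sqnorm_mono_time P (fun s w => sp_val (psi n) s w - H2 s w) tT') h2.
  rewrite sqnormBC => h2'.
  apply: (le_trans (sqnorm_sum3 tT' (regularB rphi r1) (regularB r1 r2)
    (regularB r2 rpsi) _)).
    by apply: aeW => w s _; ring.
  rewrite EFinM lee_wpmul2l ?lee_fin// !EFinD.
  by apply: leeD => //; exact: leeD.
have {}hD : Ex P (fun w => (sp_integral (phi n) z t w - sp_integral (psi n) z t w) ^+ 2)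
    <= C * (3 * (eps + Q + eps)).
  rewrite -lee_fin; apply: (le_trans hD); rewrite EFinM lee_wpmul2l ?lee_fin//.
have h0 : Ex P (fun w => (Y1 t w - Y2 t w) ^+ 2) <=
    Ex P (fun w => 3 * ((sp_integral (phi n) z t w - Y1 t w) ^+ 2 +
      (sp_integral (phi n) z t w - sp_integral (psi n) z t w) ^+ 2 +
      (sp_integral (psi n) z t w - Y2 t w) ^+ 2)).
  apply: Ex_le => [||w].
  - by apply: L2_sq; exact: L2B.
  - by apply: L1Z; apply: L1D; [apply: L1D|]; exact: L2_sq.
  - have := sq3 (Y1 t w - sp_integral (phi n) z t w)
      (sp_integral (phi n) z t w - sp_integral (psi n) z t w)
      (sp_integral (psi n) z t w - Y2 t w).
    rewrite -[(Y1 t w - _) ^+ 2]sqrrN opprB; apply: le_trans.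
    by rewrite (_ : _ + _ + _ = Y1 t w - Y2 t w)//; ring.
apply: (le_trans h0); rewrite ExZ; last first.
  by apply: L1D; [apply: L1D|]; exact: L2_sq.
rewrite ExD; [|by apply: L1D; exact: L2_sq|exact: L2_sq].
rewrite ExD; [|exact: L2_sq|exact: L2_sq].
have -> : 9 * C * Q + e = 3 * (eps + C * (3 * (eps + Q + eps)) + eps).
  by rewrite /eps; field; rewrite gt_eqF.
by rewrite ler_pM2l//; apply: lerD => //; exact: lerD.
Qed.

(** Brings an arbitrary solution into the class where the estimates hold. The supremum over all
    times may fail to be measurable; the one over the dyadic times, enumerated through [unpickle],
    is measurable and no larger. *)
Lemma strong_solution_sup_process sigma r x :
  strong_solution T sigma r x0 z a x -> sup_sq_integrable P T x ->
  sup_process T x0 z a x.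
Proof.
move=> hx hs; split; [exact (sol_adapted hx)|exact: sol_cadlag hx|].
have ax t : 0 <= t <= T -> measurable_fun setT (x t).
  move=> tT; apply: (gmeas_measurable (@data_events_measurable _ _ _ _ Pc x0 z a t)).
  exact (sol_adapted hx tT).
(* By right continuity it suffices to dominate at the dyadic times. *)
pose u p := match unpickle p : option (nat * nat) with
  | Some (j, k) => if (k <= 2 ^ j)%N then dyadic T j k else 0 | None => 0 end.
have uT p : 0 <= u p <= T.
  rewrite /u; case: unpickle => [[j k]|]; last by rewrite lexx ltW.
  by case: ifPn => [kj|_]; [exact: dyadic_mem|rewrite lexx ltW].
pose W w : \bar R := esups (fun p => (x (u p) w ^+ 2)%:E) 0%N.
have mW : measurable_fun setT W.
  apply: measurable_fun_esups => p; apply/measurable_EFinP.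
  by apply: measurable_funX; exact: ax.
have leW p w : ((x (u p) w ^+ 2)%:E <= W w)%E.
  by apply: ereal_sup_ubound; exists p.
have W0 w : (0 <= W w)%E by apply: le_trans (leW 0%N w); rewrite lee_fin sqr_ge0.
have hW : (\int[P]_w W w < +oo)%E.
  apply: le_lt_trans hs; apply: ge0_mono_integral => // w _.
  by apply: le_ereal_sup => _ [p _ <-]; exists (u p) => //=; rewrite in_itv/= uT.
have fW : (\int[P]_w W w)%E \is a fin_num.
  by rewrite ge0_fin_numE// integral_ge0.
have [V [iV V0 _ hV]] : exists V : Omega -> R, [/\ L1 P V, forall w, 0 <= V w,
    Ex P V <= fine (\int[P]_w W w)%E & {ae P, forall w, W w = (V w)%:E}].
  by apply: finite_dominating => //; rewrite fineK.
exists V; split => //.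
apply: filterS2 hV (sol_cadlag hx) => w hw [cr _] t tT.
rewrite -lee_fin -hw.
apply: (right_continuous_le T0 (f := fun t => x t w ^+ 2)) tT => [s sT|j k kj].
  by have h := cr s sT; rewrite expr2; exact: cvgM.
by have := leW (pickle (j, k)) w; rewrite /u pickleK kj.
Qed.

End integral_differences.

(** * Uniqueness *)

(** Here 9 C comes from [stochastic_integral_diff] and L from [integrand_lip]; the condition 18 C L
    <= b makes 9 C L / b at most 1/2. *)
Lemma gronwall_halving (R : realType) (C L b A E : R) : 0 <= C -> 0 <= L ->
  0 <= A -> 0 <= E -> 18 * C * L <= b -> 0 < b ->
  9 * C * (L * A * (E / b)) <= A / 2 * E.
Proof.
move=> C0 L0 A0 E0 hb b0.
have -> : 9 * C * (L * A * (E / b)) = (18 * C * L / b) * (A / 2 * E).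
  by field; rewrite gt_eqF.
by rewrite ler_piMl ?mulr_ge0// ler_pdivrMr// mul1r.
Qed.

Section uniqueness.
Context (R : realType) (d : measure_display) (Omega : measurableType d).
Context (P : probability Omega R) (Pc : measure_is_complete P).
Context (T : R) (T0 : 0 < T).
Context (x0 : {RV P >-> R}) (z : R -> {RV P >-> R}) (a : R -> {RV P >-> nat}).
Context (hx0 : sq_integrable P x0).
Context (hz : levy_process T z) (hind : independent_data T x0 z a).
Context (hz2 : forall t, 0 <= t <= T -> sq_integrable P (z t)).
Context (m : nat) (ha : markov_chain T m a).
Context (sigma : R -> R -> probability R R -> R) (r : R -> R).
Context (hlip : lipschitz_on_P2 T sigma).
Context (hcag : forall (u : R) nu, in_P2 nu -> caglad_on T (fun t => sigma t u nu)).

Let C := levy_const T z.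

Let C0 : 0 <= C. Proof. exact: levy_const_ge0. Qed.

(** Passes from equality almost surely at each time to equality of paths: one null set serves for
    the countably many dyadic times, and right continuity covers the rest. *)
Lemma sup_processes_eq x y : sup_process T x0 z a x -> sup_process T x0 z a y ->
  (forall t, 0 <= t <= T -> Ex P (fun w => (x t w - y t w) ^+ 2) <= 0) ->
  {ae P, forall w, forall t, 0 <= t <= T -> x t w = y t w}.
Proof.
move=> hx hy h.
have hD : {ae P, forall w, forall j k, (k <= 2 ^ j)%N ->
    (x (dyadic T j k) w - y (dyadic T j k) w) ^+ 2 = 0}.
  apply: ae_foralln => j; apply: ae_foralln => k.
  have [kj|kj] := boolP (k <= 2 ^ j)%N; last by apply: aeW.
  have dT := dyadic_mem T0 kj.
  have := ae_eq0_Ex (L2_sq (L2B (sup_process_L2 Pc hx dT) (sup_process_L2 Pc hy dT)))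
    (fun w => sqr_ge0 _) (h _ dT).
  by apply: filterS => w e _.
have [_ cx _] := hx; have [_ cy _] := hy.
apply: filterS3 hD cx cy => w e [rx _] [ry _] t tT.
apply/eqP; rewrite -subr_eq0 -sqrf_eq0 eq_le sqr_ge0 andbT -lee_fin.
apply: (right_continuous_le T0 (f := fun t => (x t w - y t w) ^+ 2)) tT => [s sT|j k kj].
  have h1 : x t w - y t w @[t --> s^'+] --> x s w - y s w.
    by apply: cvgB; [exact: rx|exact: ry].
  by rewrite expr2; exact: cvgM.
by rewrite e.
Qed.

Let sqB (p q : R) : (p - q) ^+ 2 <= 2 * (p ^+ 2 + q ^+ 2).
Proof. by have := sqr_ge0 (p + q); rewrite !expr2; nra. Qed.

Lemma sup_processes_Ex_bounded x y :
  sup_process T x0 z a x -> sup_process T x0 z a y ->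
  exists2 A : R, 0 <= A & forall t, 0 <= t <= T ->
    Ex P (fun w => (x t w - y t w) ^+ 2) <= A.
Proof.
move=> hx hy; have [_ _ [W [iW W0 hW]]] := hx; have [_ _ [V [iV V0 hV]]] := hy.
have iWV : L1 P (fun w => 2 * (W w + V w)) by apply: L1Z; exact: L1D.
exists (Ex P (fun w => 2 * (W w + V w))).
  by apply: Ex_ge0 => w; rewrite mulr_ge0// addr_ge0.
move=> t tT; apply: Ex_ae_le => //.
  by apply: L2_sq; apply: L2B; [exact: (sup_process_L2 Pc hx)|exact: (sup_process_L2 Pc hy)].
apply: filterS2 hW hV => w h1 h2; apply: (le_trans (sqB _ _)).
by rewrite ler_pM2l// lerD ?h1 ?h2.
Qed.

Lemma strong_solution_unique x y :
  strong_solution T sigma r x0 z a x -> sup_sq_integrable P T x ->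
  strong_solution T sigma r x0 z a y -> sup_sq_integrable P T y ->
  {ae P, forall w, forall t, 0 <= t <= T -> x t w = y t w}.
Proof.
move=> sx ix sy iy.
have hx := strong_solution_sup_process Pc T0 sx ix.
have hy := strong_solution_sup_process Pc T0 sy iy.
have [nux [lx ex]] := sol_equation sx; have [nuy [ly ey]] := sol_equation sy.
have [rx _] := integrand_approx Pc T0 ha r hlip hcag hx lx.
have [ry _] := integrand_approx Pc T0 ha r hlip hcag hy ly.
have [L L0 hL] := integrand_lip Pc T0 x0 z ha r hlip hcag.
have [A A0 hA] := sup_processes_Ex_bounded hx hy.
(* The added 1 keeps b positive when C L vanishes. *)
pose b := 18 * C * L + 1.
have b0 : 0 < b by rewrite ltr_wpDl// !mulr_ge0.
have key n t : 0 <= t <= T ->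
    Ex P (fun w => (x t w - y t w) ^+ 2) <= A / 2 ^+ n * expR (b * t).
  elim: n t => [|n IH] t tT.
    rewrite expr0 divr1; apply: le_trans (hA t tT) _.
    by rewrite ler_peMr// -expR0 ler_expR mulr_ge0 ?(ltW b0)//; case/andP : tT.
  have An : 0 <= A / 2 ^+ n by rewrite divr_ge0// exprn_ge0.
  have hQ := hL x y nux nuy _ b hx hy lx ly An b0 IH t tT.
  have := stochastic_integral_diff Pc T0 hx0 hz hind hz2 rx ry tT
    (L2B (sup_process_L2 Pc hx tT) _) (L2B (sup_process_L2 Pc hy tT) _) ex ey hQ.
  move=> /(_ (conj (measurable_funPT _) hx0) (conj (measurable_funPT _) hx0)).
  under [X in Ex P X <= _ -> _]eq_fun do rewrite opprB addrA subrK.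
  move=> /le_trans; apply; rewrite exprSr invfM [A * (_ * _)]mulrA.
  by apply: gronwall_halving; rewrite ?expR_ge0// /b lerDl.
apply: sup_processes_eq => // t tT.
apply: (@le_geometric0 _ _ (A * expR (b * t))) => n.
by rewrite mulrAC; exact: key.
Qed.

End uniqueness.

(** * Existence *)

(* [u k + g k] decreases, [u k - g k] increases, and they have the same limit, where
   [g k = 2 s / 2 ^ k]. *)
Lemma geometric_increments (R : realType) (u : nat -> R) (s : R) :
  (forall k, `|u k.+1 - u k| <= s * 2^-1 ^+ k) ->
  u n @[n --> \oo] --> lim (u n @[n --> \oo]) /\
  forall k, `|u k - lim (u n @[n --> \oo])| <= 2 * s * 2^-1 ^+ k.
Proof.
move=> h.
have s0 : 0 <= s by have := h 0%N; rewrite expr0 mulr1; apply: le_trans.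
pose g k : R := 2 * s * 2^-1 ^+ k.
have g0 k : 0 <= g k by rewrite !mulr_ge0// exprn_ge0// invr_ge0.
have gS k : g k - g k.+1 = s * 2^-1 ^+ k by rewrite /g exprS; field.
have gcvg : g n @[n --> \oo] --> (0 : R).
  by apply: cvg_geometric; rewrite ger0_norm ?invr_ge0// invf_lt1// ltr1n.
have pn : nonincreasing_seq (fun k => u k + g k).
  apply/nonincreasing_seqP => k; have := h k; rewrite -gS ler_norml.
  by move=> /andP[_]; lra.
have qn : nondecreasing_seq (fun k => u k - g k).
  apply/nondecreasing_seqP => k; have := h k; rewrite -gS ler_norml.
  by move=> /andP[]; lra.
have pcvg : cvgn (fun k => u k + g k).
  apply: nonincreasing_is_cvgn pn _; exists (u 0%N - g 0%N) => _ [k _ <-].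
  apply: (le_trans (qn 0%N k (leq0n k))).
  by have := g0 k; lra.
have ucvg : u n @[n --> \oo] --> lim (u n + g n @[n --> \oo]).
  rewrite [X in X @ _](_ : u = fun n => (u n + g n) - g n); last first.
    by apply/funext => n; rewrite addrK.
  by rewrite -[X in _ --> X]subr0; apply: cvgB.
have qlim : u n - g n @[n --> \oo] --> lim (u n + g n @[n --> \oo]).
  by rewrite -[X in _ --> X]subr0; apply: cvgB.
have -> : lim (u n @[n --> \oo]) = lim (u n + g n @[n --> \oo]) by exact: cvg_lim ucvg.
split => // k; rewrite ler_norml -/(g k).
have h1 := nonincreasing_cvgn_ge pn pcvg k.
have h2 : u k - g k <= lim (u n + g n @[n --> \oo]).
  have := nondecreasing_cvgn_le qn (cvgP _ qlim) k.
  by rewrite (cvg_lim _ qlim).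
by move: h1 h2; lra.
Qed.

Lemma cvge0_geometric (R : realType) (u : nat -> \bar R) (c q : R) :
  0 <= q < 1 -> (forall n, (0 <= u n)%E) -> (forall n, (u n <= (c * q ^+ n)%:E)%E) ->
  (u n @[n --> \oo] --> 0)%E.
Proof.
move=> /andP[q0 q1] u0 hu.
apply: (@squeeze_cvge _ _ _ _ (fun=> 0%E) u (fun n => (c * q ^+ n)%:E)).
- by apply: nearW => n; rewrite u0 hu.
- exact: cvg_cst.
- apply: cvg_EFin; first exact: nearW.
  by apply: cvg_geometric; rewrite ger0_norm.
Qed.

(** With q = 8^-k, the right side is A E q / 8. The condition 48 C L <= b makes the Lipschitz term
    at most half of it, and 96 C <= A lets the other half absorb the approximation errors, which
    amount to 27 C q / 8. *)
Lemma picard_arith (R : realType) (C L A b E q : R) : 0 <= C -> 0 <= A ->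
  0 <= q -> 96 * C <= A -> 48 * C * L <= b -> 0 < b -> 1 <= E ->
  C * (3 * (8^-1 * q + L * (A * q) * (E / b) + q)) <= A * (8^-1 * q) * E.
Proof.
move=> C0 A0 q0 hA hb b0 E1.
have E0 : 0 <= E by exact: le_trans E1.
have CL : C * L / b <= 48^-1 by rewrite ler_pdivrMr//; move: hb; lra.
have h1 : C * L / b * (A * E) <= 48^-1 * (A * E) by rewrite ler_wpM2r// mulr_ge0.
have h2 : 96 * C <= A * E by apply: (le_trans hA); rewrite ler_peMr.
have -> : C * (3 * (8^-1 * q + L * (A * q) * (E / b) + q)) =
    q * (C * (3 * (8^-1 + 1)) + 3 * (C * L / b * (A * E))).
  by field; rewrite gt_eqF.
have -> : A * (8^-1 * q) * E = q * (8^-1 * (A * E)) by ring.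
by rewrite ler_wpM2l//; move: h1 h2 C0; lra.
Qed.

Section existence.
Context (R : realType) (d : measure_display) (Omega : measurableType d).
Context (P : probability Omega R) (Pc : measure_is_complete P).
Context (T : R) (T0 : 0 < T).
Context (x0 : {RV P >-> R}) (z : R -> {RV P >-> R}) (a : R -> {RV P >-> nat}).
Context (hx0 : sq_integrable P x0).
Context (hz : levy_process T z) (hind : independent_data T x0 z a).
Context (hz2 : forall t, 0 <= t <= T -> sq_integrable P (z t)).

Let F := data_filtration x0 z a.

Lemma sup_process_sup_sq x : sup_process T x0 z a x -> sup_sq_integrable P T x.
Proof.
move=> [_ _ [W [iW W0 hW]]].
have hE : (\int[P]_w (W w)%:E < +oo)%E by rewrite Ex_int// ltry.
apply: le_lt_trans hE; apply: ae_ge0_mono_integral.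
- move=> w; apply: le_ereal_sup_tmp; exists (x 0 w ^+ 2)%:E; last by rewrite lee_fin sqr_ge0.
  by exists 0 => //=; rewrite in_itv/= lexx ltW.
- by move=> w; rewrite lee_fin.
- by apply/measurable_EFinP; exact: L1_meas iW.
- apply: filterS hW => w hw; apply: ge_ereal_sup => u /= [t].
  by rewrite in_itv/= => tT <-; rewrite lee_fin hw.
Qed.

Definition left_law (x : R -> Omega -> R) t : probability R R :=
  lawof P (left_proc x t).

Lemma left_lawP x : sup_process T x0 z a x -> left_laws P T x (left_law x).
Proof. by move=> hx t tT; apply: lawofP; exact: (left_proc_meas Pc T0 hx tT). Qed.

Definition limit_proc (Y : nat -> R -> Omega -> R) (t : R) (w : Omega) : R :=
  lim (Y n t w @[n --> \oo]).

(** The bound on the increments is uniform in time, so the convergence is uniform and the limit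
    inherits cadlag paths; adaptedness survives an almost sure limit because the filtration contains
    the null sets. The 4 is the square of the 2 in [geometric_increments]. *)
Lemma sup_process_limit (Y : nat -> R -> Omega -> R) (W : Omega -> R) :
  (forall k, sup_process T x0 z a (Y k)) -> L1 P W -> (forall w, 0 <= W w) ->
  {ae P, forall w, forall k t, 0 <= t <= T ->
    `|Y k.+1 t w - Y k t w| <= Num.sqrt (W w) * 2^-1 ^+ k} ->
  sup_process T x0 z a (limit_proc Y) /\ forall k t, 0 <= t <= T ->
    Ex P (fun w => (Y k t w - limit_proc Y t w) ^+ 2) <= 4 * Ex P W * 4^-1 ^+ k.
Proof.
move=> hY iW W0 hW; set x := limit_proc Y.
have hlim : {ae P, forall w, forall t, 0 <= t <= T ->
    Y n t w @[n --> \oo] --> x t w /\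
    forall k, `|Y k t w - x t w| <= 2 * Num.sqrt (W w) * 2^-1 ^+ k}.
  apply: filterS hW => w hw t tT.
  by apply: (geometric_increments (u := fun k => Y k t w)) => k; exact: hw.
have hsq : {ae P, forall w, forall k t, 0 <= t <= T ->
    (Y k t w - x t w) ^+ 2 <= 4 * W w * 4^-1 ^+ k}.
  apply: filterS hlim => w hw k t tT; have [_ /(_ k) h] := hw t tT.
  have := ler_pM (normr_ge0 _) (normr_ge0 _) h h.
  rewrite -expr2 real_normK ?num_real// => /le_trans; apply.
  rewrite -expr2 !exprMn sqr_sqrtr// -exprM mulnC exprM !exprVn.
  by rewrite (_ : 2 ^+ 2 = 4 :> R)// -natrX.
have hx : sup_process T x0 z a x.
  split.
  - move=> t tT; apply: (gmeas_cvg_ae _ (X_ := fun k => Y k t)).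
    + by move=> N; exact: filtration_null.
    + by move=> k; have [h _ _] := hY k; exact: h.
    + by apply: filterS hlim => w /(_ t tT)[].
  - have hc : {ae P, forall w, forall k, cadlag_on T (Y k ^~ w)}.
      by apply: ae_foralln => k; have [] := hY k.
    apply: filterS2 hc hlim => w hcw hw.
    apply: (cadlag_on_uniform_limit hcw (e := fun k => 2 * Num.sqrt (W w) * 2^-1 ^+ k)).
      by apply: cvg_geometric; rewrite ger0_norm ?invr_ge0// invf_lt1// ltr1n.
    by move=> n t tT; have [_] := hw t tT.
  - have [_ _ [V [iV V0 hV]]] := hY 0%N.
    exists (fun w => 2 * (V w + 4 * W w)); split.
    + by apply: L1Z; apply: L1D => //; exact: L1Z.
    + by move=> w; rewrite mulr_ge0// addr_ge0// mulr_ge0.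
    + apply: filterS2 hV hsq => w h1 h2 t tT.
      have := h1 t tT; have := h2 0%N t tT; rewrite expr0 mulr1.
      have := sqr_ge0 (2 * Y 0%N t w - x t w); rewrite !expr2; nra.
split => // k t tT.
have -> : 4 * Ex P W * 4^-1 ^+ k = Ex P (fun w => 4 * 4^-1 ^+ k * W w).
  by rewrite ExZ// mulrAC.
apply: Ex_ae_le; last 1 first.
- by apply: filterS hsq => w /(_ k t tT); rewrite mulrAC.
- by apply: L2_sq; apply: L2B; [exact: (sup_process_L2 Pc (hY k))|exact: (sup_process_L2 Pc hx)].
- exact: L1Z.
Qed.

Context (m : nat) (ha : markov_chain T m a).
Context (sigma : R -> R -> probability R R -> R) (r : R -> R).
Context (hlip : lipschitz_on_P2 T sigma).
Context (hcag : forall (u : R) nu, in_P2 nu -> caglad_on T (fun t => sigma t u nu)).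

Let H x := integrand a sigma r x (left_law x).
Let C := levy_const T z.

Let C0 : 0 <= C. Proof. exact: levy_const_ge0. Qed.

(** Each iterate after the first is [x0] plus a finite sum, whose paths and adaptedness are
    explicit. *)
Record picard (X : nat -> R -> Omega -> R) (phi : nat -> simple_process P T F) := {
  picard0 : X 0%N = fun=> x0;
  picardS : forall k, X k.+1 = fun t w => x0 w + sp_integral (phi k) z t w;
  picard_sup : forall k, sup_process T x0 z a (X k);
  picard_err : forall k,
    (sqnorm P (fun s w => (sp_val (phi k) s w - H (X k) s w)%R) T <= (8^-1 ^+ k)%:E)%E
}.

Lemma picard_exists : exists X phi, picard X phi.
Proof.
have e0 k : (0 : R) < 8^-1 ^+ k by rewrite exprn_gt0// invr_gt0.
(* The choice function must be defined on all processes, before the iterates are known to be good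
   ones. For a bad process any step process will do, such as one obtained from the constant process
   [x0]. *)
have pe (xk : (R -> Omega -> R) * nat) : exists phi : simple_process P T F,
    sup_process T x0 z a xk.1 ->
    (sqnorm P (fun s w => (sp_val phi s w - H xk.1 s w)%R) T <= (8^-1 ^+ xk.2)%:E)%E.
  case: xk => x k /=.
  have [hx|hx] := pselect (sup_process T x0 z a x).
    have [_ /(_ _ (e0 k))[phi hphi]] := integrand_approx Pc T0 ha r hlip hcag hx (left_lawP hx).
    by exists phi.
  have h0 := sup_process_cst T z a hx0.
  have [_ /(_ _ (e0 k))[phi _]] := integrand_approx Pc T0 ha r hlip hcag h0 (left_lawP h0).
  by exists phi.
have [ph hph] := choice pe.
pose X := fix X k := match k with
  | 0%N => fun=> (x0 : Omega -> R)
  | k.+1 => fun t w => x0 w + sp_integral (ph (X k, k)) z t w end.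
have hX k : sup_process T x0 z a (X k).
  case: k => [|k]; first exact: sup_process_cst.
  exact: sup_process_integral.
exists X, (fun k => ph (X k, k)); split => // k.
exact: (hph (X k, k) (hX k)).
Qed.

(** The indices start at [k.+2] and [k.+1] because only then is the increment the integral of a
    difference of two step processes; X 1 - X 0 enters only through its bounded mean square. *)
Lemma picard_increments X phi : picard X phi ->
  exists W : Omega -> R, [/\ L1 P W, forall w, 0 <= W w &
    {ae P, forall w, forall k t, 0 <= t <= T ->
      `|X k.+2 t w - X k.+1 t w| <= Num.sqrt (W w) * 2^-1 ^+ k}].
Proof.
move=> [X0 XS hX hphi].
have [L L0 hL] := integrand_lip Pc T0 x0 z ha r hlip hcag.
have [A0 A00 hA0] := sup_processes_Ex_bounded Pc (hX 1%N) (hX 0%N).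
(* [A0] starts the induction at k = 0; 96 and 48 are the thresholds of [picard_arith]. *)
pose A := A0 + 96 * C; pose b := 48 * C * L + 1.
have A_ge0 : 0 <= A by rewrite addr_ge0// mulr_ge0.
have b0 : 0 < b by rewrite ltr_wpDl// !mulr_ge0.
have q0 k : 0 <= 8^-1 ^+ k :> R by rewrite exprn_ge0// invr_ge0.
have incrE k t w : X k.+2 t w - X k.+1 t w =
    sp_integral (phi k.+1) z t w - sp_integral (phi k) z t w.
  by rewrite !XS opprD addrACA subrr add0r.
have step k t : 0 <= t <= T ->
    (forall u, 0 <= u <= T ->
      Ex P (fun w => (X k.+1 u w - X k u w) ^+ 2) <= A * 8^-1 ^+ k * expR (b * u)) ->
    (C%:E * sqnorm P (fun s w => (sp_val (phi k.+1) s w - sp_val (phi k) s w)%R) t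
      <= (A * 8^-1 ^+ k.+1 * expR (b * t))%:E)%E.
  move=> tT hk; have tT' : t <= T by case/andP : tT.
  have hx := hX k; have hy := hX k.+1.
  have [rx _] := integrand_approx Pc T0 ha r hlip hcag hx (left_lawP hx).
  have [ry _] := integrand_approx Pc T0 ha r hlip hcag hy (left_lawP hy).
  have rp := sp_val_regular Pc (phi k); have rq := sp_val_regular Pc (phi k.+1).
  have h1 := le_trans (sqnorm_mono_time P
    (fun s w => sp_val (phi k.+1) s w - H (X k.+1) s w) tT') (hphi k.+1).
  have h3 := le_trans (sqnorm_mono_time P
    (fun s w => sp_val (phi k) s w - H (X k) s w) tT') (hphi k).
  rewrite sqnormBC in h3.
  have h2 := hL _ _ _ _ _ b hy hx (left_lawP hy) (left_lawP hx)
    (mulr_ge0 A_ge0 (q0 k)) b0 hk t tT.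
  apply: (@le_trans _ _ (C%:E * (3 * (8^-1 ^+ k.+1 +
      L * (A * 8^-1 ^+ k) * (expR (b * t) / b) + 8^-1 ^+ k))%:E)%E).
    rewrite lee_wpmul2l ?lee_fin//.
    apply: (le_trans (sqnorm_sum3 tT' (regularB rq ry) (regularB ry rx)
      (regularB rx rp) _)).
      by apply: aeW => w s _; ring.
    rewrite [leRHS]EFinM lee_wpmul2l ?lee_fin// !EFinD.
    by apply: leeD => //; exact: leeD.
  rewrite -EFinM lee_fin exprS; apply: picard_arith => //.
  - by rewrite /A lerDr.
  - by rewrite /b lerDl.
  - by rewrite -expR0 ler_expR mulr_ge0 ?(ltW b0)//; case/andP : tT.
have Ek k u : 0 <= u <= T ->
    Ex P (fun w => (X k.+1 u w - X k u w) ^+ 2) <= A * 8^-1 ^+ k * expR (b * u).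
  elim: k u => [|k IH] u uT.
    apply: le_trans (hA0 u uT) _; rewrite expr0 mulr1.
    apply: (@le_trans _ _ A); first by rewrite /A lerDl mulr_ge0.
    by rewrite ler_peMr// -expR0 ler_expR mulr_ge0 ?(ltW b0)//; case/andP : uT.
  under [X in Ex P X]eq_fun do rewrite incrE.
  have [/(_ u uT)[_ h] _] := sp_integral_diff Pc T0 hz hind hz2 (phi k.+1) (phi k).
  by rewrite -lee_fin; apply: (le_trans h); exact: step.
pose B := A * expR (b * T).
have B0 : 0 <= B by rewrite mulr_ge0// expR_ge0.
have hV k : exists V : Omega -> R, [/\ L1 P V, forall w, 0 <= V w,
    Ex P V <= B * 8^-1 ^+ k & {ae P, forall w, forall t, 0 <= t <= T ->
      (X k.+2 t w - X k.+1 t w) ^+ 2 <= V w}].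
  have [_ [V [iV V0 eV hV]]] := sp_integral_diff Pc T0 hz hind hz2 (phi k.+1) (phi k).
  exists V; split => //.
    have TT : 0 <= T <= T by rewrite lexx ltW.
    rewrite -lee_fin; apply: (le_trans eV); apply: (le_trans (step k T TT (Ek k))).
    rewrite lee_fin /B exprS mulrAC ler_wpM2l// ler_piMl//.
    by rewrite invf_le1// ler1n.
  by apply: filterS hV => w hw t tT; rewrite incrE; exact: hw.
have [V {}hV] := choice hV.
have iV k : L1 P (V k) by have [] := hV k.
have V0 k w : 0 <= V k w by have [] := hV k.
(* The mean of [V k] is at most B 8^-k, so the weight 4^k still leaves a series of bounded mean.
   Each single term is then below [W], which gives sqrt (W) 2^-k after taking roots. *)
pose S n w := \sum_(k < n) 4 ^+ k * V k w.
have iS n : L1 P (S n) by apply: L1_sum => k; exact: L1Z.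
have S0 n w : 0 <= S n w by apply: sumr_ge0 => k _; rewrite mulr_ge0// exprn_ge0.
have eS n : Ex P (S n) <= 2 * B.
  (* The exact partial sum of the geometric series, a form that is stable under induction. *)
  suff : Ex P (S n) <= B * (2 - 2 * 2^-1 ^+ n).
    move=> /le_trans; apply; rewrite mulrC ler_wpM2r// gerDl oppr_le0 mulr_ge0//.
  elim: n => [|n IH].
    rewrite expr0 mulr1 subrr mulr0 /S; under eq_fun do rewrite big_ord0.
    by rewrite Ex_cst.
  rewrite /S; under eq_fun do rewrite big_ord_recr/=.
  rewrite ExD; [|exact: iS|exact: L1Z].
  have hn : Ex P (fun w => 4 ^+ n * V n w) <= B * 2^-1 ^+ n.
    rewrite ExZ//; have [_ _ h _] := hV n.
    apply: (@le_trans _ _ (4 ^+ n * (B * 8^-1 ^+ n))); first by rewrite ler_wpM2l// exprn_ge0.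
    rewrite mulrCA -exprMn (_ : 4 * 8^-1 = 2^-1 :> R)//; lra.
  apply: (le_trans (lerD IH hn)).
  by rewrite exprS -mulrDr ler_wpM2l//; lra.
have [W [iW W0 _ hW]] := liminf_dominating iS S0 eS.
exists W; split => //.
have hV' : {ae P, forall w, forall k, forall t, 0 <= t <= T ->
    (X k.+2 t w - X k.+1 t w) ^+ 2 <= V k w}.
  by apply: ae_foralln => k; have [] := hV k.
apply: filterS2 hW hV' => w hw hv k t tT.
have h4 : 4 ^+ k * V k w <= W w.
  apply: hw; exists k.+1 => // n /= kn.
  rewrite /S (bigD1 (Ordinal kn))//= lerDl.
  by apply: sumr_ge0 => i _; rewrite mulr_ge0// exprn_ge0.
rewrite -sqrtr_sqr -[2^-1 ^+ k]ger0_norm ?exprn_ge0 ?invr_ge0//.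
rewrite -[X in _ * X]sqrtr_sqr -sqrtrM// ler_sqrt; last first.
  by rewrite mulr_ge0// sqr_ge0.
apply: (le_trans (hv k t tT)).
rewrite -exprM mulnC exprM exprVn (_ : 2 ^+ 2 = 4 :> R); last by rewrite -natrX.
by rewrite exprVn ler_pdivlMr ?exprn_gt0// mulrC.
Qed.

(** The step processes of the iteration serve as the approximating sequence of the Ito integral: the
    same [phi k] is close to the integrand of X k and has integral X (k + 1) - x0. *)
Lemma strong_solution_exists :
  exists x, strong_solution T sigma r x0 z a x /\ sup_sq_integrable P T x.
Proof.
have [X [phi hXphi]] := picard_exists.
have [W [iW W0 hW]] := picard_increments hXphi.
have [X0 XS hX hphi] := hXphi.
pose Y k := X k.+1.
have [hx hYx] := sup_process_limit (Y := Y) (fun k => hX k.+1) iW W0 hW.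
set x := limit_proc Y in hx hYx.
exists x; split; last exact: sup_process_sup_sq hx.
have [ax cx _] := hx.
have YE n t w : sp_integral (phi n) z t w = Y n t w - x0 w.
  by rewrite /Y XS addrC addKr.
split => //.
- apply: aeW => w; rewrite /x /limit_proc.
  have -> : (fun n => Y n 0 w) = fun=> x0 w.
    by apply/funext => n; rewrite /Y XS sp_integral0 addr0.
  exact: lim_cst.
- exists (left_law x); split; first exact: left_lawP.
  have [L L0 hL] := integrand_lip Pc T0 x0 z ha r hlip hcag.
  pose A := 4 * Ex P W.
  have A0 : 0 <= A by rewrite mulr_ge0// Ex_ge0.
  have q0 k : 0 <= 4^-1 ^+ k :> R by rewrite exprn_ge0// invr_ge0.
  have q01 : 0 <= (4^-1 : R) < 1 by apply/andP; split; lra.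
  (* The shift matches [Y n], which is X (n + 1): the step process [phi n.+1] approximates its
     integrand. *)
  exists (fun n => phi n.+1); split.
    apply: (cvge0_geometric (c := 3 * (1 + L * A * expR T)) q01) => n.
      by apply: integral_ge0 => w _; apply: integral_ge0 => s _; rewrite lee_fin sqr_ge0.
    have hy := hX n.+1.
    have [rx _] := integrand_approx Pc T0 ha r hlip hcag hx (left_lawP hx).
    have [ry _] := integrand_approx Pc T0 ha r hlip hcag hy (left_lawP hy).
    have rq := sp_val_regular Pc (phi n.+1).
    have TT : 0 <= T <= T by rewrite lexx ltW.
    have hn u : 0 <= u <= T ->
        Ex P (fun w => (Y n u w - x u w) ^+ 2) <= A * 4^-1 ^+ n * expR (1 * u).
      move=> uT; apply: (le_trans (hYx n u uT)); apply: ler_peMr; first exact: mulr_ge0.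
      by rewrite -[leLHS]expR0 ler_expR mul1r; case/andP : uT.
    (* No contraction is sought here, so the weight b = 1 is enough. *)
    have h2 := hL _ _ _ _ _ 1 hy hx (left_lawP hy) (left_lawP hx)
      (mulr_ge0 A0 (q0 n)) ltr01 hn T TT.
    have h3 : sqnorm P (fun s w => H x s w - H x s w) T = 0%E.
      rewrite /sqnorm integral0_eq// => w _; rewrite integral0_eq// => s _.
      by rewrite subrr expr0n.
    rewrite sqnorm_closed; last exact: regularB.
    apply: (le_trans (sqnorm_sum3 (lexx T) (regularB rq ry) (regularB ry rx)
      (regularB rx rx) _)).
      (* A single intermediate process occurs; a zero summand completes the three terms. *)
      apply: aeW => w s _; have e3 (p q v : R) : p - v = (p - q) + (q - v) + (v - v) by ring.
      exact: e3.
    rewrite h3 adde0.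
    apply: (@le_trans _ _ (3 * ((8^-1 ^+ n.+1)%:E +
      (L * (A * 4^-1 ^+ n) * (expR (1 * T) / 1))%:E))%E).
      by rewrite lee_wpmul2l ?lee_fin//; exact: leeD.
    rewrite -EFinD -EFinM lee_fin mul1r -[leRHS]mulrA.
    rewrite ler_wpM2l// mulrDl mul1r divr1.
    apply: lerD; last by rewrite mulrA mulrAC.
    rewrite exprS; apply: (@le_trans _ _ (8^-1 ^+ n)).
      by rewrite ler_piMl ?exprn_ge0 ?invr_ge0// invf_le1// ler1n.
    by rewrite lerXn2r ?nnegrE ?invr_ge0// lef_pV2 ?posrE// ler_nat.
  move=> t tT; apply: (cvge0_geometric (c := A) q01) => n.
    by apply: integral_ge0 => w _; rewrite lee_fin sqr_ge0.
  have iD := L2_sq (L2B (sup_process_L2 Pc (hX n.+2) tT) (sup_process_L2 Pc hx tT)).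
  have E w : sp_integral (phi n.+1) z t w - (x t w - x0 w) = X n.+2 t w - x t w.
    by rewrite YE /Y opprB addrA subrK.
  under eq_integral do rewrite E.
  rewrite Ex_int// lee_fin; apply: (le_trans (hYx n.+1 t tT)).
  by rewrite ler_wpM2l// exprS ler_piMl// ltW//; case/andP : q01.
Qed.

End existence.

Theorem proposition2p1 (R : realType) (d : measure_display)
    (Omega : measurableType d) (P : probability Omega R)
    (hP : measure_is_complete P)
    (T : R) (hT : 0 < T)
    (m : nat)
    (x0 : {RV P >-> R}) (z : R -> {RV P >-> R}) (a : R -> {RV P >-> nat})
    (sigma : R -> R -> probability R R -> R) (r : R -> R)
    (hx0 : sq_integrable P x0)
    (hz : levy_process T z)
    (ha : markov_chain T m a)
    (hind : independent_data T x0 z a)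
    (hr_cont : continuous r) (hr_pos : forall y, 0 < r y)
    (hz2 : forall t, 0 <= t <= T -> sq_integrable P (z t))
    (hsigma_lip : lipschitz_on_P2 T sigma)
    (hsigma_caglad : forall x nu, in_P2 nu ->
       caglad_on T (fun t => sigma t x nu))
    (hsigma0 : (\int[lebesgue_measure]_(s in `[0%R, T])
       ((`|sigma s 0%R \d_(0%R : R)| ^+ 2)%:E) < +oo)%E) :
  (exists x : R -> Omega -> R,
      strong_solution T sigma r x0 z a x /\ sup_sq_integrable P T x) /\
  (forall x y : R -> Omega -> R,
      strong_solution T sigma r x0 z a x -> sup_sq_integrable P T x ->
      strong_solution T sigma r x0 z a y -> sup_sq_integrable P T y ->
      \forall w \ae P, forall t, 0 <= t <= T -> x t w = y t w).
Proof.
split.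
  exact: (strong_solution_exists hP hT hx0 hz hind hz2 ha r hsigma_lip hsigma_caglad).
move=> x y hx ix hy iy.
exact: (strong_solution_unique hP hT hx0 hz hind hz2 ha hsigma_lip hsigma_caglad
  hx ix hy iy).
Qed.
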